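(* Let $(\mathbb{CP}^2 \# \overline{\mathbb{CP}^2}, g_P)$ be the Page space, and for $x_0\in(-1,1)$ let $\Sigma_{x_0}=\{x=x_0\}$ be its surfaces of homogeneity. Exactly one of the hypersurfaces $\Sigma_{x_0}$, $x_0\in(-1,1)$, is minimal, and this minimal hypersurface is a Berger sphere. It is totally geodesic, and the spectrum of its stability operator $L$ can be computed explicitly; in particular, it has index $1$ and nullity $0$.
   Context: **The Page space.** Let $\nu\approx 0.281702$ be the unique positive root of $\nu^4+4\nu^3-6\nu^2+12\nu-3=0$. The Page space is the closed manifold $\mathbb{CP}^2\#\overline{\mathbb{CP}^2}$ (the non-trivial $S^2$-bundle over $S^2$) with the metric given in local coordinates $(x,\psi,\theta,\phi)$, $x\in(-1,1)$, $\theta\in(0,\pi)$, by $$g_P=S\left[\frac{dx^2}{A(x)}+4\alpha^2A(x)\left(d\psi+\frac{\cos\theta}{2}\,d\phi\right)^2+B(x)\left(d\theta^2+\sin^2\theta\,d\phi^2\right)\right],$$ where $$A(x)=\frac{(3-\nu^2-\nu^2(1+\nu^2)x^2)(1-x^2)}{1-\nu^2x^2},\qquad B(x)=\frac{1-\nu^2x^2}{3+6\nu^2-\nu^4},$$ $$S=\frac{3(1+\nu^2)}{\Lambda},\qquad \alpha=\frac{1}{2(3+\nu^2)},$$ and the normalization $\Lambda=3$ is fixed, so that $\mathrm{Ric}(g_P)=3g_P$. The coordinates are identified by $(\psi,\phi)\sim(\psi+\pi,\phi+2\pi)$ and $(\psi,\phi)\sim(\psi+2\pi,\phi)$. With these identifications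 $g_P$ extends to a globally smooth metric; the Killing field $\partial_\psi$ degenerates smoothly at $x=\pm1$. The metric is of cohomogeneity one under the isometry group $SU(2)\times U(1)$. The surfaces of homogeneity (principal orbits) are the level sets $\Sigma_{x_0}=\{x=x_0\}$, $x_0\in(-1,1)$, each diffeomorphic to $S^3$ (the total space of a circle bundle of Chern number $1$ over $S^2$, with $\psi$ parameterizing the fibres). **Berger sphere.** $S^3$ with a homogeneous metric of the form $a(d\theta^2+\sin^2\theta\,d\phi^2)+c(d\psi+\tfrac{\cos\theta}{2}d\phi)^2$, with $a,c>0$ constants and the identifications $(\psi,\phi)\sim(\psi+\pi,\phi+2\pi)$ and $(\psi,\phi)\sim(\psi+2\pi,\phi)$ of $(\psi,\phi)$. **Minimal hypersurfaces and stability.** For a two-sided hypersurface $\Sigma$ in $(M,g)$ with unit normal $n$ and induced metric $h$, the second fundamental form is $K(X,Y)=g(\nabla_Xn,Y)$ for $X,Y$ tangent to $\Sigma$, and the mean curvature is $H_\Sigma=\mathrm{Tr}_hK$. $\Sigma$ is minimal if $H_\Sigma=0$ and totally geodesic if $K=0$. The stability (Jacobi) operator of a closed two-sided minimal hypersurface, acting on $C^\infty(\Sigma)$, is $$L=-\Delta_\Sigma-\left(\mathrm{Ric}(n,n)+\mathrm{Tr}(K^2)\right),\qquad \mathrm{Tr}(K^2)=K_{ij}K^{ij},$$ where $\Delta_\Sigma$ is the Laplace–Beltrami operator of $h$ (with nonpositive spectrum). The index is the number of negative eigenvalues of $L$ counted with multiplicity, equivalently the maximal dimension of a subspace of $C^\infty(\Sigma)$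 on which the quadratic form of $L$ is negative definite. The nullity is $\dim\ker L$. *)

(* Defs.v *)
From HB Require Import structures.
From mathcomp Require Import all_boot all_order all_algebra.
From mathcomp Require Import all_classical all_reals all_analysis.

Set Implicit Arguments.
Unset Strict Implicit.
Unset Printing Implicit Defensive.

Import Order.TTheory GRing.Theory Num.Theory.
Import numFieldNormedType.Exports.

Local Open Scope classical_set_scope.
Local Open Scope ring_scope.

(** * Riemannian geometry in a coordinate chart

    Points of a chart are row vectors, and a metric is the matrix-valued
    function [G] of its components [G p i j = g(d_i, d_j)]. Only the values of
    [G] on the (open) chart domain matter. *)

Definition pderiv (R : realType) (n : nat) (i : 'I_n) (f : 'rV[R]_n -> R)
    (p : 'rV[R]_n) : R :=
  'D_(delta_mx 0 i) f p.

(** [christoffel G k i j] is $\Gamma^k_{ij}$. *)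
Definition christoffel (R : realType) (n : nat) (G : 'rV[R]_n -> 'M[R]_n)
    (k i j : 'I_n) (p : 'rV[R]_n) : R :=
  2^-1 * \sum_(l < n) invmx (G p) k l *
    (pderiv i (fun q => G q j l) p + pderiv j (fun q => G q i l) p
     - pderiv l (fun q => G q i j) p).

(** Sign convention: the unit sphere of dimension [n] has [Ric = (n - 1) g]. *)
Definition ricci (R : realType) (n : nat) (G : 'rV[R]_n -> 'M[R]_n)
    (p : 'rV[R]_n) : 'M[R]_n :=
  \matrix_(i, j)
    (\sum_(k < n) (pderiv k (christoffel G k i j) p
                   - pderiv j (christoffel G k i k) p)
     + \sum_(k < n) \sum_(l < n)
         (christoffel G k k l p * christoffel G l i j p
          - christoffel G k j l p * christoffel G l i k p)).

(** [covderiv G v X p] is the vector $\nabla_v X$ at [p]. *)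
Definition covderiv (R : realType) (n : nat) (G : 'rV[R]_n -> 'M[R]_n)
    (v : 'rV[R]_n) (X : 'rV[R]_n -> 'rV[R]_n) (p : 'rV[R]_n) : 'rV[R]_n :=
  \row_k ('D_v (fun q => X q 0 k) p
          + \sum_(i < n) \sum_(j < n) christoffel G k i j p * v 0 i * X p 0 j).

Definition bilin (R : realType) (n : nat) (g : 'M[R]_n) (v w : 'rV[R]_n) : R :=
  (v *m g *m w^T) 0 0.

(** $\Delta f = (\det h)^{-1/2}\,\partial_i((\det h)^{1/2} h^{ij}\partial_j f)$ *)
Definition laplace_beltrami (R : realType) (n : nat) (h : 'rV[R]_n -> 'M[R]_n)
    (f : 'rV[R]_n -> R) (y : 'rV[R]_n) : R :=
  (Num.sqrt (\det (h y)))^-1 *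
  \sum_(i < n) pderiv i (fun z => Num.sqrt (\det (h z)) *
                           \sum_(j < n) invmx (h z) i j * pderiv j f z) y.

(** ** The level sets of the first coordinate

    [slice x y] is the point with coordinates [y] of the hypersurface
    $\{x_0 = x\}$; the tangent directions are the coordinates
    [rshift 1 i]. *)

Definition slice (R : realType) (n : nat) (x : R) (y : 'rV[R]_n) :
    'rV[R]_(1 + n) :=
  row_mx x%:M y.

Definition induced_metric (R : realType) (n : nat)
    (G : 'rV[R]_(1 + n) -> 'M[R]_(1 + n)) (x : R) (y : 'rV[R]_n) : 'M[R]_n :=
  drsubmx (G (slice x y)).

(** $\nabla x_0/|\nabla x_0|$, the unit normal of all the level sets. *)
Definition unit_normal (R : realType) (n : nat)
    (G : 'rV[R]_(1 + n) -> 'M[R]_(1 + n)) (p : 'rV[R]_(1 + n)) :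
    'rV[R]_(1 + n) :=
  (Num.sqrt (invmx (G p) ord0 ord0))^-1 *: row ord0 (invmx (G p)).

(** $K(X, Y) = g(\nabla_X n, Y)$ *)
Definition second_fundamental_form (R : realType) (n : nat)
    (G : 'rV[R]_(1 + n) -> 'M[R]_(1 + n)) (x : R) (y : 'rV[R]_n) : 'M[R]_n :=
  \matrix_(i, j)
    bilin (G (slice x y))
      (covderiv G (delta_mx 0 (rshift 1 i)) (unit_normal G) (slice x y))
      (delta_mx 0 (rshift 1 j)).

Definition mean_curvature (R : realType) (n : nat)
    (G : 'rV[R]_(1 + n) -> 'M[R]_(1 + n)) (x : R) (y : 'rV[R]_n) : R :=
  \tr (invmx (induced_metric G x y) *m second_fundamental_form G x y).

(** $K_{ij}K^{ij}$ *)
Definition tr_K2 (R : realType) (n : nat)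
    (G : 'rV[R]_(1 + n) -> 'M[R]_(1 + n)) (x : R) (y : 'rV[R]_n) : R :=
  let A := invmx (induced_metric G x y) *m second_fundamental_form G x y in
  \tr (A *m A).

Definition ricci_nn (R : realType) (n : nat)
    (G : 'rV[R]_(1 + n) -> 'M[R]_(1 + n)) (x : R) (y : 'rV[R]_n) : R :=
  let p := slice x y in
  bilin (ricci G p) (unit_normal G p) (unit_normal G p).

Definition stability_operator (R : realType) (n : nat)
    (G : 'rV[R]_(1 + n) -> 'M[R]_(1 + n)) (x : R) (f : 'rV[R]_n -> R)
    (y : 'rV[R]_n) : R :=
  - laplace_beltrami (induced_metric G x) f y
  - (ricci_nn G x y + tr_K2 G x y) * f y.

(** * Spectra with multiplicities

    [E lam] is the space of solutions of $Lu = \lambda u$. *)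

Definition has_dim (R : realType) (V : lmodType R) (E : set V) (d : nat) :
    Prop :=
  exists b : 'I_d -> V,
    (forall u, E u <-> exists c : 'I_d -> R, u = \sum_(i < d) c i *: b i) /\
    (forall c : 'I_d -> R, \sum_(i < d) c i *: b i = 0 -> forall i, c i = 0).

Definition is_eigenvalue (R : realType) (V : lmodType R) (E : R -> set V)
    (lam : R) : Prop :=
  exists2 u, E lam u & u != 0.

(** The spectrum is the family [ev] indexed by [I], the index [i] contributing
    [mult i] to the multiplicity of [ev i]: each eigenspace [E lam] has
    dimension $\sum_{i : ev(i) = \lambda} mult(i)$, a finite sum (empty when
    [lam] is not an eigenvalue). *)
Definition has_spectrum (R : realType) (V : lmodType R) (E : R -> set V)
    (I : eqType) (ev : I -> R) (mult : I -> nat) : Prop :=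
  forall lam : R, exists s : seq I,
    [/\ uniq s, (forall i, (i \in s) = (ev i == lam))
      & has_dim (E lam) (\sum_(i <- s) mult i)%N].

(** The number of negative eigenvalues, counted with multiplicity, is [d]. *)
Definition has_index (R : realType) (V : lmodType R) (E : R -> set V)
    (d : nat) : Prop :=
  exists (s : seq R) (mult : R -> nat),
    [/\ uniq s,
        (forall lam, lam \in s <-> lam < 0 /\ is_eigenvalue E lam),
        (forall lam, lam \in s -> has_dim (E lam) (mult lam))
      & d = (\sum_(lam <- s) mult lam)%N].

Definition has_nullity (R : realType) (V : lmodType R) (E : R -> set V)
    (d : nat) : Prop :=
  has_dim (E 0) d.

(** * The sphere $S^3$ and its coordinates $(\psi, \theta, \phi)$ *)

Definition S3 (R : realType) : Type :=
  {z : 'rV[R]_4 | \sum_(i < 4) z 0 i ^+ 2 == 1}.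

Fixpoint Ck (R : realType) (n k : nat) (F : 'rV[R]_n -> R) : Prop :=
  continuous F /\
  (if k is k'.+1 then
     forall i : 'I_n, (forall z, derivable F z (delta_mx 0 i)) /\
                      Ck k' (pderiv i F)
   else True).

Definition smooth (R : realType) (n : nat) (F : 'rV[R]_n -> R) : Prop :=
  forall k, Ck k F.

Definition smooth_on_S3 (R : realType) (u : S3 R -> R) : Prop :=
  exists2 F : 'rV[R]_4 -> R, smooth F & forall z : S3 R, u z = F (val z).

Definition psi_ (R : realType) (y : 'rV[R]_3) : R := y 0 (inord 0).
Definition theta_ (R : realType) (y : 'rV[R]_3) : R := y 0 (inord 1).
Definition phi_ (R : realType) (y : 'rV[R]_3) : R := y 0 (inord 2).

(** $(z_1, z_2) = (\cos(\theta/2) e^{i(\psi + \phi/2)},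
    \sin(\theta/2) e^{i(\psi - \phi/2)})$ in $\mathbb{C}^2 = \mathbb{R}^4$. On
    $0 < \theta < \pi$ two triples have the same image exactly when they are
    identified by the lattice generated by
    $(\psi, \phi) \sim (\psi + \pi, \phi + 2\pi)$ and
    $(\psi, \phi) \sim (\psi + 2\pi, \phi)$, and the image is dense in $S^3$:
    the complement of the two circles $z_1 = 0$ and $z_2 = 0$. *)
Definition hopf_row (R : realType) (y : 'rV[R]_3) : 'rV[R]_4 :=
  \row_(i < 4) nth 0
    [:: cos (theta_ y / 2) * cos (psi_ y + phi_ y / 2);
        cos (theta_ y / 2) * sin (psi_ y + phi_ y / 2);
        sin (theta_ y / 2) * cos (psi_ y - phi_ y / 2);
        sin (theta_ y / 2) * sin (psi_ y - phi_ y / 2)] i.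

Lemma hopf_subproof (R : realType) (y : 'rV[R]_3) :
  \sum_(i < 4) hopf_row y 0 i ^+ 2 == 1.
Proof.
rewrite !big_ord_recl big_ord0 !mxE /= addr0 !exprMn addrA -!mulrDr.
by rewrite !cos2Dsin2 !mulr1 cos2Dsin2.
Qed.

Definition hopf (R : realType) (y : 'rV[R]_3) : S3 R :=
  exist _ (hopf_row y) (hopf_subproof y).

Definition chart (R : realType) : set 'rV[R]_3 :=
  [set y | 0 < theta_ y < pi].

(** The 1-forms $d\theta$, $d\phi$ and $d\psi + \frac{\cos\theta}{2} d\phi$. *)
Definition d_theta (R : realType) : 'rV[R]_3 := delta_mx 0 (inord 1).
Definition d_phi (R : realType) : 'rV[R]_3 := delta_mx 0 (inord 2).
Definition hopf_form (R : realType) (y : 'rV[R]_3) : 'rV[R]_3 :=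
  delta_mx 0 (inord 0) + (cos (theta_ y) / 2) *: d_phi R.

Definition sq_form (R : realType) (n : nat) (w : 'rV[R]_n) : 'M[R]_n :=
  w^T *m w.

Definition berger_metric (R : realType) (a c : R) (y : 'rV[R]_3) : 'M[R]_3 :=
  a *: (sq_form (d_theta R) + sin (theta_ y) ^+ 2 *: sq_form (d_phi R))
  + c *: sq_form (hopf_form y).

Definition is_berger_sphere (R : realType) (h : 'rV[R]_3 -> 'M[R]_3) : Prop :=
  exists a c : R,
    [/\ 0 < a, 0 < c & forall y, chart y -> h y = berger_metric a c y].

(** * The Page metric

    The coordinates are [slice x y] with $y = (\psi, \theta, \phi)$. The part
    $-1 < x < 1$ of the Page space, which contains all principal orbits, is
    $(-1, 1) \times S^3$. *)

Definition page_A (R : realType) (nu x : R) : R :=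
  (3 - nu ^+ 2 - nu ^+ 2 * (1 + nu ^+ 2) * x ^+ 2) * (1 - x ^+ 2)
  / (1 - nu ^+ 2 * x ^+ 2).

Definition page_B (R : realType) (nu x : R) : R :=
  (1 - nu ^+ 2 * x ^+ 2) / (3 + 6 * nu ^+ 2 - nu ^+ 4).

Definition page_Lambda (R : realType) : R := 3.

Definition page_S (R : realType) (nu : R) : R :=
  3 * (1 + nu ^+ 2) / page_Lambda R.

Definition page_alpha (R : realType) (nu : R) : R :=
  1 / (2 * (3 + nu ^+ 2)).

Definition page_metric (R : realType) (nu : R) (p : 'rV[R]_(1 + 3)) :
    'M[R]_(1 + 3) :=
  let x := lsubmx p 0 0 in
  let y := rsubmx p in
  let dx : 'rV[R]_(1 + 3) := row_mx 1%:M 0 in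
  let pull (w : 'rV[R]_3) : 'rV[R]_(1 + 3) := row_mx 0 w in
  page_S nu *:
    ((page_A nu x)^-1 *: sq_form dx
     + (4 * page_alpha nu ^+ 2 * page_A nu x) *: sq_form (pull (hopf_form y))
     + page_B nu x *: (sq_form (pull (d_theta R))
                       + sin (theta_ y) ^+ 2 *: sq_form (pull (d_phi R)))).

(** Smooth tensor fields on $\Sigma_{x_0}$ are determined by their restriction
    to the dense chart, so identities between them are stated there. *)

Definition page_minimal (R : realType) (nu x0 : R) : Prop :=
  forall y, chart y -> mean_curvature (page_metric nu) x0 y = 0.

Definition page_totally_geodesic (R : realType) (nu x0 : R) : Prop :=
  forall y, chart y -> second_fundamental_form (page_metric nu) x0 y = 0.

(** The $u \in C^\infty(\Sigma_{x_0})$ with $Lu = \lambda u$. *)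
Definition page_eigenspace (R : realType) (nu x0 lam : R) :
    set (S3 R -> R) :=
  [set u | smooth_on_S3 u /\
     forall y, chart y ->
       stability_operator (page_metric nu) x0 (u \o @hopf R) y
       = lam * u (hopf y)].

(** The eigenvalues of the stability operator of $\Sigma_0$, which carries the
    Berger metric with $a = (1+\nu^2)/(3+6\nu^2-\nu^4)$ and
    $c = (1+\nu^2)(3-\nu^2)/(3+\nu^2)^2$. On the harmonic polynomials of
    bidegree $(p, q)$ in $(z, \bar z)$, a space of dimension $p + q + 1$, one
    has $\partial_\psi^2 = -(p-q)^2$ and
    $-\Delta = (2pq + p + q)/(2a) + (p-q)^2/c$. *)
Definition page_eigenvalue (R : realType) (nu : R) (pq : nat * nat) : R :=
  let p : R := pq.1%:R in
  let q : R := pq.2%:R in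
  (3 + 6 * nu ^+ 2 - nu ^+ 4) / (1 + nu ^+ 2) * ((2 * p * q + p + q) / 2)
  + (3 + nu ^+ 2) ^+ 2 / ((1 + nu ^+ 2) * (3 - nu ^+ 2)) * (p - q) ^+ 2
  - 3.

Definition page_multiplicity (pq : nat * nat) : nat := (pq.1 + pq.2).+1.

(* Main.v *)
Require Import Defs.
From HB Require Import structures.
From mathcomp Require Import all_boot all_order all_algebra.
From mathcomp Require Import all_classical all_reals all_analysis.
From mathcomp Require Import ring lra zify.

Import Order.TTheory GRing.Theory Num.Theory.
Import numFieldNormedType.Exports.

Local Open Scope classical_set_scope.
Local Open Scope ring_scope.
Set Implicit Arguments.
Unset Strict Implicit.
Unset Printing Implicit Defensive.

(** The metric is [S / A dx^2 + h_x] with [h_x] a Berger metric, so the second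
    fundamental form of the level sets is half the normal derivative of [h_x],
    and the mean curvature is a positive multiple of [A' / A + 2 B' / B]. This
    vanishes only at [x = 0], where both [A'] and [B'] vanish; there
    [L = - Delta - 3].

    The spectrum of [Delta] on a Berger sphere is found by separation of
    variables: [z_1^a z_2^c J(|z_1|^2)], where [z_1^(-1)] and [z_2^(-1)] stand
    for the conjugates, is an eigenfunction when [J] is a Jacobi polynomial.
    These functions are orthogonal by Green's formula and Fourier orthogonality.
    They are complete because they span all polynomials on the sphere, in
    particular the powers of [(1 + <z, v>) / 2], which concentrate at [v]. A
    limit of Riemann sums along an ultrafilter is enough of an integral for
    these arguments: they need linearity, positivity, and the vanishing of the
    integral of a derivative.

    Both coefficients in the formula for the eigenvalues are at least 3, so the
    constants are the only eigenfunctions with a nonpositive eigenvalue. *)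

(** * Differential calculus of smooth functions *)

(** The obstacle is the degeneracy of the chart at [theta = 0] and [theta = pi]: eigenfunctions are
    smooth on the sphere, but the coordinate Laplacian has coefficients with [1 / sin] there. The
    Laplacian is therefore multiplied by [sin], which is also the volume density up to a constant,
    and written as the divergence of fields that stay bounded up to the poles, so that Green's
    formula has no boundary term. The integrands lie in a class closed under products and partial
    derivatives whose members are all bounded and periodic; this yields both the error estimates for
    Riemann sums and the passage from the open chart to its closure.

    Distinct bidegrees can share an eigenvalue, as (p, q) and (q, p) do, so Green's formula cannot
    separate all modes: Fourier orthogonality separates different weights, and for equal weights the
    eigenvalue is strictly monotone in the degree. Orthogonality gives independence; for spanning,
    the projection onto the modes of one eigenvalue is subtracted, and completeness kills the
    remainder. *)

Lemma mx_norm_coord_le (R : realType) n (h : 'rV[R]_n) i : `|h 0 i| <= `|h|.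
Proof.
rewrite [leRHS]/Num.norm /= mx_normrE.
exact: (le_bigmax (0 : R) (fun ij : 'I_1 * 'I_n => `|h ij.1 ij.2|) (0, i)).
Qed.

Lemma mx_norm_le (R : realType) n (h : 'rV[R]_n) (C : R) : 0 <= C ->
  (forall i, `|h 0 i| <= C) -> `|h| <= C.
Proof.
move=> C0 hC; rewrite [leLHS]/Num.norm /= mx_normrE.
by apply: bigmax_le => // -[i j] _ /=; rewrite ord1.
Qed.

Lemma is_derive_line (R : realType) n (F : 'rV[R]_n -> R) (a v : 'rV[R]_n)
  (t d : R) :
  is_derive (a + t *: v) v F d -> is_derive t 1 (fun s => F (a + s *: v)) d.
Proof.
move=> H; have E : (fun h : R => h^-1 *: ((F \o shift (a + t *: v)) (h *: v) - F (a + t *: v)))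
   = (fun h : R => h^-1 *: (((fun s => F (a + s *: v)) \o shift t) (h *: 1) - F (a + t *: v))).
  apply/funext => h /=; congr (_ *: (F _ - _)).
  by rewrite [h *: 1]mulr1 scalerDl addrCA addrC -addrA [_ *: _ + a]addrC.
by case: H => H1 H2; constructor; [move: H1|move: H2]; rewrite /derivable /derive E.
Qed.

(** * Total differentiability from continuous partial derivatives *)

Section DifferentiablePartials.
Variables (R : realType) (n : nat) (F : 'rV[R]_n -> R)
  (dF : 'I_n -> 'rV[R]_n -> R).
Hypothesis dFP : forall i z, is_derive z (delta_mx 0 i) F (dF i z).
Hypothesis dF_cont : forall i, continuous (dF i).

Let lin (x h : 'rV[R]_n) : R := \sum_i h 0 i * dF i x.

Let lin_linear x : linear (lin x).
Proof.
move=> a u v; rewrite /lin scaler_sumr -big_split/=; apply: eq_bigr => i _.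
by rewrite !mxE mulrDl -mulrA.
Qed.

Let lin_continuous x : continuous (lin x).
Proof.
move=> z; apply: differentiable_continuous.
rewrite (_ : lin x = \sum_i (fun N : 'rV[R]_n => N 0 i * dF i x)); last first.
  by apply/funext => N; rewrite fct_sumE.
apply: differentiable_sum => i.
by apply: differentiableM; [exact: differentiable_coord|exact: differentiable_cst].
Qed.

(* Moving from [x] to [x + h] one coordinate at a time, each step is controlled
   by the mean value theorem. *)
Let increment x (e : R) : 0 < e ->
  exists2 d, 0 < d & forall h : 'rV[R]_n, `|h| < d ->
    `|F (h + x) - F x - lin x h| <= e * `|h|.
Proof.
(* Dividing [e] by [n.+1] rather than [n] covers dimension 0 as well. *)
move=> e0; have n0 : 0 < n.+1%:R :> R by rewrite ltr0n.
have en0 : 0 < e / n.+1%:R by rewrite divr_gt0.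
have : nbhs x [set z | forall i, `|dF i z - dF i x| < e / n.+1%:R].
  apply: (@filter_forall _ 'I_n (fun i => [set z | `|dF i z - dF i x| < e / n.+1%:R])
    (nbhs x) (nbhs_filter x)) => i.
  by have /cvgrPdist_lt /(_ _ en0) := @dF_cont i x; apply: filterS => z; rewrite distrC.
move=> /nbhs_ballP[d /= d0 dP].
exists d => // h hd.
pose mix k : 'rV[R]_n := \row_j (if (j < k)%N then h 0 j else 0).
have mixh : mix n = h by apply/rowP => j; rewrite mxE ltn_ord.
have mix0 : mix 0%N = 0 by apply/rowP => j; rewrite !mxE.
have -> : F (h + x) - F x = \sum_(k < n) (F (x + mix k.+1) - F (x + mix k)).
  by rewrite -(big_mkord xpredT (fun k => F (x + mix k.+1) - F (x + mix k)))
    telescope_sumr// mixh mix0 addr0 [h + x]addrC.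
rewrite -sumrB; apply: le_trans (ler_norm_sum _ _ _) _.
have step (k : 'I_n) :
    `|F (x + mix k.+1) - F (x + mix k) - h 0 k * dF k x| <= `|h| * (e / n.+1%:R).
  pose g (t : R) := F (x + mix k + t *: (h 0 k *: delta_mx 0 k)).
  have mixS : mix k.+1 = mix k + h 0 k *: delta_mx 0 k.
    apply/rowP => j; rewrite !mxE ltnS leq_eqVlt eqxx /=.
    have [->|jk] := eqVneq j k; first by rewrite eqxx ltnn/= mulr1 add0r.
    by rewrite (_ : (j == k :> nat) = false) /= ?mulr0 ?addr0//; apply/negbTE.
  have gd (t : R) : is_derive t (1 : R) g (h 0 k * dF k (x + mix k + t *: (h 0 k *: delta_mx 0 k))).
    have -> : g = (fun s => F (x + mix k + s *: delta_mx 0 k)) \o *%R (h 0 k).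
      by apply/funext => s; rewrite /g /= scalerA mulrC.
    rewrite mulrC scalerA; apply: is_derive1_comp; last first.
      by apply: is_derive_eq; rewrite [_ *: 1]mulr1.
    by rewrite mulrC; apply: is_derive_line; exact: dFP.
  have [//|c c01] := @MVT_segment R g _ 0 1 ler01 (fun t _ => gd t).
    by apply: derivable_within_continuous => t _; case: (gd t).
  rewrite subr0 mulr1 /g scale1r scale0r addr0 -addrA -mixS => ->.
  rewrite -mulrBr normrM ler_pM ?mx_norm_coord_le//.
  apply/ltW/dP; rewrite -ball_normE /= -addrA opprD addrA subrr sub0r normrN.
  apply: le_lt_trans hd; apply: mx_norm_le => // j; rewrite !mxE.
  have [->|jk] := eqVneq j k.
    rewrite ltnn add0r !mulr1 normrM; move: c01; rewrite in_itv/= => /andP[c0 c1].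
    rewrite (ger0_norm c0); apply: le_trans (mx_norm_coord_le h k).
    by rewrite ler_piMl.
  rewrite !mulr0 addr0; case: ifP => _; rewrite ?normr0//.
  exact: mx_norm_coord_le.
apply: le_trans (ler_sum _ (fun k _ => step k)) _.
rewrite sumr_const card_ord -(mulr_natr _ n) -mulrA mulrC ler_wpM2r//.
by rewrite -mulrA ler_piMr ?(ltW e0)// mulrC ler_pdivrMr// mul1r ler_nat.
Qed.

(** [smooth] provides derivatives along the coordinate axes only, while the chain rule along curves
    needs the total differential; continuity of the partials supplies it. *)
Lemma is_diff_partials x : is_diff x F (lin x).
Proof.
pose linM := GRing.isLinear.Build _ _ _ _ _ (lin_linear x).
pose L : {linear 'rV[R]_n -> R} := HB.pack (lin x) linM.
have FL : F \o shift x = cst (F x) + L +o_ 0 id.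
  apply/eqaddoP => _ /posnumP[e].
  have [|d d0 dP] := @increment x e%:num; first by [].
  apply/nbhs_ballP; exists d => // h; rewrite -ball_normE /= sub0r normrN => /dP.
  by rewrite -[X in _ -> `|X| <= _]/(F (h + x) - (F x + lin x h)) opprD addrA.
have dL := diff_unique (@lin_continuous x : continuous L) FL.
constructor; last exact: dL.
apply/diff_locallyP; rewrite dL; split; last exact: FL.
exact: lin_continuous.
Qed.

Lemma is_derive_curve (g : R -> 'rV[R]_n) (dg : 'I_n -> R) (t : R) :
  (forall i, is_derive t 1 (fun s => g s 0 i) (dg i)) ->
  is_derive t 1 (fun s => F (g s)) (\sum_i dg i * dF i (g t)).
Proof.
move=> gP.
have gd : derivable g t 1.
  by apply/derivable_mxP => i j; rewrite ord1; case: (gP j).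
have gdf : differentiable g t by apply/derivable1_diffP.
have [Fd Fv] := is_diff_partials (g t).
have Fg : differentiable (F \o g) t by exact: differentiable_comp.
constructor; first by apply/derivable1_diffP.
rewrite [LHS](deriveE (1 : R) Fg) diff_comp//= Fv /lin -deriveE// derive_mx//.
by apply: eq_bigr => i _; rewrite mxE; case: (gP i) => _ ->.
Qed.

End DifferentiablePartials.

(** * Algebra of smooth functions *)

Section Smooth.
Variables (R : realType) (n : nat).
Implicit Types F G : 'rV[R]_n -> R.

Lemma Ck_continuous k F : Ck k F -> continuous F.
Proof. by case: k => [|k] []. Qed.

Lemma CkW k F : Ck k.+1 F -> Ck k F.
Proof.
elim: k F => [|k IH] F [Fc Fd]; first by split.
by split=> // i; have [? ?] := Fd i; split=> //; exact: IH.
Qed.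

Lemma Ck_cst k (c : R) : Ck k (fun _ : 'rV[R]_n => c).
Proof.
elim: k c => [|k IH] c; split=> //; try exact: cst_continuous.
move=> i; split=> [z|]; first exact: derivable_cst.
rewrite (_ : pderiv i _ = fun=> 0)//.
by apply/funext => z; rewrite /pderiv derive_cst.
Qed.

Lemma Ck_coord k i : Ck k (fun z : 'rV[R]_n => z 0 i).
Proof.
have d j z : is_derive z (delta_mx 0 j) (fun z : 'rV[R]_n => z 0 i) ((j == i)%:R).
  have df : differentiable (fun N : 'rV[R]_n => N 0 i : R) z.
    exact: differentiable_coord.
  constructor; first exact: diff_derivable.
  have := @derive_mx R 'rV[R]_n 1 n id z (delta_mx 0 j) (@derivable_id _ _ _ _).
  rewrite derive_id => /rowP /(_ i).
  by rewrite !mxE eqxx eq_sym => ->.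
case: k => [|k]; split=> //; try exact: coord_continuous.
move=> j; split=> [z|]; first by case: (d j z).
rewrite (_ : pderiv j _ = fun=> (j == i)%:R); first exact: Ck_cst.
by apply/funext => z; rewrite /pderiv; case: (d j z).
Qed.

Lemma CkD k F G : Ck k F -> Ck k G -> Ck k (fun z => F z + G z).
Proof.
elim: k F G => [|k IH] F G [Fc Fd] [Gc Gd]; split => //;
  try by (move=> z; apply: continuousD; [exact: Fc|exact: Gc]).
move=> i; have [Fi FiC] := Fd i; have [Gi GiC] := Gd i; split=> [z|].
  exact: derivableD.
rewrite (_ : pderiv i _ = fun z => pderiv i F z + pderiv i G z); first exact: IH.
by apply/funext => z; rewrite /pderiv deriveD.
Qed.

Lemma CkM k F G : Ck k F -> Ck k G -> Ck k (fun z => F z * G z).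
Proof.
elim: k F G => [|k IH] F G [Fc Fd] [Gc Gd]; split => //;
  try by (move=> z; apply: continuousM; [exact: Fc|exact: Gc]).
move=> i; have [Fi FiC] := Fd i; have [Gi GiC] := Gd i; split=> [z|].
  exact: derivableM.
rewrite (_ : pderiv i _ = fun z => F z * pderiv i G z + G z * pderiv i F z).
  by apply: CkD; apply: IH => //; apply: CkW; split.
by apply/funext => z; rewrite /pderiv deriveM.
Qed.

Lemma smooth_continuous F : smooth F -> continuous F.
Proof. by move=> /(_ 0%N) /Ck_continuous. Qed.

Lemma smooth_pderiv F i : smooth F -> smooth (pderiv i F).
Proof. by move=> Fs k; have [_ /(_ i)[]] := Fs k.+1. Qed.

Lemma smooth_is_derive F i z : smooth F ->
  is_derive z (delta_mx 0 i) F (pderiv i F z).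
Proof. by move=> Fs; have [_ /(_ i)[d _]] := Fs 1%N; exact: derivableP. Qed.

Lemma smooth_cst (c : R) : smooth (fun _ : 'rV[R]_n => c).
Proof. by move=> k; exact: Ck_cst. Qed.

Lemma smooth_coord i : smooth (fun z : 'rV[R]_n => z 0 i).
Proof. by move=> k; exact: Ck_coord. Qed.

Lemma smoothD F G : smooth F -> smooth G -> smooth (fun z => F z + G z).
Proof. by move=> Fs Gs k; exact: CkD. Qed.

Lemma smoothM F G : smooth F -> smooth G -> smooth (fun z => F z * G z).
Proof. by move=> Fs Gs k; exact: CkM. Qed.

Lemma smooth_derive_curve F (g : R -> 'rV[R]_n) (dg : 'I_n -> R) (t : R) :
  smooth F -> (forall i, is_derive t 1 (fun s => g s 0 i) (dg i)) ->
  is_derive t 1 (fun s => F (g s)) (\sum_i dg i * pderiv i F (g t)).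
Proof.
move=> Fs; apply: (@is_derive_curve _ _ F (fun i => pderiv i F)) => i.
  by move=> z; exact: smooth_is_derive.
by apply: smooth_continuous; exact: smooth_pderiv.
Qed.

End Smooth.

(** * Tame functions of Euler angles *)

Section Derivatives.
Variable R : realType.
Implicit Types (f g : R -> R) (x a b c : R).

Lemma der_cst x c : is_derive x (1 : R) (fun _ => c) 0.
Proof. exact: is_derive_cst. Qed.

Lemma der_id x : is_derive x (1 : R) (fun t => t) 1.
Proof. exact: is_derive_id. Qed.

Lemma derD x f g a b : is_derive x (1 : R) f a -> is_derive x (1 : R) g b ->
  is_derive x (1 : R) (fun t => f t + g t) (a + b).
Proof. by move=> *; exact: is_deriveD. Qed.

Lemma derN x f a : is_derive x (1 : R) f a ->
  is_derive x (1 : R) (fun t => - f t) (- a).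
Proof. by move=> *; exact: is_deriveN. Qed.

Lemma derM x f g a b : is_derive x (1 : R) f a -> is_derive x (1 : R) g b ->
  is_derive x (1 : R) (fun t => f t * g t) (a * g x + f x * b).
Proof.
move=> fa gb; apply: (is_derive_eq (is_deriveM fa gb)).
by rewrite addrC; congr (_ + _); rewrite [LHS]mulrC.
Qed.

Lemma derX x f a n : is_derive x (1 : R) f a ->
  is_derive x (1 : R) (fun t => f t ^+ n) (n%:R * f x ^+ n.-1 * a).
Proof.
move=> fa; case: n => [|n].
  rewrite !mul0r; under eq_fun do rewrite expr0.
  exact: der_cst.
have -> : (fun t => f t ^+ n.+1) = f ^+ n.+1.
  by apply/funext => t; elim: n => [|n IH]; rewrite ?expr1// exprS IH [in RHS]exprS.
apply: is_derive_eq; rewrite [LHS]mulrC.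
by rewrite mulrC /=.
Qed.

Lemma derV x f a : f x != 0 -> is_derive x (1 : R) f a ->
  is_derive x (1 : R) (fun t => (f t)^-1) (- a / f x ^+ 2).
Proof.
move=> fx0 [fd fv]; constructor; first exact: derivableV.
by rewrite deriveV// fv [LHS]mulrC mulrN mulNr.
Qed.

Lemma der_comp x f g a b : is_derive (f x) (1 : R) g b ->
  is_derive x (1 : R) f a -> is_derive x (1 : R) (fun t => g (f t)) (b * a).
Proof. by move=> *; exact: is_derive1_comp. Qed.

Lemma der_cos x f a : is_derive x (1 : R) f a ->
  is_derive x (1 : R) (fun t => cos (f t)) (- sin (f x) * a).
Proof. by move=> fa; apply: der_comp fa; exact: is_derive_cos. Qed.

Lemma der_sin x f a : is_derive x (1 : R) f a ->
  is_derive x (1 : R) (fun t => sin (f t)) (cos (f x) * a).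
Proof. by move=> fa; apply: der_comp fa; exact: is_derive_sin. Qed.

Lemma der_poly x f a (p : {poly R}) : is_derive x (1 : R) f a ->
  is_derive x (1 : R) (fun t => p.[f t]) ((p^`()).[f x] * a).
Proof. by move=> fa; apply: der_comp fa; exact: is_derive_poly. Qed.

Lemma der_eq x f a b : a = b -> is_derive x (1 : R) f a ->
  is_derive x (1 : R) f b.
Proof. by move=> ->. Qed.

End Derivatives.

Ltac der_step := first [ eassumption | eapply der_cst | eapply der_id
  | eapply derN | eapply derD | eapply derX | eapply derM | eapply der_cos
  | eapply der_sin | eapply der_poly ].
(** The derivative is first an existential variable that the structural rules fill in; what remains
    is an algebraic identity between the computed and the claimed value. Hypotheses come first among
    the rules, so locally known derivatives are used as they are. *)
Ltac der := eapply der_eq; [ | solve [repeat der_step] ]; cbv beta; rewrite ?[_.-1]/=.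

(** * The class of tame functions *)

Section Tame.
Variable R : realType.
Implicit Types f g : R -> R -> R -> R.

Definition hopf3 (x y z : R) : 'rV[R]_4 :=
  \row_(i < 4) nth 0
    [:: cos (y / 2) * cos (x + z / 2); cos (y / 2) * sin (x + z / 2);
        sin (y / 2) * cos (x - z / 2); sin (y / 2) * sin (x - z / 2)] i.

(* [k] and [l] being integers, [cos (k x + l z / 2)] is invariant under
   [x |-> x + 2 pi] and [z |-> z + 4 pi]. *)
Inductive tame : (R -> R -> R -> R) -> Prop :=
| tame_hopf F : smooth F -> tame (fun x y z => F (hopf3 x y z))
| tame_cst c : tame (fun _ _ _ => c)
| tame_cos (k l : int) : tame (fun x _ z => cos (k%:~R * x + l%:~R * (z / 2)))
| tame_sin (k l : int) : tame (fun x _ z => sin (k%:~R * x + l%:~R * (z / 2)))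
| tame_cos2 : tame (fun _ y _ => cos (y / 2))
| tame_sin2 : tame (fun _ y _ => sin (y / 2))
| tameD f g : tame f -> tame g -> tame (fun x y z => f x y z + g x y z)
| tameM f g : tame f -> tame g -> tame (fun x y z => f x y z * g x y z).

Definition d1 f f' :=
  forall x y z : R, is_derive x (1 : R) (fun t => f t y z) (f' x y z).
Definition d2 f f' :=
  forall x y z : R, is_derive y (1 : R) (fun t => f x t z) (f' x y z).
Definition d3 f f' :=
  forall x y z : R, is_derive z (1 : R) (fun t => f x y t) (f' x y z).

Definition bounded3 f := exists C, forall x y z, `|f x y z| <= C.

Lemma eq_tame f g : (forall x y z, f x y z = g x y z) -> tame g -> tame f.
Proof.
move=> fg; suff -> : f = g by [].
by apply/funext => x; apply/funext => y; apply/funext => z; exact: fg.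
Qed.

Lemma tameN f : tame f -> tame (fun x y z => - f x y z).
Proof.
move=> tf; apply: (@eq_tame _ (fun x y z => -1 * f x y z)).
  by move=> x y z; rewrite mulN1r.
by apply: tameM tf; exact: tame_cst.
Qed.

Lemma tameB f g : tame f -> tame g -> tame (fun x y z => f x y z - g x y z).
Proof. by move=> tf tg; apply: tameD => //; exact: tameN. Qed.

Lemma tameX f n : tame f -> tame (fun x y z => f x y z ^+ n).
Proof.
move=> tf; elim: n => [|n IH]; first exact: tame_cst.
by apply: (@eq_tame _ (fun x y z => f x y z * f x y z ^+ n)); [move=> *; rewrite exprS|exact: tameM].
Qed.

Lemma tame_sum (I : Type) (r : seq I) (f : I -> R -> R -> R -> R) :
  (forall i, tame (f i)) -> tame (fun x y z => \sum_(i <- r) f i x y z).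
Proof.
move=> tf; elim: r => [|i r IH].
  by apply: (@eq_tame _ (fun _ _ _ => 0)); [move=> *; rewrite big_nil|exact: tame_cst].
by apply: (@eq_tame _ (fun x y z => f i x y z + \sum_(i <- r) f i x y z));
  [move=> *; rewrite big_cons|exact: tameD].
Qed.

Lemma tame_s (h : R -> R) : h = cos \/ h = sin -> tame (fun x _ z => h (x + z / 2)).
Proof.
by case=> ->; [apply: eq_tame (tame_cos 1 1)|apply: eq_tame (tame_sin 1 1)] => x y z;
  rewrite !mul1r.
Qed.

Lemma tame_t (h : R -> R) : h = cos \/ h = sin -> tame (fun x _ z => h (x - z / 2)).
Proof.
by case=> ->; [apply: eq_tame (tame_cos 1 (-1))|apply: eq_tame (tame_sin 1 (-1))] => x y z;
  rewrite !mul1r mulN1r.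
Qed.

Lemma tame_siny : tame (fun _ y _ => sin y).
Proof.
apply: (@eq_tame _ (fun _ y _ => 2 * (sin (y / 2) * cos (y / 2)))).
  move=> _ y _; rewrite {1}(_ : y = (y / 2) *+ 2) ?sin_mulr2n.
    by rewrite -mulr_natl mulrC [cos _ * _]mulrC mulrC.
  by rewrite -mulr_natr divfK.
by apply: tameM; [exact: tame_cst|apply: tameM; [exact: tame_sin2|exact: tame_cos2]].
Qed.

Lemma tame_cosy : tame (fun _ y _ => cos y).
Proof.
apply: (@eq_tame _ (fun _ y _ => cos (y / 2) * cos (y / 2) - sin (y / 2) * sin (y / 2))).
  by move=> _ y _; rewrite -cosD -splitr.
by apply: tameB; apply: tameM; try exact: tame_cos2; exact: tame_sin2.
Qed.

End Tame.

#[global] Hint Resolve tame_cst tame_cos tame_sin tame_cos2 tame_sin2 tameD tameM tameN tameB tameX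
  tame_siny tame_cosy : tame.

(** * Derivatives, periods and bounds of tame functions *)

Section TameDerivatives.
Variable R : realType.
Implicit Types f g : R -> R -> R -> R.

Definition hopf3_dx (x y z : R) : seq R :=
  [:: - (cos (y / 2) * sin (x + z / 2)); cos (y / 2) * cos (x + z / 2);
      - (sin (y / 2) * sin (x - z / 2)); sin (y / 2) * cos (x - z / 2)].
Definition hopf3_dy (x y z : R) : seq R :=
  [:: - (2^-1 * (sin (y / 2) * cos (x + z / 2)));
      - (2^-1 * (sin (y / 2) * sin (x + z / 2)));
      2^-1 * (cos (y / 2) * cos (x - z / 2));
      2^-1 * (cos (y / 2) * sin (x - z / 2))].
Definition hopf3_dz (x y z : R) : seq R :=
  [:: - (2^-1 * (cos (y / 2) * sin (x + z / 2)));
      2^-1 * (cos (y / 2) * cos (x + z / 2));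
      2^-1 * (sin (y / 2) * sin (x - z / 2));
      - (2^-1 * (sin (y / 2) * cos (x - z / 2)))].

Lemma d1_hopf F : smooth F -> d1 (fun x y z => F (hopf3 x y z))
  (fun x y z => \sum_(i < 4) nth 0 (hopf3_dx x y z) i * pderiv i F (hopf3 x y z)).
Proof.
move=> Fs x y z; apply: smooth_derive_curve => // i.
under eq_fun do rewrite mxE.
by case: i => -[|[|[|[|]]]]//= _; der; ring.
Qed.

Lemma d2_hopf F : smooth F -> d2 (fun x y z => F (hopf3 x y z))
  (fun x y z => \sum_(i < 4) nth 0 (hopf3_dy x y z) i * pderiv i F (hopf3 x y z)).
Proof.
move=> Fs x y z; apply: smooth_derive_curve => // i.
under eq_fun do rewrite mxE.
by case: i => -[|[|[|[|]]]]//= _; der; ring.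
Qed.

Lemma d3_hopf F : smooth F -> d3 (fun x y z => F (hopf3 x y z))
  (fun x y z => \sum_(i < 4) nth 0 (hopf3_dz x y z) i * pderiv i F (hopf3 x y z)).
Proof.
move=> Fs x y z; apply: smooth_derive_curve => // i.
under eq_fun do rewrite mxE.
by case: i => -[|[|[|[|]]]]//= _; der; ring.
Qed.

Lemma tame_hopf3_dx i : tame (fun x y z => nth 0 (hopf3_dx x y z) i).
Proof.
by case: i => [|[|[|[|i]]]] /=; rewrite ?nth_nil; auto 9 using tame_s, tame_t with tame.
Qed.

Lemma tame_hopf3_dy i : tame (fun x y z => nth 0 (hopf3_dy x y z) i).
Proof.
by case: i => [|[|[|[|i]]]] /=; rewrite ?nth_nil; auto 9 using tame_s, tame_t with tame.
Qed.

Lemma tame_hopf3_dz i : tame (fun x y z => nth 0 (hopf3_dz x y z) i).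
Proof.
by case: i => [|[|[|[|i]]]] /=; rewrite ?nth_nil; auto 9 using tame_s, tame_t with tame.
Qed.

(** Since derivatives of tame functions are tame again, second derivatives are bounded too, which is
    what the error estimate for Riemann sums consumes. *)
Lemma tame_d1 f : tame f -> exists2 f', tame f' & d1 f f'.
Proof.
elim=> {f}.
- move=> F Fs; exists (fun x y z => \sum_(i < 4) nth 0 (hopf3_dx x y z) i * pderiv i F (hopf3 x y z)).
    apply: tame_sum => i; apply: tameM (tame_hopf3_dx i) (tame_hopf _).
    exact: smooth_pderiv.
  exact: d1_hopf.
- by move=> c; exists (fun _ _ _ => 0); [exact: tame_cst|move=> x y z; exact: der_cst].
- move=> k l; exists (fun x y z => - k%:~R * sin (k%:~R * x + l%:~R * (z / 2))).
    by auto with tame.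
  by move=> x y z; der; ring.
- move=> k l; exists (fun x y z => k%:~R * cos (k%:~R * x + l%:~R * (z / 2))).
    by auto with tame.
  by move=> x y z; der; ring.
- by exists (fun _ _ _ => 0); [exact: tame_cst|move=> x y z; exact: der_cst].
- by exists (fun _ _ _ => 0); [exact: tame_cst|move=> x y z; exact: der_cst].
- move=> f g tf [f' tf' f'P] tg [g' tg' g'P]; exists (fun x y z => f' x y z + g' x y z).
    by auto with tame.
  by move=> x y z; apply: derD.
- move=> f g tf [f' tf' f'P] tg [g' tg' g'P].
  exists (fun x y z => f' x y z * g x y z + f x y z * g' x y z).
    by auto with tame.
  by move=> x y z; apply: (derM (f := fun t => f t y z)).
Qed.

Lemma tame_d2 f : tame f -> exists2 f', tame f' & d2 f f'.
Proof.
elim=> {f}.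
- move=> F Fs; exists (fun x y z => \sum_(i < 4) nth 0 (hopf3_dy x y z) i * pderiv i F (hopf3 x y z)).
    apply: tame_sum => i; apply: tameM (tame_hopf3_dy i) (tame_hopf _).
    exact: smooth_pderiv.
  exact: d2_hopf.
- by move=> c; exists (fun _ _ _ => 0); [exact: tame_cst|move=> x y z; exact: der_cst].
- by move=> k l; exists (fun _ _ _ => 0); [exact: tame_cst|move=> x y z; exact: der_cst].
- by move=> k l; exists (fun _ _ _ => 0); [exact: tame_cst|move=> x y z; exact: der_cst].
- exists (fun _ y _ => - 2^-1 * sin (y / 2)); first by auto with tame.
  by move=> x y z; der; ring.
- exists (fun _ y _ => 2^-1 * cos (y / 2)); first by auto with tame.
  by move=> x y z; der; ring.
- move=> f g tf [f' tf' f'P] tg [g' tg' g'P]; exists (fun x y z => f' x y z + g' x y z).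
    by auto with tame.
  by move=> x y z; apply: derD.
- move=> f g tf [f' tf' f'P] tg [g' tg' g'P].
  exists (fun x y z => f' x y z * g x y z + f x y z * g' x y z).
    by auto with tame.
  by move=> x y z; apply: (derM (f := fun t => f x t z)).
Qed.

Lemma tame_d3 f : tame f -> exists2 f', tame f' & d3 f f'.
Proof.
elim=> {f}.
- move=> F Fs; exists (fun x y z => \sum_(i < 4) nth 0 (hopf3_dz x y z) i * pderiv i F (hopf3 x y z)).
    apply: tame_sum => i; apply: tameM (tame_hopf3_dz i) (tame_hopf _).
    exact: smooth_pderiv.
  exact: d3_hopf.
- by move=> c; exists (fun _ _ _ => 0); [exact: tame_cst|move=> x y z; exact: der_cst].
- move=> k l; exists (fun x y z => - (l%:~R / 2) * sin (k%:~R * x + l%:~R * (z / 2))).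
    by auto with tame.
  by move=> x y z; der; ring.
- move=> k l; exists (fun x y z => l%:~R / 2 * cos (k%:~R * x + l%:~R * (z / 2))).
    by auto with tame.
  by move=> x y z; der; ring.
- by exists (fun _ _ _ => 0); [exact: tame_cst|move=> x y z; exact: der_cst].
- by exists (fun _ _ _ => 0); [exact: tame_cst|move=> x y z; exact: der_cst].
- move=> f g tf [f' tf' f'P] tg [g' tg' g'P]; exists (fun x y z => f' x y z + g' x y z).
    by auto with tame.
  by move=> x y z; apply: derD.
- move=> f g tf [f' tf' f'P] tg [g' tg' g'P].
  exists (fun x y z => f' x y z * g x y z + f x y z * g' x y z).
    by auto with tame.
  by move=> x y z; apply: (derM (f := fun t => f x y t)).
Qed.

Lemma cosD2piZ (k : int) (x : R) : cos (x + k%:~R * (2 * pi)) = cos x.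
Proof.
have H (n : nat) (u : R) : cos (u + n%:R * (2 * pi)) = cos u.
  by rewrite mulr_natl; elim: n => [|n IH]; rewrite ?mulr0n ?addr0// mulrS addrCA addrC
   [2 * pi]mulr_natl cosD2pi -mulr_natl.
case: k => n; first exact: H.
by rewrite NegzE mulrNz mulNr -[LHS](H n.+1) -addrA addNr addr0.
Qed.

Lemma sinD2piZ (k : int) (x : R) : sin (x + k%:~R * (2 * pi)) = sin x.
Proof. by rewrite -!cosBpihalf addrAC cosD2piZ. Qed.

Lemma tame_periodic1 f : tame f -> forall x y z, f (x + 2 * pi) y z = f x y z.
Proof.
elim=> {f} //=.
- move=> F Fs x y z; congr F; apply/rowP => i; rewrite !mxE.
  have E (h : R) : x + 2 * pi + h = x + h + 1%:~R * (2 * pi) by rewrite mul1r addrAC.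
  by rewrite !E !cosD2piZ !sinD2piZ.
- by move=> k l x y z; rewrite mulrDr addrAC cosD2piZ.
- by move=> k l x y z; rewrite mulrDr addrAC sinD2piZ.
- by move=> f g _ fP _ gP x y z; rewrite fP gP.
- by move=> f g _ fP _ gP x y z; rewrite fP gP.
Qed.

Lemma tame_periodic3 f : tame f -> forall x y z, f x y (z + 4 * pi) = f x y z.
Proof.
have E (z : R) : (z + 4 * pi) / 2 = z / 2 + 2 * pi by field.
elim=> {f} //=.
- move=> F Fs x y z; congr F; apply/rowP => i; rewrite !mxE.
  have E1 (u v : R) : u + (v + 2 * pi) = (u + v) + 1%:~R * (2 * pi).
    by rewrite mul1r addrA.
  have E2 (u v : R) : u - (v + 2 * pi) = (u - v) + (-1)%:~R * (2 * pi).
    by rewrite mulrNz mulN1r opprD addrA.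
  by rewrite E E1 E2 !cosD2piZ !sinD2piZ.
- by move=> k l x y z; rewrite E mulrDr addrA cosD2piZ.
- by move=> k l x y z; rewrite E mulrDr addrA sinD2piZ.
- by move=> f g _ fP _ gP x y z; rewrite fP gP.
- by move=> f g _ fP _ gP x y z; rewrite fP gP.
Qed.

Lemma hopf3_coord_le1 (x y z : R) i : `|hopf3 x y z 0 i| <= 1.
Proof.
rewrite mxE; case: i => -[|[|[|[|]]]]//= _; rewrite normrM;
  by rewrite mulr_ile1// ?cos_max ?sin_max.
Qed.

Lemma tame_bounded f : tame f -> bounded3 f.
Proof.
elim=> {f}.
- move=> F Fs.
  (* The image of [hopf3] lies in the cube [-1, 1]^4, on which a continuous function is bounded. *)
  have cpt := @rV_compact R 4 (fun=> `[-1, 1]%classic) (fun=> @segment_compact R (-1) 1).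
  have Fc : {within [set v : 'rV[R]_4 | forall i : 'I_4, `[-1, 1]%classic (v ord0 i)], continuous F}.
    by apply: continuous_subspaceT; exact: smooth_continuous.
  have [C [_ CP]] := compact_bounded (@continuous_compact _ _ _ _ Fc cpt).
  exists (C + 1) => x y z; apply: (CP (C + 1)); first by rewrite ltrDl.
  exists (hopf3 x y z) => // i /=.
  by rewrite in_itv/= -ler_norml hopf3_coord_le1.
- by move=> c; exists `|c|.
- by move=> k l; exists 1 => *; exact: cos_max.
- by move=> k l; exists 1 => *; exact: sin_max.
- by exists 1 => *; exact: cos_max.
- by exists 1 => *; exact: sin_max.
- move=> f g _ [C fC] _ [D gD]; exists (C + D) => x y z.
  by apply: le_trans (ler_normD _ _) _; exact: lerD.
- move=> f g _ [C fC] _ [D gD]; exists (C * D) => x y z.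
  by rewrite normrM ler_pM.
Qed.

Lemma derive_bound_lipschitz (f f' : R -> R) (C : R) :
  (forall t, is_derive t (1 : R) f (f' t)) -> (forall t, `|f' t| <= C) ->
  forall a b, `|f b - f a| <= C * `|b - a|.
Proof.
move=> fd fC.
suff H a b : a <= b -> `|f b - f a| <= C * `|b - a|.
  move=> a b; have [|/ltW] := leP a b; first exact: H.
  by rewrite distrC [`|b - a|]distrC; exact: H.
move=> ab; have [//|c _ ->] := @MVT_segment R f f' a b ab (fun t _ => fd t).
  by apply: derivable_within_continuous => t _; case: (fd t).
by rewrite normrM ler_wpM2r.
Qed.

(** A global Lipschitz constant replaces uniform continuity: it extends identities from an open box
    of angles to the closed one, and turns positivity at a point into positivity on an explicit
    box. *)
Lemma tame_lipschitz f : tame f -> exists2 C, 0 <= C & forall x y z x' y' z',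
  `|f x' y' z' - f x y z| <= C * (`|x' - x| + `|y' - y| + `|z' - z|).
Proof.
move=> tf.
have [f1 /tame_bounded[C1 f1C] fd1] := tame_d1 tf.
have [f2 /tame_bounded[C2 f2C] fd2] := tame_d2 tf.
have [f3 /tame_bounded[C3 f3C] fd3] := tame_d3 tf.
have C10 : 0 <= C1 by apply: le_trans (f1C 0 0 0).
have C20 : 0 <= C2 by apply: le_trans (f2C 0 0 0).
have C30 : 0 <= C3 by apply: le_trans (f3C 0 0 0).
exists (C1 + C2 + C3) => [|x y z x' y' z']; first by rewrite !addr_ge0.
have -> : f x' y' z' - f x y z = (f x' y' z' - f x y' z') + (f x y' z' - f x y z')
  + (f x y z' - f x y z) by ring.
have H1 : `|f x' y' z' - f x y' z'| <= C1 * `|x' - x|.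
  by apply: (derive_bound_lipschitz (f := fun t => f t y' z')) => t; [exact: fd1|exact: f1C].
have H2 : `|f x y' z' - f x y z'| <= C2 * `|y' - y|.
  by apply: (derive_bound_lipschitz (f := fun t => f x t z')) => t; [exact: fd2|exact: f2C].
have H3 : `|f x y z' - f x y z| <= C3 * `|z' - z|.
  by apply: (derive_bound_lipschitz (f := fun t => f x y t)) => t; [exact: fd3|exact: f3C].
apply: le_trans (ler_normD _ _) _.
apply: le_trans (lerD (ler_normD _ _) (lexx _)) _.
apply: le_trans (lerD (lerD H1 H2) H3) _.
rewrite !mulrDr !mulrDl.
have P (a b : R) : 0 <= a -> 0 <= a * `|b| by move=> a0; rewrite mulr_ge0.
have := (P _ (x' - x) C20, P _ (x' - x) C30, P _ (y' - y) C10, P _ (y' - y) C30,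
  P _ (z' - z) C10, P _ (z' - z) C20).
by move=> [[[[[? ?] ?] ?] ?] ?]; lra.
Qed.

End TameDerivatives.

(** * A positive functional on functions of Euler angles *)

Section Mean.
Variable R : realType.
Implicit Types g : nat -> R.

Definition mean n g : R := n.+1%:R^-1 * \sum_(i < n.+1) g i.

Lemma meanD n g h : mean n (fun i => g i + h i) = mean n g + mean n h.
Proof. by rewrite /mean big_split mulrDr. Qed.

Lemma meanZ n c g : mean n (fun i => c * g i) = c * mean n g.
Proof. by rewrite /mean -mulr_sumr mulrCA. Qed.

Lemma meanZr n c g : mean n (fun i => g i * c) = mean n g * c.
Proof. by rewrite /mean -mulr_suml mulrA. Qed.

Lemma ler_mean n g h : (forall i, (i < n.+1)%N -> g i <= h i) -> mean n g <= mean n h.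
Proof. by move=> gh; rewrite ler_wpM2l ?invr_ge0// ler_sum// => i _; exact: gh. Qed.

Lemma mean_cst n c : mean n (fun=> c) = c.
Proof. by rewrite /mean sumr_const card_ord -(mulr_natl c) mulKf// pnatr_eq0. Qed.

Lemma ler_norm_mean n g C : (forall i, `|g i| <= C) -> `|mean n g| <= C.
Proof.
move=> gC; rewrite ler_norml; apply/andP; split.
  rewrite -[X in X <= _](mean_cst n); apply: ler_mean => i _.
  by have := gC i; rewrite ler_norml => /andP[].
rewrite -[X in _ <= X](mean_cst n); apply: ler_mean => i _.
by have := gC i; rewrite ler_norml => /andP[].
Qed.

Lemma mean_exchange n (g : nat -> nat -> R) :
  mean n (fun i => mean n (g i)) = mean n (fun j => mean n (g^~ j)).
Proof. by rewrite /mean -!mulr_sumr exchange_big. Qed.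

(** A quantitative fundamental theorem of calculus. With [h = l / n.+1], each step replaces the
    increment of [g] by [h * g1] at the left end with an error of at most [C * h ^+ 2], and the
    increments telescope to zero by periodicity. *)
Lemma mean_derive n (g g1 g2 : R -> R) (a l C : R) : 0 < l ->
  (forall t, is_derive t (1 : R) g (g1 t)) ->
  (forall t, is_derive t (1 : R) g1 (g2 t)) -> (forall t, `|g2 t| <= C) ->
  g (a + l) = g a ->
  `|mean n (fun i => g1 (a + l * (i%:R / n.+1%:R)))| <= C * l / n.+1%:R.
Proof.
move=> l0 gd g1d g2C gal.
have C0 : 0 <= C by apply: le_trans (g2C 0).
pose x i : R := a + l * (i%:R / n.+1%:R).
pose h := l / n.+1%:R.
have h0 : 0 < h by rewrite divr_gt0.
have xS i : x i.+1 = x i + h by rewrite /x /h -natr1; ring.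
have step i : `|g (x i.+1) - g (x i) - h * g1 (x i)| <= C * h ^+ 2.
  have [||c c01 E] := @MVT_segment R g g1 (x i) (x i.+1) _ (fun t _ => gd t).
  - by rewrite xS lerDl ltW.
  - by apply: derivable_within_continuous => t _; case: (gd t).
  have -> : g (x i.+1) - g (x i) - h * g1 (x i) = h * (g1 c - g1 (x i)).
    by rewrite E xS; ring.
  rewrite normrM (gtr0_norm h0) expr2 mulrCA; apply: ler_wpM2l; first exact: ltW.
  apply: le_trans (derive_bound_lipschitz g1d g2C _ _) _.
  rewrite ler_wpM2l//; move: c01; rewrite in_itv/= xS => /andP[c1 c2].
  by rewrite ger0_norm ?subr_ge0// lerBlDr addrC.
have T : \sum_(i < n.+1) (g (x i.+1) - g (x i)) = 0.
  rewrite -(big_mkord xpredT (fun i => g (x i.+1) - g (x i))) telescope_sumr//.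
  by rewrite /x mul0r mulr0 addr0 divff ?gt_eqF// mulr1 gal subrr.
have S : `|h * \sum_(i < n.+1) g1 (x i)| <= n.+1%:R * (C * h ^+ 2).
  have -> : h * \sum_(i < n.+1) g1 (x i)
     = - \sum_(i < n.+1) (g (x i.+1) - g (x i) - h * g1 (x i)).
    by rewrite sumrB T sub0r opprK mulr_sumr.
  rewrite normrN; apply: le_trans (ler_norm_sum _ _ _) _.
  apply: le_trans (ler_sum _ (fun (i : 'I_n.+1) _ => step i)) _.
  by rewrite sumr_const card_ord -(mulr_natl (C * h ^+ 2)).
rewrite /mean normrM gtr0_norm ?invr_gt0// mulrC -/(x _).
rewrite ler_pdivrMr// -/x -(ler_pM2l h0) -{1}(gtr0_norm h0) -normrM.
apply: le_trans S _.
by rewrite le_eqVlt; apply/orP; left; apply/eqP; rewrite /h; field; rewrite gt_eqF.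
Qed.

(** Equidistribution of the grid. After rescaling, the window has radius [r] around [u]; of its
    roughly [2 r M] grid points only [K] consecutive ones, about [r M], are counted. This leaves
    room for rounding once [r M >= 2] and gives the density [r / 2]. *)
Lemma mean_indicator (a l x0 d : R) : 0 < l -> a < x0 < a + l -> 0 < d ->
  exists N k, 0 < k /\ forall n, (N <= n)%N ->
    k <= mean n (fun i => (`|a + l * (i%:R / n.+1%:R) - x0| < d)%R%:R).
Proof.
move=> l0 /andP[ax xal] d0.
pose u := (x0 - a) / l.
have u0 : 0 < u by rewrite divr_gt0// subr_gt0.
have u1 : u < 1 by rewrite ltr_pdivrMr// mul1r ltrBlDl.
pose r := Num.min (Num.min u (1 - u)) (d / l).
have r0 : 0 < r by rewrite !lt_min u0 subr_gt0 u1 divr_gt0.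
have ru : r <= u by rewrite !ge_min lexx.
have ru1 : r <= 1 - u by rewrite !ge_min lexx orbT.
have rd : r <= d / l by rewrite ge_min lexx orbT.
exists (Num.truncn (2 / r)), (r / 2); split; first by rewrite divr_gt0.
move=> n nN; set M : R := n.+1%:R.
have Mr : 2 / r <= M.
  apply: ltW; apply: lt_le_trans (truncnS_gt _) _.
  by rewrite ler_nat ltnS.
pose i0 := (Num.truncn ((u - r) * M)).+1.
pose K := Num.truncn (r * M).
have ur0 : 0 <= (u - r) * M by rewrite mulr_ge0 ?subr_ge0// ltW.
have rM0 : 0 <= r * M by rewrite mulr_ge0// ltW.
have i0gt : (u - r) * M < i0%:R by exact: truncnS_gt.
have i0le : i0%:R <= (u - r) * M + 1.
  by rewrite /i0 -natr1 lerD2r truncn_le.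
have Kle : K%:R <= r * M by rewrite truncn_le.
have Kge : r * M < K%:R + 1 by rewrite natr1; exact: truncnS_gt.
have rM2 : 2 <= r * M by rewrite mulrC -ler_pdivrMr.
have i0K : (i0 + K <= n.+1)%N.
  rewrite -(ler_nat R) natrD -/M; apply: le_trans (lerD i0le Kle) _.
  have : (u + r) * M <= M by apply: ler_piMl; [exact: ltW|rewrite -lerBrDl].
  rewrite mulrDl mulrBl; lra.
have H i : (i0 <= i < i0 + K)%N -> `|a + l * (i%:R / M) - x0| < d.
  move=> /andP[]; rewrite -(ler_nat R) -(ler_nat R i.+1) natrD -natr1 => il iu.
  have -> : a + l * (i%:R / M) - x0 = l * (i%:R / M - u).
    by rewrite mulrBr /u [l * (_ / l)]mulrC divfK ?gt_eqF//; ring.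
  rewrite normrM (gtr0_norm l0) mulrC -ltr_pdivlMr//; apply: lt_le_trans rd.
  rewrite ltr_norml; apply/andP; split.
    by rewrite ltrBrDl ltr_pdivlMr//; exact: lt_le_trans i0gt il.
  rewrite ltrBlDl ltr_pdivrMr//.
  have : 0 < r * M by rewrite mulr_gt0.
  by rewrite mulrDl; move: i0le; rewrite mulrBl; lra.
rewrite /mean -/M [_^-1 * _]mulrC ler_pdivlMr//.
apply: (@le_trans _ _ K%:R); first by lra.
rewrite -(big_mkord xpredT (fun i => (`|a + l * (i%:R / M) - x0| < d)%R%:R : R)).
rewrite (big_cat_nat (n := i0)) ?(leq_trans (leq_addr K i0))//=.
rewrite (big_cat_nat (n := (i0 + K)%N) (m := i0)) ?leq_addr//=.
rewrite (_ : \sum_(i0 <= i < i0 + K) _ = K%:R); last first.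
  rewrite big_nat_cond (eq_bigr (fun=> 1)) => [|i /andP[/H -> _]//].
  by rewrite -big_nat_cond sumr_const_nat addKn.
by rewrite addrCA lerDl addr_ge0// sumr_ge0.
Qed.

End Mean.

(** * The ultrafilter limit of Riemann sums *)

Section Functional.
Variable R : realType.
Implicit Types f g : R -> R -> R -> R.

(** The sides 2 pi and 4 pi are the separate periods of tame functions in [x] and [z]; this
    rectangle consists of two cells of the lattice of identifications. The [0 +] in [gridy] gives
    all three grids the shape [a + l * t] of the lemmas on means. *)
Definition gridx n i : R := - pi + 2 * pi * (i%:R / n.+1%:R).
Definition gridy n i : R := 0 + pi * (i%:R / n.+1%:R).
Definition gridz n i : R := - (2 * pi) + 4 * pi * (i%:R / n.+1%:R).

Definition rsum f n : R :=
  mean n (fun i => mean n (fun j => mean n (fun k =>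
    f (gridx n i) (gridy n j) (gridz n k)))).

Fact eventually_ultra : exists U : set_system nat, UltraFilter U /\ \oo `<=` U.
Proof. exact: ultraFilterLemma. Qed.

Definition ultra : set_system nat := sval (cid eventually_ultra).

Lemma ultra_ultra : UltraFilter ultra.
Proof. by have [] := svalP (cid eventually_ultra). Qed.

#[local] Instance ultra_proper_filter : ProperFilter ultra.
Proof. exact: (@ultra_proper _ _ ultra_ultra). Qed.

Lemma ultra_eventually (N : nat) (P : set nat) :
  (forall n, (N <= n)%N -> P n) -> ultra P.
Proof.
move=> NP; have [_] := svalP (cid eventually_ultra); apply.
by exists N => // n; exact: NP.
Qed.

(** The image of an ultrafilter is an ultrafilter, hence converges in the compact interval [- C, C].
    Every bounded function thus has an integral, without any proof of integrability. *)
Lemma cvg_ultra (u : nat -> R) C : (forall n, `|u n| <= C) -> cvg (u n @[n --> ultra]).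
Proof.
move=> uC.
have imU : UltraFilter (u @ ultra).
  constructor=> [|G GF uG]; first exact: fmap_proper_filter.
  apply/seteqP; split=> // A GA.
  have [//|UA] := in_ultra_setVsetC (u @^-1` A) ultra_ultra.
  have : G (A `&` ~` A) by apply: filterI => //; exact: uG.
  by rewrite setICr => /filter_not_empty.
have : compact `[- C, C]%classic by exact: segment_compact.
rewrite compact_ultra => /(_ _ imU) [|l [_ ul]].
  apply: (@ultra_eventually 0%N) => n _ /=.
  by rewrite in_itv/= -ler_norml uC.
by apply/cvg_ex; exists l.
Qed.

(* Plays the role of the normalized integral over [-pi, pi] x [0, pi] x [-2 pi, 2 pi]. *)
Definition rint f : R := lim (rsum f n @[n --> ultra]).

Lemma cvg_rsum f : bounded3 f -> cvg (rsum f n @[n --> ultra]).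
Proof.
move=> [C fC]; apply: (@cvg_ultra _ C) => n.
by apply: ler_norm_mean => i; apply: ler_norm_mean => j; apply: ler_norm_mean => k.
Qed.

Lemma rintD f g : bounded3 f -> bounded3 g ->
  rint (fun x y z => f x y z + g x y z) = rint f + rint g.
Proof.
move=> bf bg; apply: cvg_lim => //.
under eq_fun => n.
  rewrite /rsum; under eq_fun => i.
    under eq_fun => j do rewrite meanD.
    rewrite meanD; over.
  rewrite meanD; over.
by apply: cvgD; exact: cvg_rsum.
Qed.

Lemma rintZ c f : bounded3 f -> rint (fun x y z => c * f x y z) = c * rint f.
Proof.
move=> bf; apply: cvg_lim => //.
under eq_fun => n.
  rewrite /rsum; under eq_fun => i.
    under eq_fun => j do rewrite meanZ.
    rewrite meanZ; over.
  rewrite meanZ; over.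
by apply: cvgMl_tmp; exact: cvg_rsum.
Qed.

Lemma rint_ge f c N : bounded3 f -> (forall n, (N <= n)%N -> c <= rsum f n) ->
  c <= rint f.
Proof.
move=> bf cf; apply: limr_ge; first exact: cvg_rsum.
exact: (@ultra_eventually N).
Qed.

Lemma gridy_itv n i : (i < n.+1)%N -> 0 <= gridy n i <= pi.
Proof.
move=> lin; have : 0 <= (i%:R / n.+1%:R : R) <= 1.
  by rewrite divr_ge0//= ler_pdivrMr ?ltr0n// mul1r ler_nat ltnW.
by rewrite /gridy; move: (_ / _) => u /andP[? ?]; have := pi_gt0 R; nra.
Qed.

Lemma rint_ge0 f : bounded3 f -> (forall x y z, 0 <= y <= pi -> 0 <= f x y z) ->
  0 <= rint f.
Proof.
move=> bf f0; apply: (@rint_ge _ _ 0%N) => // n _; rewrite -(mean_cst n 0).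
apply: ler_mean => i ni; rewrite -(mean_cst n 0).
apply: ler_mean => j nj; rewrite -(mean_cst n 0).
by apply: ler_mean => k nk; apply: f0; exact: gridy_itv.
Qed.

Lemma rint_cst0 : rint (fun _ _ _ => 0) = 0.
Proof.
rewrite -[RHS](mul0r (rint (fun _ _ _ => 0))) -rintZ; last by exists 0 => *; rewrite normr0.
by under [in RHS]eq_fun do under eq_fun do under eq_fun do rewrite mul0r.
Qed.

Lemma rint_eq0 f C : bounded3 f -> (forall n, `|rsum f n| <= C / n.+1%:R) ->
  rint f = 0.
Proof.
move=> bf fC; apply: cvg_lim => //; apply/cvgr0Pnorm_le => e e0.
apply: (@ultra_eventually (Num.truncn (C / e))) => n nN.
apply: le_trans (fC n) _.
rewrite ler_pdivrMr ?ltr0n// mulrC -ler_pdivrMr//.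
by apply: ltW; apply: lt_le_trans (truncnS_gt _) _; rewrite ler_nat ltnS.
Qed.

Lemma rint_d1 f f1 : tame f -> d1 f f1 -> tame f1 -> rint f1 = 0.
Proof.
move=> tf fd tf1; have [f2 /tame_bounded[C f2C] f1d] := tame_d1 tf1.
apply: (@rint_eq0 _ (C * (2 * pi))) => [|n]; first exact: tame_bounded.
rewrite /rsum mean_exchange; apply: ler_norm_mean => j.
rewrite mean_exchange; apply: ler_norm_mean => k.
apply: (@mean_derive _ n (fun t => f t (gridy n j) (gridz n k)) (fun t => f1 t (gridy n j) (gridz n k))
  (fun t => f2 t (gridy n j) (gridz n k)) (- pi) (2 * pi)) => //.
  by have := pi_gt0 R; lra.
exact: tame_periodic1.
Qed.

Lemma rint_d3 f f1 : tame f -> d3 f f1 -> tame f1 -> rint f1 = 0.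
Proof.
move=> tf fd tf1; have [f2 /tame_bounded[C f2C] f1d] := tame_d3 tf1.
apply: (@rint_eq0 _ (C * (4 * pi))) => [|n]; first exact: tame_bounded.
rewrite /rsum; apply: ler_norm_mean => i; apply: ler_norm_mean => j.
apply: (@mean_derive _ n (fun t => f (gridx n i) (gridy n j) t) (fun t => f1 (gridx n i) (gridy n j) t)
  (fun t => f2 (gridx n i) (gridy n j) t) (- (2 * pi)) (4 * pi)) => //.
  by have := pi_gt0 R; lra.
exact: tame_periodic3.
Qed.

(** Nothing is periodic in [y]; equal values at the two poles close the telescoping sum instead. *)
Lemma rint_d2 f f1 : tame f -> d2 f f1 -> tame f1 ->
  (forall x z, f x 0 z = f x pi z) -> rint f1 = 0.
Proof.
move=> tf fd tf1 f0; have [f2 /tame_bounded[C f2C] f1d] := tame_d2 tf1.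
apply: (@rint_eq0 _ (C * pi)) => [|n]; first exact: tame_bounded.
rewrite /rsum; apply: ler_norm_mean => i.
rewrite mean_exchange; apply: ler_norm_mean => k.
apply: (@mean_derive _ n (fun t => f (gridx n i) t (gridz n k)) (fun t => f1 (gridx n i) t (gridz n k))
  (fun t => f2 (gridx n i) t (gridz n k)) 0 pi) => //; first exact: pi_gt0.
by rewrite add0r f0.
Qed.

(** The share of grid points in the box is the product of three one-dimensional densities, each
    bounded below uniformly in [n], so the positive lower bound survives in the limit. *)
Lemma rint_gt0 f c d x0 y0 z0 : bounded3 f -> 0 < c -> 0 < d ->
  - pi < x0 < pi -> 0 < y0 < pi -> - (2 * pi) < z0 < 2 * pi ->
  (forall x y z, 0 <= y <= pi -> 0 <= f x y z) ->
  (forall x y z, `|x - x0| < d -> `|y - y0| < d -> `|z - z0| < d -> c <= f x y z) ->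
  0 < rint f.
Proof.
move=> bf c0 dp x0P y0P z0P f0 fc; have p0 := pi_gt0 R.
have [||//|N1 [k1 [k10 H1]]] := @mean_indicator R (- pi) (2 * pi) x0 d; [lra|lra|].
have [||//|N2 [k2 [k20 H2]]] := @mean_indicator R 0 pi y0 d; [lra|lra|].
have [||//|N3 [k3 [k30 H3]]] := @mean_indicator R (- (2 * pi)) (4 * pi) z0 d; [lra|lra|].
apply: (@lt_le_trans _ _ (c * (k1 * (k2 * k3)))); first by rewrite !mulr_gt0.
apply: (@rint_ge _ _ (maxn N1 (maxn N2 N3))) => // n.
rewrite !geq_max => /and3P[/H1 H1n /H2 H2n /H3 H3n].
set i1 := (fun i : nat => _) in H1n; set i2 := (fun i : nat => _) in H2n.
set i3 := (fun i : nat => _) in H3n.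
apply: (@le_trans _ _ (c * (mean n i1 * (mean n i2 * mean n i3)))).
  apply: ler_wpM2l; first exact: ltW.
  by rewrite !ler_pM ?mulr_ge0// ltW.
have -> : c * (mean n i1 * (mean n i2 * mean n i3)) = mean n (fun i => mean n (fun j =>
    mean n (fun k => c * i1 i * i2 j * i3 k))).
  transitivity (mean n (fun i => c * i1 i * mean n i2 * mean n i3)).
    by rewrite !meanZr meanZ !mulrA.
  congr mean; apply/funext => i; rewrite -[_ * mean n i2]meanZ -meanZr.
  by congr mean; apply/funext => j; rewrite meanZ.
apply: ler_mean => i ni; apply: ler_mean => j nj; apply: ler_mean => k nk.
have f0' := f0 (gridx n i) (gridy n j) (gridz n k) (gridy_itv nj).
rewrite /i1 /i2 /i3 -/(gridx n i) -/(gridy n j) -/(gridz n k).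
have := fc (gridx n i) (gridy n j) (gridz n k).
by do 3 (case: ltP => _; rewrite ?mulr0 ?mul0r//; rewrite mulr1); apply.
Qed.

End Functional.

(** * Green's formula for Berger metrics *)

Section HopfGradient.
Variable R : realType.
Implicit Types f g : R -> R -> R -> R.

(* [Z] is the derivative along the unit field that is orthogonal to the Hopf
   fibre and to [d_theta], up to a constant: it stays bounded at the poles. *)
Record hopf_gradient f fx fy fz Z : Prop := HopfGradient {
  hg_tame : tame f; hg_tamex : tame fx; hg_tamey : tame fy; hg_tamez : tame fz;
  hg_tameZ : tame Z;
  hg_d1 : d1 f fx; hg_d2 : d2 f fy; hg_d3 : d3 f fz;
  hg_Z : forall x y z, fz x y z = cos y / 2 * fx x y z + sin y / 2 * Z x y z }.

Lemma cos_half (y : R) : cos y = cos (y / 2) ^+ 2 - sin (y / 2) ^+ 2.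
Proof. by rewrite [in LHS](splitr y) cosD !expr2. Qed.

Lemma sin_half (y : R) : sin y = 2 * (sin (y / 2) * cos (y / 2)).
Proof. by rewrite [in LHS](splitr y) sinD; ring. Qed.

Lemma hopf_gradient_smooth F : smooth F ->
  exists fx fy fz Z, hopf_gradient (fun x y z => F (hopf3 x y z)) fx fy fz Z.
Proof.
move=> Fs; pose dF i (x y z : R) := pderiv i F (hopf3 x y z).
have tdF i : tame (dF i) by apply: tame_hopf; exact: smooth_pderiv.
exists (fun x y z => \sum_(i < 4) nth 0 (hopf3_dx x y z) i * dF i x y z).
exists (fun x y z => \sum_(i < 4) nth 0 (hopf3_dy x y z) i * dF i x y z).
exists (fun x y z => \sum_(i < 4) nth 0 (hopf3_dz x y z) i * dF i x y z).
pose i1 : 'I_4 := lift ord0 ord0.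
pose i2 : 'I_4 := lift ord0 (lift ord0 ord0).
pose i3 : 'I_4 := lift ord0 (lift ord0 (lift ord0 ord0)).
(* Writing 1 as [cos (y / 2) ^+ 2 + sin (y / 2) ^+ 2] in [fz - cos y / 2 * fx] makes the factor
   [sin (y / 2) * cos (y / 2) = sin y / 2] appear; this is the quotient. *)
exists (fun x y z => sin (y / 2) * (cos (x + z / 2) * dF i1 x y z - sin (x + z / 2) * dF ord0 x y z)
  - cos (y / 2) * (cos (x - z / 2) * dF i3 x y z - sin (x - z / 2) * dF i2 x y z)).
split.
- exact: tame_hopf.
- by apply: tame_sum => i; apply: (@tameM _ (fun x y z => nth 0 (hopf3_dx x y z) i) (dF i)); [exact: tame_hopf3_dx|].
- by apply: tame_sum => i; apply: (@tameM _ (fun x y z => nth 0 (hopf3_dy x y z) i) (dF i)); [exact: tame_hopf3_dy|].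
- by apply: tame_sum => i; apply: (@tameM _ (fun x y z => nth 0 (hopf3_dz x y z) i) (dF i)); [exact: tame_hopf3_dz|].
- by auto 9 using tame_s, tame_t with tame.
- exact: d1_hopf.
- exact: d2_hopf.
- exact: d3_hopf.
- move=> x y z; rewrite !big_ord_recl !big_ord0 /= -/i1 -/i2 -/i3 (cos_half y) (sin_half y).
  have := cos2Dsin2 (y / 2).
  set C := cos (y / 2); set S := sin (y / 2) => cs.
  set cs1 := cos (x + _); set ss1 := sin (x + _); set ct1 := cos (x - _); set st1 := sin (x - _).
  apply/eqP; rewrite -subr_eq0; apply/eqP.
  transitivity ((1 - (C ^+ 2 + S ^+ 2)) / 2 * (C * (cs1 * dF i1 x y z - ss1 * dF ord0 x y z)
    - S * (ct1 * dF i3 x y z - st1 * dF i2 x y z))); last by rewrite cs subrr !mul0r.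
  by field.
Qed.

Lemma rint_ext f g : (forall x y z, f x y z = g x y z) -> rint f = rint g.
Proof.
move=> fg; congr rint; apply/funext => x; apply/funext => y; apply/funext => z.
exact: fg.
Qed.

(** * The Laplacian in divergence form *)

Section Laplacian.
Variables a c : R.

(* [l = sin y * Delta f] for the Berger metric with parameters [a] and [c], in
   divergence form. *)
Definition weighted_laplacian f l : Prop := exists fx fy fz Z D1 D2 D3,
  hopf_gradient f fx fy fz Z /\
  [/\ tame D1 /\ d1 (fun x y z => sin y * fx x y z / c - cos y * Z x y z / (4 * a)) D1,
      tame D2 /\ d2 (fun x y z => sin y * fy x y z / a) D2,
      tame D3 /\ d3 (fun x y z => Z x y z / (2 * a)) D3
    & forall x y z, l x y z = D1 x y z + D2 x y z + D3 x y z].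

Lemma weighted_laplacian_tame f l : weighted_laplacian f l -> tame l.
Proof.
by move=> [? [? [? [? [? [? [? [_ [[t1 _] [t2 _] [t3 _] E]]]]]]]]]; apply: (eq_tame E); auto with tame.
Qed.

Lemma weighted_laplacian_smooth F : smooth F ->
  exists l, weighted_laplacian (fun x y z => F (hopf3 x y z)) l.
Proof.
move=> /hopf_gradient_smooth[fx [fy [fz [Z G]]]].
have [? tx ty tz tZ _ _ _ _] := G.
have [D1 t1 D1P] : exists2 D, tame D & d1 (fun x y z => sin y * fx x y z / c - cos y * Z x y z / (4 * a)) D.
  by apply: tame_d1; auto 9 with tame.
have [D2 t2 D2P] : exists2 D, tame D & d2 (fun x y z => sin y * fy x y z / a) D.
  by apply: tame_d2; auto 9 with tame.
have [D3 t3 D3P] : exists2 D, tame D & d3 (fun x y z => Z x y z / (2 * a)) D.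
  by apply: tame_d3; auto 9 with tame.
exists (fun x y z => D1 x y z + D2 x y z + D3 x y z).
by exists fx, fy, fz, Z, D1, D2, D3.
Qed.

Lemma weighted_laplacian_linear k f l g m : weighted_laplacian f l ->
  weighted_laplacian g m ->
  weighted_laplacian (fun x y z => k * f x y z + g x y z) (fun x y z => k * l x y z + m x y z).
Proof.
move=> [fx [fy [fz [Z [D1 [D2 [D3 [[? ? ? ? ? fd1 fd2 fd3 fZ] [[? D1P] [? D2P] [? D3P] E]]]]]]]]].
move=> [gx [gy [gz [Y [E1 [E2 [E3 [[? ? ? ? ? gd1 gd2 gd3 gZ] [[? E1P] [? E2P] [? E3P] E']]]]]]]]].
exists (fun x y z => k * fx x y z + gx x y z), (fun x y z => k * fy x y z + gy x y z),
  (fun x y z => k * fz x y z + gz x y z), (fun x y z => k * Z x y z + Y x y z),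
  (fun x y z => k * D1 x y z + E1 x y z), (fun x y z => k * D2 x y z + E2 x y z),
  (fun x y z => k * D3 x y z + E3 x y z).
have L (x : R) (u v : R -> R) (u' v' : R) : is_derive x (1 : R) u u' -> is_derive x (1 : R) v v' ->
    is_derive x (1 : R) (fun t => k * u t + v t) (k * u' + v').
  by move=> *; der; ring.
split; first split; auto with tame.
- by move=> x y z; apply: L.
- by move=> x y z; apply: L.
- by move=> x y z; apply: L.
- by move=> x y z; rewrite fZ gZ; ring.
split; try split; auto with tame.
- move=> x y z; have := L _ _ _ _ _ (D1P x y z) (E1P x y z).
  by congr is_derive; apply/funext => t; ring.
- move=> x y z; have := L _ _ _ _ _ (D2P x y z) (E2P x y z).
  by congr is_derive; apply/funext => t; ring.
- move=> x y z; have := L _ _ _ _ _ (D3P x y z) (E3P x y z).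
  by congr is_derive; apply/funext => t; ring.
- by move=> x y z; rewrite E E'; ring.
Qed.

(* Green's formula: [f m - g l] is the divergence of the vector field
   [f grad g - g grad f], which is periodic in [x], [z] and vanishes at
   the poles [y = 0, pi]. *)
Lemma weighted_laplacian_sym f l g m : weighted_laplacian f l ->
  weighted_laplacian g m ->
  rint (fun x y z => f x y z * m x y z - g x y z * l x y z) = 0.
Proof.
move=> [fx [fy [fz [Z [D1 [D2 [D3 [[tf tfx tfy tfz tZ fd1 fd2 fd3 fZ] [[tD1 D1P] [tD2 D2P] [tD3 D3P] E]]]]]]]]].
move=> [gx [gy [gz [Y [E1 [E2 [E3 [[tg tgx tgy tgz tY gd1 gd2 gd3 gZ] [[tE1 E1P] [tE2 E2P] [tE3 E3P] E']]]]]]]]].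
pose v1 (x y z : R) := sin y * fx x y z / c - cos y * Z x y z / (4 * a).
pose w1 (x y z : R) := sin y * gx x y z / c - cos y * Y x y z / (4 * a).
pose v2 (x y z : R) := sin y * fy x y z / a.
pose w2 (x y z : R) := sin y * gy x y z / a.
pose v3 (x y z : R) := Z x y z / (2 * a).
pose w3 (x y z : R) := Y x y z / (2 * a).
have tv1 : tame v1 by rewrite /v1; auto 9 with tame.
have tw1 : tame w1 by rewrite /w1; auto 9 with tame.
have tv2 : tame v2 by rewrite /v2; auto 9 with tame.
have tw2 : tame w2 by rewrite /w2; auto 9 with tame.
have tv3 : tame v3 by rewrite /v3; auto 9 with tame.
have tw3 : tame w3 by rewrite /w3; auto 9 with tame.
pose P1 (x y z : R) := fx x y z * w1 x y z + f x y z * E1 x y z - (gx x y z * v1 x y z + g x y z * D1 x y z).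
pose P2 (x y z : R) := fy x y z * w2 x y z + f x y z * E2 x y z - (gy x y z * v2 x y z + g x y z * D2 x y z).
pose P3 (x y z : R) := fz x y z * w3 x y z + f x y z * E3 x y z - (gz x y z * v3 x y z + g x y z * D3 x y z).
have tP1 : tame P1 by rewrite /P1; auto 9 with tame.
have tP2 : tame P2 by rewrite /P2; auto 9 with tame.
have tP3 : tame P3 by rewrite /P3; auto 9 with tame.
have I1 : rint P1 = 0.
  apply: (@rint_d1 _ (fun x y z => f x y z * w1 x y z - g x y z * v1 x y z)) => //.
    by auto with tame.
  move=> x y z; have := (fd1 x y z, gd1 x y z, D1P x y z, E1P x y z) => -[[[? ?] ?] ?].
  by apply: derD; [apply: (derM (f := fun t => f t y z))|apply: derN; apply: (derM (f := fun t => g t y z))].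
have I2 : rint P2 = 0.
  apply: (@rint_d2 _ (fun x y z => f x y z * w2 x y z - g x y z * v2 x y z)) => //.
  - by auto with tame.
  - move=> x y z; have := (fd2 x y z, gd2 x y z, D2P x y z, E2P x y z) => -[[[? ?] ?] ?].
    by apply: derD; [apply: (derM (f := fun t => f x t z))|apply: derN; apply: (derM (f := fun t => g x t z))].
  - by move=> x z; rewrite /v2 /w2 sin0 sinpi; ring.
have I3 : rint P3 = 0.
  apply: (@rint_d3 _ (fun x y z => f x y z * w3 x y z - g x y z * v3 x y z)) => //.
    by auto with tame.
  move=> x y z; have := (fd3 x y z, gd3 x y z, D3P x y z, E3P x y z) => -[[[? ?] ?] ?].
  by apply: derD; [apply: (derM (f := fun t => f x y t))|apply: derN; apply: (derM (f := fun t => g x y t))].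
rewrite (@rint_ext _ (fun x y z => P1 x y z + P2 x y z + P3 x y z)).
  have b1 := tame_bounded tP1; have b2 := tame_bounded tP2; have b3 := tame_bounded tP3.
  rewrite (rintD (tame_bounded (tameD tP1 tP2)) b3) (rintD b1 b2) I1 I2 I3.
  by rewrite !addr0.
(* The products of first derivatives cancel because the inverse metric is symmetric; only
   [f m - g l] is left. *)
move=> x y z; rewrite E E' /P1 /P2 /P3 /w1 /w2 /w3 /v1 /v2 /v3 fZ gZ !invfM.
set ai := a^-1; set ci := c^-1; have -> : 4^-1 = (2^-1) ^+ 2 :> R by field.
by ring.
Qed.

End Laplacian.
End HopfGradient.

(** * The Laplacian of a Berger metric in coordinates *)

Section Berger.
Variable R : realType.

Lemma sum_I3 (V : zmodType) (F : 'I_3 -> V) :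
  \sum_(i < 3) F i = F (inord 0) + F (inord 1) + F (inord 2).
Proof.
rewrite !big_ord_recl big_ord0 addr0 addrA.
by congr (F _ + F _ + F _); apply: val_inj; rewrite /= inordK.
Qed.

Lemma forall_I3 (P : 'I_3 -> Prop) :
  P (inord 0) -> P (inord 1) -> P (inord 2) -> forall i, P i.
Proof.
move=> P0 P1 P2 i; rewrite -(inord_val i).
by case: i => -[|[|[|]]].
Qed.

Lemma inord3_eq k l : (k < 3)%N -> (l < 3)%N ->
  ((inord k : 'I_3) == inord l) = (k == l).
Proof. by move=> k3 l3; rewrite -val_eqE /= !inordK. Qed.

Lemma invmx_right (n : nat) (A B : 'M[R]_n) : A *m B = 1%:M -> invmx A = B.
Proof.
move=> AB; have [Au _] := mulmx1_unit AB.
by rewrite -[LHS]mulmx1 -AB mulmxA mulVmx// mul1mx.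
Qed.

Lemma berger_metricE (a c : R) y i j : berger_metric a c y i j =
  a * ((i == inord 1)%:R * (j == inord 1)%:R
       + sin (theta_ y) ^+ 2 * ((i == inord 2)%:R * (j == inord 2)%:R))
  + c * (((i == inord 0)%:R + cos (theta_ y) / 2 * (i == inord 2)%:R)
         * ((j == inord 0)%:R + cos (theta_ y) / 2 * (j == inord 2)%:R)).
Proof. by rewrite !mxE !big_ord1 !mxE /=. Qed.

(** The sum of squares of the dual frame: [d_theta], the fibre direction [d_psi], and the horizontal
    field [d_phi - cos theta / 2 * d_psi]. *)
Definition berger_inverse (a c : R) (y : 'rV[R]_3) : 'M[R]_3 :=
  \matrix_(i, j) (a^-1 * ((i == inord 1)%:R * (j == inord 1)%:R)
    + c^-1 * ((i == inord 0)%:R * (j == inord 0)%:R)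
    + (a * sin (theta_ y) ^+ 2)^-1
      * (((i == inord 2)%:R - cos (theta_ y) / 2 * (i == inord 0)%:R)
         * ((j == inord 2)%:R - cos (theta_ y) / 2 * (j == inord 0)%:R))).

Lemma chart_sin_gt0 (y : 'rV[R]_3) : chart y -> 0 < sin (theta_ y).
Proof. by move=> /= ?; exact: sin_gt0_pi. Qed.

Lemma invmx_berger (a c : R) y : a != 0 -> c != 0 -> chart y ->
  invmx (berger_metric a c y) = berger_inverse a c y.
Proof.
move=> a0 c0 /chart_sin_gt0 sy; apply: invmx_right; apply/matrixP => i j.
rewrite mxE sum_I3 !berger_metricE !mxE.
have s0 : sin (theta_ y) != 0 by rewrite gt_eqF.
by elim/forall_I3: i; elim/forall_I3: j; rewrite !inord3_eq//=; field; rewrite ?a0 ?c0 ?s0.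
Qed.

Lemma det_berger (a c : R) y :
  \det (berger_metric a c y) = a ^+ 2 * c * sin (theta_ y) ^+ 2.
Proof.
(* The columns of [P] are the forms [hopf_form], [d_theta], [d_phi], in which the metric is
   diagonal. [P] is unitriangular, so the determinant is that of the diagonal part. *)
pose P : 'M[R]_3 := \matrix_(i, j) ((i == j)%:R + cos (theta_ y) / 2 * ((i == inord 2) && (j == inord 0))%:R).
pose d : 'rV[R]_3 := \row_j (if j == inord 0 then c else if j == inord 1 then a else a * sin (theta_ y) ^+ 2).
have -> : berger_metric a c y = P *m diag_mx d *m P^T.
  apply/matrixP => i j; rewrite berger_metricE.
  rewrite mxE; under eq_bigr => k _ do rewrite mxE.
  rewrite !sum_I3 !mxE.
  by elim/forall_I3: i; elim/forall_I3: j; rewrite !inord3_eq//=; field.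
rewrite !det_mulmx det_tr det_diag (bigD1 (inord 0))// (bigD1 (inord 1))/=; last by rewrite inord3_eq.
rewrite (bigD1 (inord 2))/=; last by rewrite !inord3_eq.
rewrite big1 => [|i]; last by elim/forall_I3: i; rewrite !inord3_eq.
rewrite !mxE !inord3_eq//=.
have -> : \det P = 1.
  rewrite det_trig.
    by rewrite big1// => i _; rewrite mxE; elim/forall_I3: i; rewrite !inord3_eq//= ?mulr0 ?addr0 ?eqxx.
  apply/is_trig_mxP => i j; elim/forall_I3: i; elim/forall_I3: j; rewrite !inordK// => _;
  by rewrite mxE !inord3_eq//= mulr0 addr0.
by ring.
Qed.

Lemma is_derive_along n (f : 'rV[R]_n -> R) (y v : 'rV[R]_n) d :
  is_derive (0 : R) (1 : R) (fun h => f (h *: v + y)) d -> is_derive y v f d.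
Proof.
have E : (fun h : R => h^-1 *: (((fun h => f (h *: v + y)) \o shift (0 : R)) (h *: (1 : R)) - f ((0 : R) *: v + y)))
   = (fun h : R => h^-1 *: ((f \o shift y) (h *: v) - f y)).
  by apply/funext => h /=; rewrite addr0 scale0r add0r [h *: 1]mulr1.
by case=> H1 H2; constructor; [move: H1|move: H2]; rewrite /derivable /derive E.
Qed.

Definition on3 (g : R -> R -> R -> R) (y : 'rV[R]_3) : R :=
  g (psi_ y) (theta_ y) (phi_ y).

Lemma der_shift (f : R -> R) (x d : R) : is_derive x (1 : R) f d ->
  is_derive (0 : R) (1 : R) (fun h => f (h + x)) d.
Proof.
move=> fd; rewrite -[d]mulr1; apply: (der_comp (f := fun h => h + x)); first by rewrite add0r.
by der; rewrite addr0.
Qed.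

Lemma is_derive_on3_1 g y d :
  is_derive (psi_ y) (1 : R) (fun t => g t (theta_ y) (phi_ y)) d ->
  is_derive y (delta_mx 0 (inord 0)) (on3 g) d.
Proof.
move=> /der_shift gd; apply: is_derive_along; move: gd; congr is_derive.
by apply/funext => h; rewrite /on3 /psi_ /theta_ /phi_ !mxE !inord3_eq//= !mulr0 !add0r mulr1.
Qed.

Lemma is_derive_on3_2 g y d :
  is_derive (theta_ y) (1 : R) (fun t => g (psi_ y) t (phi_ y)) d ->
  is_derive y (delta_mx 0 (inord 1)) (on3 g) d.
Proof.
move=> /der_shift gd; apply: is_derive_along; move: gd; congr is_derive.
by apply/funext => h; rewrite /on3 /psi_ /theta_ /phi_ !mxE !inord3_eq//= !mulr0 !add0r mulr1.
Qed.

Lemma is_derive_on3_3 g y d :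
  is_derive (phi_ y) (1 : R) (fun t => g (psi_ y) (theta_ y) t) d ->
  is_derive y (delta_mx 0 (inord 2)) (on3 g) d.
Proof.
move=> /der_shift gd; apply: is_derive_along; move: gd; congr is_derive.
by apply/funext => h; rewrite /on3 /psi_ /theta_ /phi_ !mxE !inord3_eq//= !mulr0 !add0r mulr1.
Qed.

Lemma open_chart : open (@chart R).
Proof.
have -> : @chart R = (fun y : 'rV[R]_3 => theta_ y) @^-1` (`]0, pi[%classic : set R).
  by apply/seteqP; split=> y /=; rewrite in_itv.
apply: open_comp; last exact: interval_open.
by move=> y _; exact: coord_continuous.
Qed.

Lemma near_chart (y : 'rV[R]_3) : chart y -> \forall z \near y, chart z.
Proof. by move=> cy; apply: open_nbhs_nbhs; split=> //; exact: open_chart. Qed.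

(** The [v] are the components of [sin theta] times the gradient; the density is
    [a * Num.sqrt c * sin theta], and its constant factor cancels. The [D] are derivatives at the
    single point [y] and the other identities hold inside the strip, so the lemma serves both
    functions with a smooth extension and explicit modes. *)
Lemma laplace_beltrami_berger (a c : R) (h : 'rV[R]_3 -> 'M[R]_3)
    (f fx fy fz v1 v2 v3 D1 D2 D3 : R -> R -> R -> R) (y : 'rV[R]_3) :
  0 < a -> 0 < c -> (forall y, chart y -> h y = berger_metric a c y) ->
  (forall x y z, 0 < y < pi ->
     [/\ is_derive x (1 : R) (fun t => f t y z) (fx x y z),
         is_derive y (1 : R) (fun t => f x t z) (fy x y z)
       & is_derive z (1 : R) (fun t => f x y t) (fz x y z)]) ->
  (forall x y z, 0 < y < pi ->
     [/\ v1 x y z = sin y * fx x y z / c - cos y / (2 * a * sin y) * (fz x y z - cos y / 2 * fx x y z),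
         v2 x y z = sin y * fy x y z / a
       & v3 x y z = (fz x y z - cos y / 2 * fx x y z) / (a * sin y)]) ->
  chart y ->
  is_derive (psi_ y) (1 : R) (fun t => v1 t (theta_ y) (phi_ y)) (on3 D1 y) ->
  is_derive (theta_ y) (1 : R) (fun t => v2 (psi_ y) t (phi_ y)) (on3 D2 y) ->
  is_derive (phi_ y) (1 : R) (fun t => v3 (psi_ y) (theta_ y) t) (on3 D3 y) ->
  laplace_beltrami h (on3 f) y = (on3 D1 y + on3 D2 y + on3 D3 y) / sin (theta_ y).
Proof.
move=> a0 c0 hE fd vE cy vd1 vd2 vd3.
have sqc : 0 < Num.sqrt c by rewrite sqrtr_gt0.
have sdet z : chart z -> Num.sqrt (\det (h z)) = a * Num.sqrt c * sin (theta_ z).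
  move=> cz; have sz := chart_sin_gt0 cz.
  rewrite hE// det_berger sqrtrM ?mulr_ge0 ?sqr_ge0 ?ltW//.
  by rewrite sqrtrM ?sqr_ge0// !sqrtr_sqr !gtr0_norm.
have f1 z : chart z -> pderiv (inord 0) (on3 f) z = on3 fx z.
  by move=> cz; have [/is_derive_on3_1[_ E] _ _] := fd (psi_ z) (theta_ z) (phi_ z) cz; exact: E.
have f2 z : chart z -> pderiv (inord 1) (on3 f) z = on3 fy z.
  by move=> cz; have [_ /is_derive_on3_2[_ E] _] := fd (psi_ z) (theta_ z) (phi_ z) cz; exact: E.
have f3 z : chart z -> pderiv (inord 2) (on3 f) z = on3 fz z.
  by move=> cz; have [_ _ /is_derive_on3_3[_ E]] := fd (psi_ z) (theta_ z) (phi_ z) cz; exact: E.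
have step i v : (forall z, chart z -> \sum_(j < 3) berger_inverse a c z i j * pderiv j (on3 f) z * sin (theta_ z) = on3 v z) ->
    forall d, is_derive y (delta_mx 0 i) (on3 v) d ->
    pderiv i (fun z => Num.sqrt (\det (h z)) * \sum_(j < 3) invmx (h z) i j * pderiv j (on3 f) z) y
    = a * Num.sqrt c * d.
  move=> vE' d vd; rewrite /pderiv.
  (* The inverse and the determinant have their closed forms on the chart, so the two functions are
     compared in a neighbourhood of [y]. *)
  have -> : 'D_(delta_mx 0 i) (fun z => Num.sqrt (\det (h z)) * \sum_(j < 3) invmx (h z) i j * 'D_(delta_mx 0 j) (on3 f) z) y
      = 'D_(delta_mx 0 i) ((a * Num.sqrt c) *: on3 v) y.
    apply: near_eq_derive; near=> z.
    have cz : chart z by near: z; exact: near_chart.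
    rewrite sdet// hE// invmx_berger ?gt_eqF// -[RHS]/(a * Num.sqrt c * on3 v z) -vE'// -mulr_suml.
    by rewrite -!mulrA; congr (_ * (_ * _)); exact: mulrC.
  by case: vd => vd1' vd2'; rewrite deriveZ// vd2'.
rewrite /laplace_beltrami sum_I3 sdet//.
rewrite (step _ v1 _ _ (is_derive_on3_1 vd1)); last first.
  move=> z cz; rewrite [RHS]/on3; have [-> _ _] := vE (psi_ z) (theta_ z) (phi_ z) cz.
  have sz : sin (theta_ z) != 0 by rewrite gt_eqF// chart_sin_gt0.
  rewrite sum_I3 f1// f2// f3// !mxE !inord3_eq//= /on3; field.
  by rewrite !gt_eqF ?(chart_sin_gt0 cz).
rewrite (step _ v2 _ _ (is_derive_on3_2 vd2)); last first.
  move=> z cz; rewrite [RHS]/on3; have [_ -> _] := vE (psi_ z) (theta_ z) (phi_ z) cz.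
  have sz : sin (theta_ z) != 0 by rewrite gt_eqF// chart_sin_gt0.
  rewrite sum_I3 f1// f2// f3// !mxE !inord3_eq//= /on3; field.
  by rewrite !gt_eqF ?(chart_sin_gt0 cz).
rewrite (step _ v3 _ _ (is_derive_on3_3 vd3)); last first.
  move=> z cz; rewrite [RHS]/on3; have [_ _ ->] := vE (psi_ z) (theta_ z) (phi_ z) cz.
  rewrite sum_I3 f1// f2// f3// !mxE !inord3_eq//= /on3; field.
  by rewrite !gt_eqF ?(chart_sin_gt0 cz).
field; by rewrite !gt_eqF ?(chart_sin_gt0 cy).
Unshelve. all: by end_near. Qed.

End Berger.

(** * Separation of variables *)

(** Comparing the coefficients of each power of x turns Gauss's hypergeometric equation into this
    two-term recurrence. The two lowest coefficients are treated apart because the shifts by 'X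
    treat them differently. *)
Lemma hypergeometric_ode (R : comNzRingType) (J : {poly R}) (K al be : R) :
  (forall i, (i%:R + 1) * (i%:R + al + 1) * J`_i.+1
             + (K - i%:R * (i%:R + al + be + 1)) * J`_i = 0) ->
  forall x, x * (1 - x) * (J^`()^`()).[x]
    + (al + 1 - (al + be + 2) * x) * (J^`()).[x] + K * J.[x] = 0.
Proof.
move=> rec x.
suff E : 'X * J^`()^`() - 'X * ('X * J^`()^`()) + (al + 1) *: J^`()
    - (al + be + 2) *: ('X * J^`()) + K *: J = 0.
  have := congr1 (horner^~ x) E.
  rewrite !(hornerD, hornerN, hornerZ, hornerM, hornerX, horner0) => H.
  by rewrite -[RHS]H; ring.
apply/polyP => k; rewrite !(coefD, coefN, coefZ, coefXM, coef0, coef_deriv) -[RHS](rec k).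
case: k => [|[|k]] /=.
- by ring.
- by ring.
- by ring.
Qed.

(** * Jacobi polynomials *)

Section Jacobi.
Variables (R : realType) (al be j : nat).

Definition jacobi_eigenvalue (k : nat) : R := k%:R * (k%:R + al%:R + be%:R + 1).

Fixpoint jacobi_coef (k : nat) : R :=
  if k is k'.+1 then
    - (jacobi_eigenvalue j - jacobi_eigenvalue k')
      / (k'.+1%:R * (k'%:R + al%:R + 1)) * jacobi_coef k'
  else 1.

(* The Jacobi polynomial of degree [j], normalized by its value 1 at 0. *)
Definition jacobi : {poly R} := \poly_(k < j.+1) jacobi_coef k.

Lemma jacobi_eigenvalue_lt k l : (k < l)%N ->
  jacobi_eigenvalue k < jacobi_eigenvalue l.
Proof.
rewrite -(ltr_nat R) /jacobi_eigenvalue => kl.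
have := (ler0n R k, ler0n R al, ler0n R be) => -[[? ?] ?]; nra.
Qed.

(** The recurrence stops by itself: its numerator vanishes at index [j], so all later coefficients
    are zero and the truncation loses nothing. *)
Lemma coef_jacobi k : jacobi`_k = jacobi_coef k.
Proof.
rewrite coef_poly; case: ltnP => // jk.
have [i ->] : exists i, k = (i + j.+1)%N by exists (k - j.+1)%N; rewrite subnK.
elim: i {jk} => [|i IH]; first by rewrite add0n /= subrr oppr0 !mul0r.
by rewrite addSn /= -IH mulr0.
Qed.

(** Before index [j] the numerators are differences of strictly increasing eigenvalues, so no
    coefficient vanishes and the degree is exactly [j]. *)
Lemma size_jacobi : size jacobi = j.+1.
Proof.
apply: size_poly_eq => /=.
(* The induction runs over the index of the coefficient, bounded by [j], while the [j] inside the
   recurrence stays fixed. *)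
have : (j <= j)%N by [].
elim: {1 3}j => [_|k IH kj] /=; first exact: oner_neq0.
apply: mulf_neq0; last by apply: IH; exact: ltnW.
apply: mulf_neq0; first by rewrite oppr_eq0 subr_eq0 gt_eqF// jacobi_eigenvalue_lt.
rewrite invr_eq0 mulf_neq0 ?pnatr_eq0//.
Qed.

Lemma jacobi_ode (x : R) :
  x * (1 - x) * (jacobi^`()^`()).[x]
  + (al%:R + 1 - (al%:R + be%:R + 2) * x) * (jacobi^`()).[x]
  + jacobi_eigenvalue j * jacobi.[x] = 0.
Proof.
apply: hypergeometric_ode => i; rewrite !coef_jacobi /=.
have nz : i.+1%:R * (i%:R + al%:R + 1) != 0 :> R.
  by rewrite mulf_neq0 ?pnatr_eq0// gt_eqF// ltr_wpDl ?addr_ge0.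
rewrite natr1 mulrA [_ * (_ / _)]mulrC divfK//.
by rewrite mulNr addNr.
Qed.

End Jacobi.

(** * Separated functions and their smoothness *)

Section Mode.
Variable R : realType.

Definition phase (b : bool) (u : R) : R := if b then cos u else sin u.

(** The argument of z_1^a (conj z_1)^a' z_2^c (conj z_2)^c' in Euler angles. *)
Definition weight (a a' c c' : nat) (x z : R) : R :=
  (a%:R - a'%:R) * (x + z / 2) + (c%:R - c'%:R) * (x - z / 2).

(* The real ([b = true]) or imaginary part of
   z_1^a (conj z_1)^a' z_2^c (conj z_2)^c' J(|z_1|^2) on S^3. *)
Definition mode (b : bool) (a a' c c' : nat) (J : {poly R}) (x y z : R) : R :=
  cos (y / 2) ^+ (a + a') * sin (y / 2) ^+ (c + c') * J.[cos (y / 2) ^+ 2]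
  * phase b (weight a a' c c' x z).

Definition hopf_smooth (f : R -> R -> R -> R) : Prop :=
  exists2 F : 'rV[R]_4 -> R, smooth F & forall x y z, f x y z = F (hopf3 x y z).

Lemma hopf_smooth_cst k : hopf_smooth (fun _ _ _ => k).
Proof. by exists (fun _ => k) => //; exact: smooth_cst. Qed.

Lemma hopf_smoothD f g : hopf_smooth f -> hopf_smooth g ->
  hopf_smooth (fun x y z => f x y z + g x y z).
Proof.
move=> [F Fs FE] [G Gs GE]; exists (fun v => F v + G v); first exact: smoothD.
by move=> x y z; rewrite FE GE.
Qed.

Lemma hopf_smoothM f g : hopf_smooth f -> hopf_smooth g ->
  hopf_smooth (fun x y z => f x y z * g x y z).
Proof.
move=> [F Fs FE] [G Gs GE]; exists (fun v => F v * G v); first exact: smoothM.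
by move=> x y z; rewrite FE GE.
Qed.

Lemma eq_hopf_smooth f g : (forall x y z, f x y z = g x y z) ->
  hopf_smooth g -> hopf_smooth f.
Proof. by move=> fg [G Gs GE]; exists G => // x y z; rewrite fg. Qed.

Lemma hopf_smooth_coord :
  [/\ hopf_smooth (fun x y z => cos (y / 2) * cos (x + z / 2)),
      hopf_smooth (fun x y z => cos (y / 2) * sin (x + z / 2)),
      hopf_smooth (fun x y z => sin (y / 2) * cos (x - z / 2))
    & hopf_smooth (fun x y z => sin (y / 2) * sin (x - z / 2))].
Proof.
split; [exists (fun v => v 0 ord0)|exists (fun v => v 0 (lift ord0 ord0))
  |exists (fun v => v 0 (lift ord0 (lift ord0 ord0)))
  |exists (fun v => v 0 (lift ord0 (lift ord0 (lift ord0 ord0))))];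
  try exact: smooth_coord; by move=> x y z; rewrite mxE.
Qed.

Lemma hopf_smooth_horner (J : {poly R}) f : hopf_smooth f ->
  hopf_smooth (fun x y z => J.[f x y z]).
Proof.
move=> hf; elim/poly_ind: J => [|J k IH].
  by apply: eq_hopf_smooth (hopf_smooth_cst 0) => x y z; rewrite horner0.
apply: eq_hopf_smooth (hopf_smoothD (hopf_smoothM IH hf) (hopf_smooth_cst k)) => x y z.
by rewrite hornerMXaddC.
Qed.

Lemma hopf_smooth_cos2 : hopf_smooth (fun _ y _ => cos (y / 2) ^+ 2).
Proof.
have [h0 h1 _ _] := hopf_smooth_coord.
apply: eq_hopf_smooth (hopf_smoothD (hopf_smoothM h0 h0) (hopf_smoothM h1 h1)) => x y z.
transitivity (cos (y / 2) ^+ 2 * (cos (x + z / 2) ^+ 2 + sin (x + z / 2) ^+ 2)).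
  by rewrite cos2Dsin2 mulr1.
by ring.
Qed.

(** By the addition formulas, one more factor z_1, z_2 or a conjugate mixes the real and the
    imaginary part with coordinate functions as coefficients. The induction on the four exponents
    therefore treats both values of [b] together, and the polynomial in |z_1|^2 is a separate smooth
    factor. *)
Lemma hopf_smooth_mode b a a' c c' J : hopf_smooth (mode b a a' c c' J).
Proof.
have [h0 h1 h2 h3] := hopf_smooth_coord.
have S (f g : R -> R -> R -> R) e : hopf_smooth f -> hopf_smooth g -> (e = 1 \/ e = -1) -> forall h,
  (forall x y z, h x y z = f x y z + e * g x y z) -> hopf_smooth h.
  move=> hf hg _ h hE; apply: eq_hopf_smooth hE _.
  by apply: hopf_smoothD => //; apply: hopf_smoothM => //; exact: hopf_smooth_cst.
suff H b' : hopf_smooth (mode b' a a' c c' 1).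
  apply: eq_hopf_smooth (hopf_smoothM (H b) (hopf_smooth_horner J hopf_smooth_cos2)) => x y z.
  by rewrite /mode hornerC; ring.
elim: a b' => [|a IH] b'; last first.
  have wa x z : weight a.+1 a' c c' x z = weight a a' c c' x z + (x + z / 2).
    by rewrite /weight -natr1; ring.
  case: b'.
    apply: (S _ _ (-1) (hopf_smoothM (IH true) h0) (hopf_smoothM (IH false) h1)) => [|x y z]; first by right.
    by rewrite /mode /phase wa cosD addSn exprS; ring.
  apply: (S _ _ 1 (hopf_smoothM (IH false) h0) (hopf_smoothM (IH true) h1)) => [|x y z]; first by left.
  by rewrite /mode /phase wa sinD addSn exprS; ring.
elim: a' b' => [|a' IH] b'; last first.
  have wa x z : weight 0 a'.+1 c c' x z = weight 0 a' c c' x z - (x + z / 2).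
    by rewrite /weight -natr1; ring.
  case: b'.
    apply: (S _ _ 1 (hopf_smoothM (IH true) h0) (hopf_smoothM (IH false) h1)) => [|x y z]; first by left.
    by rewrite /mode /phase wa cosB addnS exprS; ring.
  apply: (S _ _ (-1) (hopf_smoothM (IH false) h0) (hopf_smoothM (IH true) h1)) => [|x y z]; first by right.
  by rewrite /mode /phase wa sinB addnS exprS; ring.
elim: c b' => [|c IH] b'; last first.
  have wa x z : weight 0 0 c.+1 c' x z = weight 0 0 c c' x z + (x - z / 2).
    by rewrite /weight -natr1; ring.
  case: b'.
    apply: (S _ _ (-1) (hopf_smoothM (IH true) h2) (hopf_smoothM (IH false) h3)) => [|x y z]; first by right.
    by rewrite /mode /phase wa cosD addSn exprS; ring.
  apply: (S _ _ 1 (hopf_smoothM (IH false) h2) (hopf_smoothM (IH true) h3)) => [|x y z]; first by left.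
  by rewrite /mode /phase wa sinD addSn exprS; ring.
elim: c' b' => [|c' IH] b'; last first.
  have wa x z : weight 0 0 0 c'.+1 x z = weight 0 0 0 c' x z - (x - z / 2).
    by rewrite /weight -natr1; ring.
  case: b'.
    apply: (S _ _ 1 (hopf_smoothM (IH true) h2) (hopf_smoothM (IH false) h3)) => [|x y z]; first by left.
    by rewrite /mode /phase wa cosB addnS exprS; ring.
  apply: (S _ _ (-1) (hopf_smoothM (IH false) h2) (hopf_smoothM (IH true) h3)) => [|x y z]; first by right.
  by rewrite /mode /phase wa sinB addnS exprS; ring.
apply: eq_hopf_smooth (hopf_smooth_cst (if b' then 1 else 0)) => x y z.
rewrite /mode /weight /phase !subrr !mul0r addr0 sin0 cos0 hornerC.
by case: b'; ring.
Qed.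

End Mode.

(** * The Laplacian of a separated function *)

Section ModeLaplacian.
Variable R : realType.

Lemma half_gt0 (y : R) : 0 < y < pi -> 0 < cos (y / 2) /\ 0 < sin (y / 2).
Proof.
move=> /andP[y0 yp]; split.
  by apply: cos_gt0_pihalf; apply/andP; split; lra.
by apply: sin_gt0_pi; apply/andP; split; lra.
Qed.

Lemma der_radial_weight (al be : nat) (y : R) : 0 < y < pi ->
  is_derive y (1 : R) (fun t => cos (t / 2) ^+ al * sin (t / 2) ^+ be)
    (cos (y / 2) ^+ al * sin (y / 2) ^+ be
     * ((be%:R * cos (y / 2) ^+ 2 - al%:R * sin (y / 2) ^+ 2)
        / (2 * cos (y / 2) * sin (y / 2)))).
Proof.
move=> /half_gt0[C0 S0]; der.
have Cn : cos (y / 2) != 0 by rewrite gt_eqF.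
have Sn : sin (y / 2) != 0 by rewrite gt_eqF.
(* The factor [n] makes both sides vanish at [n = 0], so the truncated exponent [n.-1] can be traded
   for a division. *)
have E (u : R) n : u != 0 -> n%:R * u ^+ n.-1 = n%:R * u ^+ n / u.
  by case: n => [|n] u0; rewrite ?mul0r// exprSr mulrA mulfK.
rewrite (E _ al)// (E _ be)//; field.
by rewrite ?Cn ?Sn.
Qed.

(* With [xi = |z_1|^2], the radial part of the Laplacian turns the
   hypergeometric equation into the eigenvalue equation. *)
Lemma radial_identity (m m' n n' j J0 J1 J2 xi : R) :
  m * m' = 0 -> n * n' = 0 ->
  xi * (1 - xi) * J2 + (m + m' + 1 - (m + m' + (n + n') + 2) * xi) * J1
    + j * (j + (m + m') + (n + n') + 1) * J0 = 0 ->
  let p := m + n + j in let q := m' + n' + j in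
  let w := (n + n') * xi - (m + m') * (1 - xi) in
  w * (w * J0 - 2 * xi * (1 - xi) * J1)
  - 2 * xi * (1 - xi) * ((n + n' + (m + m')) * J0 + w * J1
     - 2 * (1 - 2 * xi) * J1 - 2 * xi * (1 - xi) * J2)
  = (((1 - xi) * (m - m') - xi * (n - n')) ^+ 2
     - 4 * (p * q + (p + q) / 2) * xi * (1 - xi)) * J0.
Proof.
move=> /eqP; rewrite mulf_eq0 => m0 /eqP; rewrite mulf_eq0 => n0 ode p q w.
apply/eqP; rewrite -subr_eq0; apply/eqP.
(* Once one of [m], [m'] and one of [n], [n'] is zero, the difference of the two sides is
   [4 * xi * (1 - xi)] times the hypergeometric equation. *)
rewrite -[RHS](mulr0 (4 * xi * (1 - xi))) -ode /p /q /w.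
by case/orP: m0 => /eqP ->; case/orP: n0 => /eqP ->; field.
Qed.

Lemma laplace_beltrami_mode (a c : R) (h : 'rV[R]_3 -> 'M[R]_3) b
    (m m' n n' j : nat) (y : 'rV[R]_3) :
  0 < a -> 0 < c -> (forall y, chart y -> h y = berger_metric a c y) ->
  (m * m' = 0)%N -> (n * n' = 0)%N ->
  let p : R := (m + n + j)%:R in let q : R := (m' + n' + j)%:R in
  let f := on3 (mode b m m' n n' (jacobi R (m + m') (n + n') j)) in
  chart y ->
  laplace_beltrami h f y =
    - ((2 * p * q + p + q) / (2 * a) + (p - q) ^+ 2 / c) * f y.
Proof.
move=> a0 c0 hE mm nn p q f cy.
have mm' : (m%:R * m'%:R = 0 :> R) by rewrite -natrM mm.
have nn' : (n%:R * n'%:R = 0 :> R) by rewrite -natrM nn.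
pose al : R := m%:R + m'%:R; pose be : R := n%:R + n'%:R.
pose mu : R := m%:R - m'%:R; pose nu : R := n%:R - n'%:R.
(* [M] and [N] are the frequencies of the mode in psi and phi. *)
pose M : R := mu + nu; pose N : R := (mu - nu) / 2.
pose J := jacobi R (m + m') (n + n') j.
pose g0 (y : R) := cos (y / 2) ^+ (m + m') * sin (y / 2) ^+ (n + n').
pose W (y : R) := (be * cos (y / 2) ^+ 2 - al * sin (y / 2) ^+ 2) / (2 * cos (y / 2) * sin (y / 2)).
pose G (y : R) := g0 y * J.[cos (y / 2) ^+ 2].
pose u (x z : R) := weight m m' n n' x z.
pose dphase (t : R) := if b then - sin t else cos t.
(* [sin t] times the derivative of the radial part [G] is [g0 t] times [Rp] at [cos (t / 2) ^+ 2];
   the second theta derivative thus again involves only [g0] and a polynomial. *)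
pose Rp : {poly R} := (be%:P * 'X - al%:P * (1 - 'X)) * J - 2%:P * 'X * (1 - 'X) * J^`().
have RpE (s : R) : Rp.[s] = (be * s - al * (1 - s)) * J.[s] - 2 * s * (1 - s) * (J^`()).[s].
  by rewrite /Rp !(hornerD, hornerN, hornerM, hornerC, hornerX).
have Rp'E (s : R) : (Rp^`()).[s] = (be + al) * J.[s] + (be * s - al * (1 - s)) * (J^`()).[s]
    - 2 * (1 - 2 * s) * (J^`()).[s] - 2 * s * (1 - s) * (J^`()^`()).[s].
  rewrite /Rp !(derivD, derivN, derivM, derivC, derivX).
  by rewrite !(hornerD, hornerN, hornerM, hornerC, hornerX, horner0); ring.
have g0d (t : R) : 0 < t < pi -> is_derive t (1 : R) g0 (g0 t * W t).
  by move=> tp; have := der_radial_weight (m + m') (n + n') tp; rewrite !natrD.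
have Gd (t : R) : 0 < t < pi -> is_derive t (1 : R) G
    (g0 t * W t * J.[cos (t / 2) ^+ 2] - g0 t * (J^`()).[cos (t / 2) ^+ 2] * (cos (t / 2) * sin (t / 2))).
  by move=> /g0d ?; rewrite /G; der; field.
have phd (x k d : R) (w : R -> R) : is_derive x (1 : R) w d -> is_derive x (1 : R) (fun t => k * phase b (w t)) (k * (dphase (w x) * d)).
  by move=> ?; rewrite /phase /dphase; case: (b); der; ring.
have dphd (x k d : R) (w : R -> R) : is_derive x (1 : R) w d -> is_derive x (1 : R) (fun t => k * dphase (w t)) (k * (- phase b (w x) * d)).
  by move=> ?; rewrite /phase /dphase; case: (b); der; ring.
have ux x z : is_derive x (1 : R) (fun t => u t z) M by rewrite /u /weight; der; rewrite /M /mu /nu; ring.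
have uz x z : is_derive z (1 : R) (fun t => u x t) N by rewrite /u /weight; der; rewrite /N /mu /nu; field.
pose fx (x y z : R) := G y * dphase (u x z) * M.
pose fy (x y z : R) := (g0 y * W y * J.[cos (y / 2) ^+ 2] - g0 y * (J^`()).[cos (y / 2) ^+ 2] * (cos (y / 2) * sin (y / 2))) * phase b (u x z).
pose fz (x y z : R) := G y * dphase (u x z) * N.
pose k1 (y : R) := (sin y * M / c - cos y / (2 * a * sin y) * (N - cos y / 2 * M)) * G y.
pose k3 (y : R) := (N - cos y / 2 * M) / (a * sin y) * G y.
pose v1 (x y z : R) := k1 y * dphase (u x z).
pose v2 (x y z : R) := g0 y * Rp.[cos (y / 2) ^+ 2] * (phase b (u x z) / a).
pose v3 (x y z : R) := k3 y * dphase (u x z).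
pose D1 (x y z : R) := k1 y * (- phase b (u x z) * M).
pose D2 (x y z : R) := (g0 y * W y * Rp.[cos (y / 2) ^+ 2] - g0 y * (Rp^`()).[cos (y / 2) ^+ 2] * (cos (y / 2) * sin (y / 2))) * (phase b (u x z) / a).
pose D3 (x y z : R) := k3 y * (- phase b (u x z) * N).
rewrite /f; refine (eq_trans (@laplace_beltrami_berger R a c h _ fx fy fz v1 v2 v3 D1 D2 D3 y
  a0 c0 hE _ _ cy _ _ _) _).
- move=> x t z tp; split.
  + by apply: der_eq (phd _ _ _ _ (ux x z)); exact: mulrA.
  + by apply: der_eq (derM (Gd _ tp) (der_cst t (phase b (u x z)))); rewrite mulr0 addr0.
  + by apply: der_eq (phd _ _ _ _ (uz x z)); exact: mulrA.
- move=> x t z tp; have [C0 S0] := half_gt0 tp; split.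
  + by rewrite /v1 /k1 /fx /fz; ring.
  + have Cn : cos (t / 2) != 0 by rewrite gt_eqF.
    have Sn : sin (t / 2) != 0 by rewrite gt_eqF.
    rewrite /v2 /fy /W (sin_half t) RpE -sin2cos2; field.
    by rewrite Cn Sn gt_eqF.
  + by rewrite /v3 /k3 /fx /fz; ring.
- exact: (dphd _ _ _ _ (ux _ _)).
- have Rd : is_derive (theta_ y) (1 : R) (fun t => Rp.[cos (t / 2) ^+ 2])
      ((Rp^`()).[cos (theta_ y / 2) ^+ 2] * - (cos (theta_ y / 2) * sin (theta_ y / 2))).
    by der; field.
  apply: der_eq (derM (derM (g0d _ cy) Rd) (der_cst _ _)).
  by rewrite /on3 /D2; ring.
- have [C0 S0] := half_gt0 cy; have : 0 < theta_ y < pi by []. rewrite /f /on3 => {}cy.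
  move: (psi_ y) (theta_ y) (phi_ y) C0 S0 cy => x t z C0 S0 tp.
  rewrite /D1 /D2 /D3 /mode -/(u x z) -/(g0 t) -/J.
  have sC : sin (t / 2) ^+ 2 = 1 - cos (t / 2) ^+ 2 by rewrite sin2cos2.
  have ode := @jacobi_ode R (m + m') (n + n') j (cos (t / 2) ^+ 2).
  rewrite -/J /jacobi_eigenvalue !natrD in ode.
  have rid := radial_identity mm' nn' ode.
  (* The radial equation after multiplication by [2 * cos (t / 2) * sin (t / 2) = sin t] is
     [radial_identity] at [xi = cos (t / 2) ^+ 2]. *)
  have key : g0 t * W t * Rp.[cos (t / 2) ^+ 2] - g0 t * (Rp^`()).[cos (t / 2) ^+ 2] * (cos (t / 2) * sin (t / 2))
     = g0 t * J.[cos (t / 2) ^+ 2] * ((sin (t / 2) ^+ 2 * mu - cos (t / 2) ^+ 2 * nu) ^+ 2 / sin t - (p * q + (p + q) / 2) * sin t).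
    have Cn : cos (t / 2) != 0 by rewrite gt_eqF.
    have Sn : sin (t / 2) != 0 by rewrite gt_eqF.
    apply: (@mulfI _ (2 * cos (t / 2) * sin (t / 2))); first by rewrite !mulf_neq0.
    transitivity (g0 t * (((1 - cos (t / 2) ^+ 2) * mu - cos (t / 2) ^+ 2 * nu) ^+ 2
      - 4 * (p * q + (p + q) / 2) * cos (t / 2) ^+ 2 * (1 - cos (t / 2) ^+ 2)) * J.[cos (t / 2) ^+ 2]); last first.
      by rewrite (sin_half t) -sC; field; rewrite Cn Sn.
    rewrite -[RHS]mulrA /p /q /mu /nu !natrD -rid RpE Rp'E /W -sC /al /be; field.
    by rewrite Cn Sn.
  rewrite key /k1 /k3 /G.
  have -> : N - cos t / 2 * M = sin (t / 2) ^+ 2 * mu - cos (t / 2) ^+ 2 * nu.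
    by rewrite (cos_half t) sC /N /M; field.
  have -> : p - q = M by rewrite /p /q /M /mu /nu !natrD; ring.
  have st : sin t != 0 by rewrite gt_eqF// sin_gt0_pi.
  have N2 : N = sin (t / 2) ^+ 2 * mu - cos (t / 2) ^+ 2 * nu + cos t / 2 * M.
    by rewrite (cos_half t) sC /N /M; field.
  rewrite N2; field.
  by rewrite st !gt_eqF.
Qed.

End ModeLaplacian.

(** * Geometry of a block-diagonal metric *)

Section BlockMetric.
Variables (R : realType) (n : nat) (G : 'rV[R]_(1 + n) -> 'M[R]_(1 + n)).
Variables (g : R -> R) (H : R -> 'rV[R]_n -> 'M[R]_n).
Hypothesis GE : forall x y, G (slice x y) = block_mx (g x)%:M 0 0 (H x y).

Lemma ord0_lshift : (ord0 : 'I_(1 + n)) = lshift n ord0.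
Proof. exact: val_inj. Qed.

Lemma sum_slice (V : zmodType) (F : 'I_(1 + n) -> V) :
  \sum_(k < 1 + n) F k = F ord0 + \sum_(k < n) F (rshift 1 k).
Proof. by rewrite big_split_ord big_ord1 ord0_lshift. Qed.

Lemma ord0_neq_rshift i : (ord0 == rshift 1 i :> 'I_(1 + n)) = false.
Proof. by []. Qed.

Lemma sliceE (p : 'rV[R]_(1 + n)) : p = slice (lsubmx p 0 0) (rsubmx p).
Proof.
by rewrite -{1}(hsubmxK p) /slice; congr row_mx; apply/matrixP => i j; rewrite !ord1 !mxE.
Qed.

Lemma slice_line0 (h x : R) (y : 'rV[R]_n) :
  h *: delta_mx 0 ord0 + slice x y = slice (h + x) y.
Proof.
apply/rowP => k; rewrite !mxE; case: splitP => j.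
  by rewrite (ord1 j) => k0; rewrite !mxE eqxx mulr1n (_ : k = ord0) ?eqxx ?mulr1//; apply: val_inj.
move=> kj; rewrite (_ : k == ord0 = false) ?mulr0 ?add0r//.
by apply/eqP => k0; rewrite k0 in kj.
Qed.

Lemma slice_lineS (h x : R) (y : 'rV[R]_n) i :
  h *: delta_mx 0 (rshift 1 i) + slice x y = slice x (h *: delta_mx 0 i + y).
Proof.
apply/rowP => k; rewrite !mxE; case: splitP => j kj.
  rewrite (ord1 j) !mxE (_ : k == rshift 1 i = false) ?mulr0 ?add0r//.
  by apply/eqP => k0; rewrite k0 (ord1 j) in kj.
rewrite !mxE !eqxx /= -(val_eqE k) /= kj.
by rewrite -[(_ == (1 + i)%N)]/(j == i :> nat).
Qed.

Lemma pderiv0 (f : 'rV[R]_(1 + n) -> R) x y :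
  pderiv ord0 f (slice x y) = 'D_1 (fun t : R => f (slice t y)) x.
Proof.
rewrite /pderiv /derive.
under eq_fun do rewrite /= slice_line0.
by under [in RHS]eq_fun do rewrite /= [_ *: 1]mulr1.
Qed.

Lemma pderivS (f : 'rV[R]_(1 + n) -> R) x y i :
  pderiv (rshift 1 i) f (slice x y) = pderiv i (fun z => f (slice x z)) y.
Proof.
by rewrite /pderiv /derive; under eq_fun do rewrite /= slice_lineS.
Qed.

Lemma G00 x y : G (slice x y) ord0 ord0 = g x.
Proof. by rewrite GE ord0_lshift block_mxEul mxE eqxx. Qed.
Lemma G0S x y i : G (slice x y) ord0 (rshift 1 i) = 0.
Proof. by rewrite GE ord0_lshift block_mxEur mxE. Qed.
Lemma GS0 x y i : G (slice x y) (rshift 1 i) ord0 = 0.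
Proof. by rewrite GE ord0_lshift block_mxEdl mxE. Qed.
Lemma GSS x y i j : G (slice x y) (rshift 1 i) (rshift 1 j) = H x y i j.
Proof. by rewrite GE block_mxEdr. Qed.

Lemma dG00_0 x y : pderiv ord0 (fun q => G q ord0 ord0) (slice x y) = 'D_1 g x.
Proof.
by rewrite pderiv0 (_ : (fun t => G (slice t y) ord0 ord0) = g)//; apply/funext => t; exact: G00.
Qed.
Lemma dG00_S x y i : pderiv (rshift 1 i) (fun q => G q ord0 ord0) (slice x y) = 0.
Proof.
rewrite pderivS /pderiv (_ : (fun z => _) = fun=> g x) ?derive_cst//.
by apply/funext => z; exact: G00.
Qed.
Lemma dG0S k p i : pderiv k (fun q => G q ord0 (rshift 1 i)) p = 0.
Proof.
rewrite /pderiv (_ : (fun q => _) = fun=> 0) ?derive_cst//.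
by apply/funext => q; rewrite (sliceE q) G0S.
Qed.
Lemma dGS0 k p i : pderiv k (fun q => G q (rshift 1 i) ord0) p = 0.
Proof.
rewrite /pderiv (_ : (fun q => _) = fun=> 0) ?derive_cst//.
by apply/funext => q; rewrite (sliceE q) GS0.
Qed.
Lemma dGSS_0 x y i j : pderiv ord0 (fun q => G q (rshift 1 i) (rshift 1 j)) (slice x y)
  = 'D_1 (fun t : R => H t y i j) x.
Proof.
by rewrite pderiv0 (_ : (fun t => _) = fun t => H t y i j)//; apply/funext => t; exact: GSS.
Qed.

Definition regular x y := g x != 0 /\ H x y \in unitmx.

Lemma regular_unit x y : regular x y ->
  block_mx ((g x)%:M : 'M[R]_1) 0 0 (H x y) \in unitmx.
Proof.
case=> g0 Hu; rewrite unitmxE det_ublock det_scalar1 unitrM unitfE g0.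
by rewrite -unitmxE.
Qed.

Lemma invG x y : regular x y ->
  invmx (G (slice x y)) = block_mx (g x)^-1%:M 0 0 (invmx (H x y)).
Proof.
move=> reg; rewrite GE invmx_block_diag ?regular_unit//.
by rewrite invmx_scalar ?unitfE//; case: reg.
Qed.

Lemma inv00 x y : regular x y -> invmx (G (slice x y)) ord0 ord0 = (g x)^-1.
Proof. by move=> reg; rewrite invG// ord0_lshift block_mxEul mxE eqxx. Qed.
Lemma inv0S x y i : regular x y -> invmx (G (slice x y)) ord0 (rshift 1 i) = 0.
Proof. by move=> reg; rewrite invG// ord0_lshift block_mxEur mxE. Qed.
Lemma invS0 x y i : regular x y -> invmx (G (slice x y)) (rshift 1 i) ord0 = 0.
Proof. by move=> reg; rewrite invG// ord0_lshift block_mxEdl mxE. Qed.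
Lemma invSS x y i j : regular x y ->
  invmx (G (slice x y)) (rshift 1 i) (rshift 1 j) = invmx (H x y) i j.
Proof. by move=> reg; rewrite invG// block_mxEdr. Qed.

Lemma christoffel000 x y : regular x y ->
  christoffel G ord0 ord0 ord0 (slice x y) = 2^-1 * ((g x)^-1 * 'D_1 g x).
Proof.
move=> reg; rewrite /christoffel sum_slice inv00// dG00_0 big1 => [|i _]; last first.
  by rewrite inv0S// mul0r.
by rewrite addr0 addrK.
Qed.

Lemma christoffelS00 x y k : regular x y ->
  christoffel G (rshift 1 k) ord0 ord0 (slice x y) = 0.
Proof.
move=> reg; rewrite /christoffel sum_slice invS0// mul0r add0r big1 ?mulr0// => i _.
by rewrite dG0S dG00_S !addr0 subr0 mulr0.
Qed.

Lemma christoffel00S x y k : regular x y ->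
  christoffel G ord0 ord0 (rshift 1 k) (slice x y) = 0.
Proof.
move=> reg; rewrite /christoffel sum_slice inv00// dGS0 dG00_S dG0S big1 => [|i _]; last first.
  by rewrite inv0S// mul0r.
by rewrite !addr0 subrr !mulr0.
Qed.

Lemma christoffelS0S x y k l : regular x y ->
  christoffel G (rshift 1 k) ord0 (rshift 1 l) (slice x y)
  = 2^-1 * \sum_(m < n) invmx (H x y) k m * 'D_1 (fun t : R => H t y l m) x.
Proof.
move=> reg; rewrite /christoffel sum_slice invS0// mul0r add0r; congr (_ * _).
by apply: eq_bigr => m _; rewrite invSS// dGSS_0 !dG0S addr0 subr0.
Qed.

Lemma christoffelSS0 x y k l : regular x y ->
  christoffel G (rshift 1 k) (rshift 1 l) ord0 (slice x y)
  = 2^-1 * \sum_(m < n) invmx (H x y) k m * 'D_1 (fun t : R => H t y l m) x.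
Proof.
move=> reg; rewrite /christoffel sum_slice invS0// mul0r add0r; congr (_ * _).
by apply: eq_bigr => m _; rewrite invSS// dGSS_0 dG0S dGS0 add0r subr0.
Qed.

Lemma unit_normal_slice x y : 0 < g x -> H x y \in unitmx ->
  unit_normal G (slice x y) = (Num.sqrt (g x))^-1 *: delta_mx 0 ord0.
Proof.
move=> g0 Hu; have reg : regular x y by split=> //; rewrite gt_eqF.
have sg : 0 < Num.sqrt (g x) by rewrite sqrtr_gt0.
apply/rowP => k; rewrite /unit_normal inv00// !mxE.
rewrite (sqrtrV (ltW g0)) invrK.
have [->|] := eqVneq k ord0.
  rewrite inv00// mulr1; apply: (@mulfI _ (Num.sqrt (g x))); first by rewrite gt_eqF.
  by rewrite mulrA -expr2 sqr_sqrtr ?ltW// !divff// gt_eqF.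
case: (split_ordP k) => j -> {k}; first by rewrite (ord1 j) -ord0_lshift eqxx.
by rewrite inv0S// !mulr0.
Qed.

(** The normal has no tangential component, so its covariant derivative comes from the Christoffel
    symbols with one normal index. These are half the x-derivative of [H] with an index raised by
    the inverse of [H], and pairing with a tangent vector lowers it again. *)
Lemma second_fundamental_form_slice x y i j : 0 < g x ->
  (forall z, (H x z)^T = H x z) -> (\forall z \near y, H x z \in unitmx) ->
  second_fundamental_form G x y i j
  = (2 * Num.sqrt (g x))^-1 * 'D_1 (fun t : R => H t y i j) x.
Proof.
move=> g0 Hsym Hu; have Huy : H x y \in unitmx := nbhs_singleton Hu.
have reg : regular x y by split=> //; rewrite gt_eqF.
rewrite mxE /bilin.
set w := covderiv _ _ _ _.
have -> : (w *m G (slice x y) *m (delta_mx 0 (rshift 1 j) : 'rV[R]_(1 + n))^T) 0 0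
   = \sum_(k < n) w 0 (rshift 1 k) * H x y k j.
  rewrite trmx_delta -colE mxE mxE sum_slice G0S mulr0 add0r.
  by apply: eq_bigr => k _; rewrite GSS.
have wE k : w 0 (rshift 1 k) = (Num.sqrt (g x))^-1 *
    (2^-1 * \sum_(m < n) invmx (H x y) k m * 'D_1 (fun t : R => H t y i m) x).
  rewrite mxE.
  (* The tangential components of the normal vanish on a neighbourhood, not just at the point. *)
  have -> : 'D_(delta_mx 0 (rshift 1 i)) (fun q => unit_normal G q 0 (rshift 1 k)) (slice x y) = 0.
    rewrite -/(pderiv (rshift 1 i) _ _) pderivS /pderiv.
    rewrite (@near_eq_derive _ _ _ _ (fun=> 0)) ?derive_cst//; near=> z.
    rewrite unit_normal_slice//; last by near: z.
    by rewrite !mxE mulr0.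
  rewrite add0r sum_slice [X in X + _]big1 => [|l _]; last first.
    by rewrite mxE ord0_neq_rshift andbF mulr0 mul0r.
  rewrite add0r (bigD1 i)//= [X in _ + X]big1 => [|l li]; last first.
    rewrite big1 // => m _; rewrite mxE.
    by rewrite eqxx /= (inj_eq (@rshift_inj _ _)) (negbTE li) mulr0 mul0r.
  rewrite addr0 sum_slice [X in _ + X]big1 => [|l _]; last first.
    by rewrite unit_normal_slice// !mxE mulr0 mulr0.
  rewrite addr0 unit_normal_slice// !mxE !eqxx !mulr1 christoffelSS0//.
  by rewrite mulrC.
have invsym : (invmx (H x y))^T = invmx (H x y) by rewrite trmx_inv Hsym.
have invE m : \sum_(k < n) invmx (H x y) k m * H x y k j = (m == j)%:R.
  have /matrixP/(_ m j) := mulVmx Huy; rewrite !mxE => <-.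
  by apply: eq_bigr => k _; rewrite -{1}invsym mxE.
pose D m := 'D_1 (fun t : R => H t y i m) x.
transitivity ((Num.sqrt (g x))^-1 * 2^-1 * \sum_(m < n) D m * (m == j)%:R); last first.
  rewrite (bigD1 j)//= eqxx mulr1 big1 => [|m mj]; last by rewrite (negbTE mj) mulr0.
  by rewrite addr0 invfM [2^-1 * _]mulrC.
under [in RHS]eq_bigr => m _ do rewrite -invE mulr_sumr.
rewrite exchange_big mulr_sumr; apply: eq_bigr => k _.
rewrite wE -!mulrA; congr (_ * (_ * _)); rewrite mulr_suml.
by apply: eq_bigr => m _; rewrite mulrA [D m * _]mulrC.
Unshelve. all: by end_near. Qed.

(** Where the x-derivatives of [g] and [H] vanish, so do all Christoffel symbols with a lower normal
    index, and with them every quadratic term. The tangential symbols with two lower normal indices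
    vanish nearby, so what survives is minus the x-derivative of a trace. *)
Lemma ricci_slice x y : g x != 0 -> (\forall z \near x, regular z y) ->
  (\forall z \near y, regular x z) -> 'D_1 g x = 0 ->
  (forall i j, 'D_1 (fun t : R => H t y i j) x = 0) ->
  ricci G (slice x y) ord0 ord0 = - \sum_(k < n) 'D_1 (fun t : R =>
     2^-1 * \sum_(m < n) invmx (H t y) k m * 'D_1 (fun t : R => H t y k m) t) x.
Proof.
move=> g0 regx regy g'0 H'0.
have reg : regular x y := nbhs_singleton regx.
have split_index (k : 'I_(1 + n)) : k = ord0 \/ exists l, k = rshift 1 l.
  by case: (split_ordP k) => l ->; [left; rewrite (ord1 l) -ord0_lshift|right; exists l].
have c0 k l : christoffel G k ord0 l (slice x y) = 0.
  case: (split_index k) => [->|[k' ->]]; case: (split_index l) => [->|[l' ->]].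
  - by rewrite christoffel000// g'0 !mulr0.
  - exact: christoffel00S.
  - exact: christoffelS00.
  - by rewrite christoffelS0S// big1 ?mulr0// => m _; rewrite H'0 mulr0.
rewrite mxE [X in _ + X]big1 => [|k _]; last first.
  by rewrite big1// => l _; rewrite !c0 !mulr0 subrr.
rewrite sum_slice subrr add0r.
rewrite addr0 -sumrN; apply: eq_bigr => k _.
rewrite pderivS /pderiv (@near_eq_derive _ _ _ _ (fun=> 0)); last first.
  near=> z; rewrite christoffelS00//; by near: z.
rewrite derive_cst add0r; congr (- _).
rewrite -/(pderiv ord0 _ _) pderiv0; apply: near_eq_derive; near=> z.
by rewrite christoffelS0S//; near: z.
Unshelve. all: by end_near. Qed.

End BlockMetric.

(** * The level sets of the Page metric *)

Section Page.
Variables (R : realType) (nu : R).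
Hypothesis nu01 : 0 < nu < 1.
Let A := page_A nu.
Let B := page_B nu.
Let S := page_S nu.
Let F : R := 4 * page_alpha nu ^+ 2.

Let nu2 : 0 < nu ^+ 2 < 1.
Proof. by case/andP: nu01 => n0 n1; rewrite exprn_gt0// expr_lt1// ltW. Qed.

Let S_gt0 : 0 < S.
Proof. by rewrite /S /page_S /page_Lambda; case/andP: nu2 => *; rewrite divr_gt0//; lra. Qed.

Let F_gt0 : 0 < F.
Proof.
rewrite /F /page_alpha mulr_gt0// exprn_gt0// divr_gt0//.
by case/andP: nu2 => *; lra.
Qed.

Definition page_num (x : R) : R := 3 - nu ^+ 2 - nu ^+ 2 * (1 + nu ^+ 2) * x ^+ 2.

Lemma page_factors_gt0 (x : R) : -1 < x < 1 ->
  [/\ 0 < page_num x, 0 < 1 - x ^+ 2, 0 < 1 - nu ^+ 2 * x ^+ 2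
    & 0 < 3 + 6 * nu ^+ 2 - nu ^+ 4].
Proof.
rewrite -[_ && _]/(-1 < x < 1) -ltr_norml => x1.
have x2 : x ^+ 2 < 1 by rewrite -real_normK ?num_real// expr_lt1.
have x20 : 0 <= x ^+ 2 by exact: sqr_ge0.
case/andP: nu2; rewrite /page_num (exprM nu 2 2); move: (nu ^+ 2) (x ^+ 2) x2 x20.
by move=> n X X1 X0 n0 n1; split; nra.
Qed.

Lemma page_A_gt0 (x : R) : -1 < x < 1 -> 0 < A x.
Proof. by case/page_factors_gt0 => *; rewrite /A /page_A divr_gt0// mulr_gt0. Qed.

Lemma page_B_gt0 (x : R) : -1 < x < 1 -> 0 < B x.
Proof. by case/page_factors_gt0 => *; rewrite /B /page_B divr_gt0. Qed.

Lemma page_coef_gt0 (x : R) : -1 < x < 1 -> 0 < S * B x /\ 0 < S * (F * A x).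
Proof.
move=> x1; split; first exact: mulr_gt0 (page_B_gt0 x1).
exact: mulr_gt0 S_gt0 (mulr_gt0 F_gt0 (page_A_gt0 x1)).
Qed.

(** The logarithmic derivative of [page_A] with its factor [x] pulled out, which displays the
    critical point at 0 and reduces the second derivative there to an evaluation of the other
    factor. *)
Definition page_log_dA (x : R) : R :=
  x * (2 * nu ^+ 2 / (1 - nu ^+ 2 * x ^+ 2) - 2 / (1 - x ^+ 2)
       - 2 * nu ^+ 2 * (1 + nu ^+ 2) / page_num x).
Definition page_log_dB (x : R) : R := x * (- (2 * nu ^+ 2 / (1 - nu ^+ 2 * x ^+ 2))).

Lemma page_A_derive (x : R) : -1 < x < 1 -> is_derive x (1 : R) A (A x * page_log_dA x).
Proof.
case/page_factors_gt0 => n0 x0 d0 _.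
have d1 : 1 - nu ^+ 2 * x ^+ 2 != 0 by rewrite gt_eqF.
rewrite /A /page_A.
have dn : is_derive x (1 : R) (fun t => (3 - nu ^+ 2 - nu ^+ 2 * (1 + nu ^+ 2) * t ^+ 2) * (1 - t ^+ 2))
   (- (2 * nu ^+ 2 * (1 + nu ^+ 2) * x) * (1 - x ^+ 2) - page_num x * (2 * x)).
  by der; rewrite /page_num; ring.
have dd : is_derive x (1 : R) (fun t => 1 - nu ^+ 2 * t ^+ 2) (- (nu ^+ 2 * (2 * x))).
  by der; ring.
refine (der_eq _ (derM dn (derV (f := fun t => 1 - nu ^+ 2 * t ^+ 2) d1 dd))); rewrite /page_log_dA -/(page_num x); field.
by rewrite exprMn !gt_eqF.
Qed.

Lemma page_B_derive (x : R) : -1 < x < 1 -> is_derive x (1 : R) B (B x * page_log_dB x).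
Proof.
case/page_factors_gt0 => n0 x0 d0 e0; rewrite /B /page_B; der.
rewrite /page_log_dB; field.
by rewrite exprMn !gt_eqF.
Qed.

Definition page_slice (x : R) (y : 'rV[R]_3) : 'M[R]_3 := berger_metric (S * B x) (S * (F * A x)) y.

Lemma page_metricE (x : R) y :
  page_metric nu (slice x y) = block_mx (S / A x)%:M 0 0 (page_slice x y).
Proof.
rewrite /page_metric /slice row_mxKl row_mxKr mxE eqxx mulr1n /sq_form.
rewrite !tr_row_mx !mul_col_row !trmx0 !mulmx0 !mul0mx !trmx1 mulmx1.
rewrite !scale_block_mx !add_block_mx !scaler0 !addr0 !add0r !scale_block_mx !add_block_mx !scaler0 !addr0.
rewrite scale_block_mx !scaler0; congr block_mx.
  by rewrite scalerA scalemx1.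
apply/matrixP => i j; rewrite /page_slice !mxE /S /B /F /A; ring.
Qed.

Lemma page_slice_sym (x : R) y : (page_slice x y)^T = page_slice x y.
Proof. by apply/matrixP => i j; rewrite mxE /page_slice !berger_metricE; ring. Qed.

Lemma page_slice_unit (x : R) y : -1 < x < 1 -> chart y -> page_slice x y \in unitmx.
Proof.
move=> x1 /chart_sin_gt0 sy; rewrite unitmxE det_berger unitfE.
have [a0 c0] := page_coef_gt0 x1.
by rewrite gt_eqF//; exact: (mulr_gt0 (mulr_gt0 (exprn_gt0 2 a0) c0) (exprn_gt0 2 sy)).
Qed.

Lemma page_regular (x : R) y : -1 < x < 1 -> chart y -> regular (fun x => S / A x) page_slice x y.
Proof.
move=> x1 cy; split; last exact: page_slice_unit.
by rewrite gt_eqF// divr_gt0// page_A_gt0.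
Qed.

Lemma page_slice_derive (x : R) y i j : -1 < x < 1 ->
  'D_1 (fun t : R => page_slice t y i j) x
  = berger_metric (S * (B x * page_log_dB x)) (S * (F * (A x * page_log_dA x))) y i j.
Proof.
move=> x1; have dA := page_A_derive x1; have dB := page_B_derive x1.
have -> : (fun t : R => page_slice t y i j) = fun t => S * B t * berger_metric 1 0 y i j
    + S * (F * A t) * berger_metric 0 1 y i j.
  by apply/funext => t; rewrite /page_slice !berger_metricE; ring.
have := derD (derM (derM (der_cst x S) dB) (der_cst x (berger_metric 1 0 y i j)))
  (derM (derM (der_cst x S) (derM (der_cst x F) dA)) (der_cst x (berger_metric 0 1 y i j))).
case=> _; rewrite /= => ->; rewrite !berger_metricE; ring.
Qed.

Lemma page_induced (x : R) y : induced_metric (page_metric nu) x y = page_slice x y.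
Proof. by rewrite /induced_metric page_metricE block_mxKdr. Qed.

Lemma near_itv (x : R) : -1 < x < 1 -> \forall t \near x, -1 < t < 1.
Proof.
move=> x1; have := @near_in_itvoo R (-1) 1 x.
by rewrite in_itv => /(_ x1); apply: filterS => t; rewrite in_itv.
Qed.

Lemma page_second_fundamental_form (x : R) y : -1 < x < 1 -> chart y ->
  second_fundamental_form (page_metric nu) x y = (2 * Num.sqrt (S / A x))^-1 *:
    berger_metric (S * (B x * page_log_dB x)) (S * (F * (A x * page_log_dA x))) y.
Proof.
move=> x1 cy; apply/matrixP => i j; rewrite [RHS]mxE -page_slice_derive//.
apply: (second_fundamental_form_slice (g := fun x => S / A x) page_metricE).
- by rewrite divr_gt0// page_A_gt0.
- by move=> z; exact: page_slice_sym.
- near=> z; apply: page_slice_unit => //; near: z; exact: near_chart.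
Unshelve. all: by end_near. Qed.

(** Two Berger metrics are diagonal in the same coframe, so the quotient of the second by the first
    is triangular in coordinates. Its diagonal holds the ratio of the fibre coefficients once and
    that of the base coefficients twice. *)
Lemma berger_inverse_diag (a c a' c' : R) y k : a != 0 -> c != 0 -> chart y ->
  \sum_(m < 3) berger_inverse a c y k m * berger_metric a' c' y m k
  = if k == inord 0 then c' / c else a' / a.
Proof.
move=> a0 c0 /chart_sin_gt0 sy; rewrite sum_I3 !berger_metricE !mxE.
have s0 : sin (theta_ y) != 0 by rewrite gt_eqF.
by elim/forall_I3: k; rewrite !inord3_eq//=; field; rewrite ?a0 ?c0 ?s0.
Qed.

Lemma page_mean_curvature (x : R) y : -1 < x < 1 -> chart y ->
  mean_curvature (page_metric nu) x y =
  (2 * Num.sqrt (S / A x))^-1 * (page_log_dA x + 2 * page_log_dB x).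
Proof.
move=> x1 cy; rewrite /mean_curvature page_induced page_second_fundamental_form//.
have A0 := page_A_gt0 x1; have B0 := page_B_gt0 x1.
have a0 : S * B x != 0 by rewrite gt_eqF// mulr_gt0.
have c0 : S * (F * A x) != 0 by rewrite gt_eqF// mulr_gt0 ?exprn_gt0// mulr_gt0 ?exprn_gt0// ?mulr_gt0// mulr_gt0.
rewrite -scalemxAr mxtraceZ; congr (_ * _).
rewrite invmx_berger// /mxtrace.
under eq_bigr => k _ do rewrite mxE berger_inverse_diag//.
rewrite sum_I3 !inord3_eq//=; field.
by rewrite !gt_eqF.
Qed.

Lemma page_log_dA0 : page_log_dA 0 = 0. Proof. by rewrite /page_log_dA mul0r. Qed.
Lemma page_log_dB0 : page_log_dB 0 = 0. Proof. by rewrite /page_log_dB mul0r. Qed.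

Lemma zero_itv : -1 < (0 : R) < 1.
Proof. by rewrite oppr_lt0 ltr01. Qed.

Lemma page_totally_geodesic0 : page_totally_geodesic nu 0.
Proof.
move=> y cy; rewrite page_second_fundamental_form ?zero_itv//.
rewrite page_log_dA0 page_log_dB0 !mulr0 /berger_metric !scale0r addr0.
exact: scaler0.
Qed.

Lemma page_minimal0 : page_minimal nu 0.
Proof.
move=> y cy; rewrite page_mean_curvature ?zero_itv//.
by rewrite page_log_dA0 page_log_dB0 !mulr0 addr0 mulr0.
Qed.

Lemma page_minimal_unique (x : R) : -1 < x < 1 -> page_minimal nu x -> x = 0.
Proof.
(* The mean curvature is constant on the chart, so a single point with [theta = pi / 2] decides. *)
move=> x1 /(_ (const_mx (pi / 2))).
have cy : chart (const_mx (pi / 2) : 'rV[R]_3).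
  rewrite /chart /= /theta_ mxE; have := pi_gt0 R; lra.
move=> /(_ cy); rewrite page_mean_curvature// => /eqP.
have A0 := page_A_gt0 x1.
have s0 : 0 < Num.sqrt (S / A x) by rewrite sqrtr_gt0; exact: divr_gt0.
rewrite mulf_eq0 invr_eq0 mulf_eq0 pnatr_eq0/= (gt_eqF s0)/=.
case/page_factors_gt0: (x1) => n0 x0 d0 e0; case/andP: nu2 => m0 m1.
rewrite /page_log_dA /page_log_dB.
(* Twice [page_log_dB] reverses the only positive term of [page_log_dA]; the bracket then consists
   of three terms of the same sign. *)
have -> : x * (2 * nu ^+ 2 / (1 - nu ^+ 2 * x ^+ 2) - 2 / (1 - x ^+ 2)
       - 2 * nu ^+ 2 * (1 + nu ^+ 2) / page_num x)
     + 2 * (x * (- (2 * nu ^+ 2 / (1 - nu ^+ 2 * x ^+ 2))))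
   = - (x * (2 * nu ^+ 2 / (1 - nu ^+ 2 * x ^+ 2) + 2 / (1 - x ^+ 2)
       + 2 * nu ^+ 2 * (1 + nu ^+ 2) / page_num x)) by ring.
rewrite oppr_eq0 mulf_eq0 => /orP[/eqP //|].
have n1 : 0 < 2 * nu ^+ 2 by rewrite mulr_gt0.
have n2 : 0 < 2 * nu ^+ 2 * (1 + nu ^+ 2) by rewrite mulr_gt0// addr_gt0.
rewrite gt_eqF//; apply: addr_gt0; last exact: divr_gt0.
by apply: addr_gt0; exact: divr_gt0.
Qed.

Lemma bilin_scale_delta n (M : 'M[R]_n) k i :
  bilin M (k *: delta_mx 0 i) (k *: delta_mx 0 i) = k ^+ 2 * M i i.
Proof.
rewrite /bilin linearZ /= -!scalemxAl -scalemxAr scalerA mxE -expr2; congr (_ * _).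
by rewrite -rowE trmx_delta -colE !mxE.
Qed.

(** The component of the Ricci tensor along [d_x] comes out as 3 (1 + nu^2) / (3 - nu^2). The normal
    is normalized by [S / A 0], which is (1 + nu^2) / (3 - nu^2), and the quotient is the Einstein
    constant. *)
Lemma page_ricci_nn0 y : chart y -> ricci_nn (page_metric nu) 0 y = 3.
Proof.
move=> cy; have z1 := zero_itv.
have A0 := page_A_gt0 z1.
have SA0 : 0 < S / A 0 := divr_gt0 S_gt0 A0.
rewrite /ricci_nn (unit_normal_slice page_metricE)//; last exact: page_slice_unit.
set r := Num.sqrt _.
have -> : bilin (ricci (page_metric nu) (slice 0 y)) (r^-1 *: delta_mx 0 ord0) (r^-1 *: delta_mx 0 ord0)
   = (r ^+ 2)^-1 * ricci (page_metric nu) (slice 0 y) ord0 ord0.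
  by rewrite bilin_scale_delta exprVn.
rewrite (sqr_sqrtr (ltW SA0)).
rewrite (ricci_slice page_metricE) ?(gt_eqF SA0)//.
- have E k : 'D_1 (fun t : R => 2^-1 * \sum_(m < 3) invmx (page_slice t y) k m * 'D_1 (fun t : R => page_slice t y k m) t) 0
     = 'D_1 (fun t : R => 2^-1 * (if k == inord 0 then page_log_dA t else page_log_dB t)) 0.
    apply: near_eq_derive; near=> t.
    have t1 : -1 < t < 1 by near: t; exact: near_itv.
    have At := page_A_gt0 t1; have Bt := page_B_gt0 t1.
    have [a0 c0] := page_coef_gt0 t1.
    congr (_ * _); transitivity (\sum_(m < 3) berger_inverse (S * B t) (S * (F * A t)) y k m *
        berger_metric (S * (B t * page_log_dB t)) (S * (F * (A t * page_log_dA t))) y m k).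
      apply: eq_bigr => m _; rewrite page_slice_derive// invmx_berger ?gt_eqF//.
      by congr (_ * _); rewrite !berger_metricE; ring.
    rewrite berger_inverse_diag ?(gt_eqF a0) ?(gt_eqF c0)//.
    have An : A t != 0 by exact: lt0r_neq0.
    have Bn : B t != 0 by exact: lt0r_neq0.
    have Sn : S != 0 by exact: lt0r_neq0.
    have Fn : F != 0 by exact: lt0r_neq0.
    by case: (k == inord 0); field; rewrite ?An ?Bn ?Sn ?Fn.
  have [n0 x0 d0 _] := page_factors_gt0 z1.
  (* Both logarithmic derivatives are [t] times a function derivable at 0, so the product rule
     leaves the value of that function at 0. *)
  have dscale (d : R) f : is_derive (0 : R) (1 : R) f d ->
      'D_1 (fun t : R => 2^-1 * (t * f t)) 0 = 2^-1 * f 0.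
    move=> fd; have [_ ->] : is_derive (0 : R) (1 : R) (fun t : R => 2^-1 * (t * f t)) (2^-1 * f 0).
      by der; ring.
    by [].
  have dV (u l : R) : u != 0 -> is_derive (0 : R) (1 : R) (fun t => (u - l * t ^+ 2)^-1) 0.
    move=> u0; have kl : u - l * (0 : R) ^+ 2 != 0 by rewrite expr0n mulr0 subr0.
    have dl : is_derive (0 : R) (1 : R) (fun t => u - l * t ^+ 2) 0 by der; ring.
    by refine (der_eq _ (derV (f := fun t => u - l * t ^+ 2) kl dl)); rewrite oppr0 mul0r.
  have dd : is_derive (0 : R) (1 : R) (fun t => (1 - nu ^+ 2 * t ^+ 2)^-1) 0 by exact: dV.
  have dx : is_derive (0 : R) (1 : R) (fun t => (1 - t ^+ 2)^-1) 0.
    by under eq_fun do rewrite -[X in 1 - X]mul1r; exact: dV.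
  have dn : is_derive (0 : R) (1 : R) (fun t => (page_num t)^-1) 0.
    apply: dV; move: n0; rewrite /page_num expr0n mulr0 subr0.
    exact: lt0r_neq0.
  have dA : is_derive (0 : R) (1 : R) (fun t => 2 * nu ^+ 2 / (1 - nu ^+ 2 * t ^+ 2) - 2 / (1 - t ^+ 2)
       - 2 * nu ^+ 2 * (1 + nu ^+ 2) / page_num t) 0 by der; ring.
  have dB : is_derive (0 : R) (1 : R) (fun t => - (2 * nu ^+ 2 / (1 - nu ^+ 2 * t ^+ 2))) 0 by der; ring.
  rewrite sum_I3 !E !inord3_eq//= (dscale _ _ dA) (dscale _ _ dB).
  move: n0 d0; rewrite /A /page_A /S /page_S /page_Lambda /page_num !expr0n !mulr0 !subr0 => n0 _.
  field.
  by case/andP: nu2 => m0 m1; rewrite !gt_eqF// addr_gt0.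
- near=> t; apply: page_regular => //; near: t; exact: near_itv.
- near=> t; apply: page_regular => //; near: t; exact: near_chart.
- have [_ dA] := page_A_derive z1.
  have d := der_eq _ (derM (der_cst (0 : R) S) (derV (f := A) (lt0r_neq0 A0) (page_A_derive z1))).
  by have [_ ->] := d _ erefl; rewrite page_log_dA0 mulr0 oppr0 !mul0r mulr0 addr0.
- by move=> i j; rewrite page_slice_derive// page_log_dA0 page_log_dB0 !mulr0 /berger_metric !scale0r addr0 mxE.
Unshelve. all: by end_near. Qed.

End Page.

(** * Orthogonality *)

Section InnerProduct.
Variable R : realType.
Implicit Types f g w : R -> R -> R -> R.

Lemma eq_rint f g : (forall x y z : R, 0 <= y <= pi -> f x y z = g x y z) ->
  rint f = rint g.
Proof.
move=> fg; rewrite /rint (_ : rsum f = rsum g)//; apply/funext => n.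
rewrite /rsum /mean; congr (_ * _); apply: eq_bigr => i _; congr (_ * _).
apply: eq_bigr => j _; congr (_ * _); apply: eq_bigr => k _.
by apply: fg; apply: gridy_itv.
Qed.

(** The eigenvalue equations are known on the open chart, but the Riemann sums also sample the pole
    [y = 0]; the Lipschitz bound carries the identity there. *)
Lemma tame_closed_strip f : tame f -> (forall x y z : R, 0 < y < pi -> f x y z = 0) ->
  forall x y z : R, 0 <= y <= pi -> f x y z = 0.
Proof.
move=> /tame_lipschitz[C C0 fC] f0 x y z /andP[y0 yp]; have pi0 := pi_gt0 R.
apply/eqP; rewrite -normr_le0; apply/ler_addgt0Pr => e e0; rewrite add0r.
have C1 : 0 < C + 1 by rewrite ltr_wpDl.
pose d := Num.min (e / (C + 1)) (pi / 2).
have d0 : 0 < d by rewrite lt_min divr_gt0//=; lra.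
have dp : d <= pi / 2 by rewrite ge_min lexx orbT.
pose y' := if y <= pi / 2 then y + d / 2 else y - d / 2.
have y'p : 0 < y' < pi.
  by rewrite /y'; case: ifP => [|/negbT]; rewrite -?ltNge => h; apply/andP; split; lra.
have := fC x y' z x y z; rewrite (f0 x y' z y'p) subr0 !subrr normr0 addr0 add0r => h.
apply: le_trans h _; have -> : `|y - y'| = d / 2.
  rewrite /y'; case: ifP => _; first by rewrite opprD addrA subrr sub0r normrN gtr0_norm ?divr_gt0.
  by rewrite opprB addrC subrK gtr0_norm ?divr_gt0.
have de : d <= e / (C + 1) by rewrite ge_min lexx.
have : (C + 1) * d <= e by rewrite mulrC -ler_pdivlMr.
nra.
Qed.

(** The L^2 product of the sphere up to a constant: [sin y] is the volume density. *)
Definition ip f g : R := rint (fun x y z => sin y * (f x y z * g x y z)).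

Lemma ip_tame f g : tame f -> tame g -> bounded3 (fun x y z => sin y * (f x y z * g x y z)).
Proof. by move=> tf tg; apply: tame_bounded; auto with tame. Qed.

Lemma ip_linear w k f g : tame w -> tame f -> tame g ->
  ip w (fun x y z => k * f x y z + g x y z) = k * ip w f + ip w g.
Proof.
move=> tw tf tg; rewrite /ip -(rintZ _ (ip_tame tw tf)) -rintD.
- by apply: rint_ext => x y z; ring.
- by apply: tame_bounded; auto 7 with tame.
- exact: ip_tame.
Qed.

Lemma ipC f g : ip f g = ip g f.
Proof. by apply: rint_ext => x y z; rewrite [f x y z * _]mulrC. Qed.

Lemma eq_ip w f g : (forall x y z, f x y z = g x y z) -> ip w f = ip w g.
Proof. by move=> fg; apply: rint_ext => x y z; rewrite fg. Qed.

Lemma ip0 w : ip w (fun _ _ _ => 0) = 0.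
Proof.
by rewrite -[RHS](rint_cst0 R); apply: rint_ext => x y z; rewrite !mulr0.
Qed.

Definition eigenfunction a c (mu : R) f := exists2 l, weighted_laplacian a c f l &
  forall x y z : R, 0 < y < pi -> l x y z = - mu * (sin y * f x y z).

Lemma eigenfunction_orth a c mu f kap g : eigenfunction a c mu f ->
  eigenfunction a c kap g -> mu != kap -> ip f g = 0.
Proof.
move=> [l fl fE] [m gm gE] mk.
have tl := weighted_laplacian_tame fl; have tm := weighted_laplacian_tame gm.
have tf : tame f by move: fl => [? [? [? [? [? [? [? [[]]]]]]]]].
have tg : tame g by move: gm => [? [? [? [? [? [? [? [[]]]]]]]]].
have E (k : R) (h h' : R -> R -> R -> R) : tame h -> tame h' -> (forall x y z : R, 0 < y < pi -> h' x y z = - k * (sin y * h x y z)) ->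
    forall x y z : R, 0 <= y <= pi -> h' x y z = - k * (sin y * h x y z).
  move=> th th' hE x y z yp; apply/eqP; rewrite -subr_eq0; apply/eqP.
  refine (@tame_closed_strip (fun x y z => h' x y z - - k * (sin y * h x y z)) _ _ x y z yp).
    by auto with tame.
  by move=> ? ? ? ?; rewrite hE// subrr.
have := weighted_laplacian_sym fl gm.
rewrite (@eq_rint _ (fun x y z => (mu - kap) * (sin y * (f x y z * g x y z)))); last first.
  by move=> x y z yp; rewrite (E _ _ _ tf tl fE)// (E _ _ _ tg tm gE)//; ring.
rewrite (rintZ _ (ip_tame tf tg)) => /eqP; rewrite mulf_eq0 subr_eq0 (negbTE mk) /=.
by move/eqP.
Qed.

Lemma tame_horner (J : {poly R}) f : tame f -> tame (fun x y z => J.[f x y z]).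
Proof.
move=> tf; elim/poly_ind: J => [|J k IH].
  by apply: eq_tame (tame_cst 0) => x y z; rewrite horner0.
by apply: (eq_tame (g := fun x y z => J.[f x y z] * f x y z + k)) => [x y z|];
  rewrite ?hornerMXaddC//; auto with tame.
Qed.

Definition frequency (b : bool) (k l : int) (x z : R) : R :=
  phase b (k%:~R * x + l%:~R * (z / 2)).

Lemma tame_frequency b k l : tame (fun x _ z => frequency b k l x z).
Proof. by case: b; [exact: tame_cos|exact: tame_sin]. Qed.

(** A nonzero frequency in [x] or in [z] admits a periodic antiderivative in that variable, with
    sine and cosine exchanged. If both are zero, the assumption leaves only the sine, which is
    zero. *)
Lemma rint_frequency (h : R -> R) b k l : tame (fun _ y _ => h y) ->
  ~~ b \/ (k, l) != (0, 0) -> rint (fun x y z => h y * frequency b k l x z) = 0.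
Proof.
move=> th kl.
have tf := tameM th (tame_frequency b k l).
have D u (v : R -> R) (s : R) (d : R) : is_derive s (1 : R) v d -> d != 0 ->
    is_derive s (1 : R) (fun t => u * ((if b then 1 else -1) / d * phase (~~ b) (v t))) (u * phase b (v s)).
  by move=> vd d0; rewrite /phase; case: (b) => /=; der; field.
have [k0|k0] := eqVneq k 0; last first.
  apply: (@rint_d1 _ (fun x y z => h y * ((if b then 1 else -1) / k%:~R * frequency (~~ b) k l x z))) => //.
    by apply: tameM => //; apply: tameM; [exact: tame_cst|exact: tame_frequency].
  by move=> x y z; apply: D; [der; ring|rewrite intr_eq0].
have [l0|l0] := eqVneq l 0.
  rewrite -[RHS](rint_cst0 R); apply: rint_ext => x y z.
  case: kl; last by rewrite k0 l0 eqxx.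
  by move=> /negbTE ->; rewrite /frequency k0 l0 !mul0r addr0 /phase sin0 mulr0.
apply: (@rint_d3 _ (fun x y z => h y * ((if b then 1 else -1) / (l%:~R / 2) * frequency (~~ b) k l x z))) => //.
  by apply: tameM => //; apply: tameM; [exact: tame_cst|exact: tame_frequency].
by move=> x y z; apply: D; [der; field|rewrite mulf_neq0 ?intr_eq0// invr_eq0].
Qed.

Definition radial (a a' c c' : nat) (J : {poly R}) (y : R) : R :=
  cos (y / 2) ^+ (a + a') * sin (y / 2) ^+ (c + c') * J.[cos (y / 2) ^+ 2].

Lemma tame_radial a a' c c' (J : {poly R}) : tame (fun _ y _ => radial a a' c c' J y).
Proof.
have ? : tame (fun _ y _ : R => J.[cos (y / 2) ^+ 2]) by apply: tame_horner; auto with tame.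
by rewrite /radial; auto with tame.
Qed.

Lemma mode_frequency b a a' c c' (J : {poly R}) x y z : mode b a a' c c' J x y z =
  radial a a' c c' J y * frequency b (a%:Z - a'%:Z + (c%:Z - c'%:Z)) (a%:Z - a'%:Z - (c%:Z - c'%:Z)) x z.
Proof.
rewrite /mode; congr (_ * phase b _).
by rewrite /weight !(rmorphD, rmorphN) /= -!pmulrn; ring.
Qed.

Lemma tame_mode b a a' c c' (J : {poly R}) : tame (mode b a a' c c' J).
Proof.
apply: eq_tame (mode_frequency b a a' c c' J) _.
by apply: tameM; [exact: tame_radial|exact: tame_frequency].
Qed.

(** The product formulas for sine and cosine yield the difference and the sum of the two weights.
    Both must be excluded for equal [b], because opposite weights describe conjugate functions with
    the same real parts up to the radial factor; for different [b] only sines occur. *)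
Lemma ip_mode_eq0 b1 b2 a a' c c' (J : {poly R}) d d' e e' (K : {poly R}) :
  b1 != b2 \/ ((a%:Z - a'%:Z, c%:Z - c'%:Z) != (d%:Z - d'%:Z, e%:Z - e'%:Z)
    /\ (a%:Z - a'%:Z, c%:Z - c'%:Z) != (d'%:Z - d%:Z, e'%:Z - e%:Z)) ->
  ip (mode b1 a a' c c' J) (mode b2 d d' e e' K) = 0.
Proof.
move=> H; rewrite /ip.
set m := a%:Z - a'%:Z in H; set n := c%:Z - c'%:Z in H.
set m' := d%:Z - d'%:Z in H; set n' := e%:Z - e'%:Z in H.
pose h y := sin y * (radial a a' c c' J y * radial d d' e e' K y) / 2.
have th : tame (fun _ y _ => h y) by have := tame_radial; rewrite /h; auto 9 with tame.
pose k1 := m + n - (m' + n'); pose l1 := m - n - (m' - n').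
pose k2 := m + n + (m' + n'); pose l2 := m - n + (m' - n').
have E x y z : sin y * (mode b1 a a' c c' J x y z * mode b2 d d' e e' K x y z) =
    (if ~~ b1 && b2 then 1 else if b1 && ~~ b2 then -1 else 1) * (h y * frequency (b1 == b2) k1 l1 x z)
    + (if b1 || b2 then 1 else -1) * (h y * frequency (b1 == b2) k2 l2 x z).
  rewrite !mode_frequency -/m -/n -/m' -/n' /frequency.
  have -> : k1%:~R * x + l1%:~R * (z / 2) = ((m + n)%:~R * x + (m - n)%:~R * (z / 2))
     - ((m' + n')%:~R * x + (m' - n')%:~R * (z / 2)) :> R.
    by rewrite /k1 /l1 (rmorphB _ (m + n)) (rmorphB _ (m - n)) /=; ring.
  have -> : k2%:~R * x + l2%:~R * (z / 2) = ((m + n)%:~R * x + (m - n)%:~R * (z / 2))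
     + ((m' + n')%:~R * x + (m' - n')%:~R * (z / 2)) :> R.
    by rewrite /k2 /l2 (rmorphD _ (m + n)) (rmorphD _ (m - n)) /=; ring.
  rewrite /h /phase; set u := (m + n)%:~R * x + _; set v := (m' + n')%:~R * x + _.
  by case: (b1); case: (b2); rewrite /= ?(cosD u v) ?(cosB u v) ?(sinD u v) ?(sinB u v); field.
rewrite (rint_ext E).
have kl (k l : int) : (b1 == b2 -> (k, l) != (0, 0)) -> rint (fun x y z => h y * frequency (b1 == b2) k l x z) = 0.
  by move=> hb; apply: rint_frequency => //; case: eqP hb => [_ /(_ isT)|]; [right|left].
have bd k l : bounded3 (fun x y z => h y * frequency (b1 == b2) k l x z).
  by apply: tame_bounded; apply: tameM => //; exact: tame_frequency.
rewrite rintD ?rintZ//.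
- rewrite !kl ?mulr0 ?addr0//.
  + move=> b12; case: H => [|[_ H]]; first by rewrite b12.
    apply: contra H => /eqP[k0 l0]; rewrite /k2 /l2 in k0 l0.
    by apply/eqP; congr pair; lia.
  + move=> b12; case: H => [|[H _]]; first by rewrite b12.
    apply: contra H => /eqP[k0 l0]; rewrite /k1 /l1 in k0 l0.
    by apply/eqP; congr pair; lia.
- by apply: tame_bounded; apply: tameM; [exact: tame_cst|apply: tameM => //; exact: tame_frequency].
- by apply: tame_bounded; apply: tameM; [exact: tame_cst|apply: tameM => //; exact: tame_frequency].
Qed.

End InnerProduct.

(** * Completeness *)

Section AllModes.
Variable R : realType.
Implicit Types (w : R -> R -> R -> R) (J : {poly R}).

(** There is one polynomial of each degree, so subtracting a multiple with the same leading
    coefficient lowers the size. *)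
Lemma jacobi_span al be (P : {poly R} -> Prop) :
  P 0 -> (forall k p q, P p -> P q -> P (k *: p + q)) ->
  (forall j, P (jacobi R al be j)) -> forall p, P p.
Proof.
move=> P0 PD Pj p; have [n] := ubnP (size p); elim: n p => // n IH p.
rewrite ltnS => sp; case: (posnP (size p)) => [/eqP|p0].
  by rewrite size_poly_eq0 => /eqP ->.
pose j := (size p).-1; pose J := jacobi R al be j.
have sJ : size J = size p by rewrite size_jacobi prednK.
have J0 : lead_coef J != 0 by rewrite lead_coef_eq0 -size_poly_eq0 sJ -lt0n.
pose k := lead_coef p / lead_coef J.
rewrite -[p](subrK (k *: J)) addrC; apply: PD; first exact: Pj.
apply: IH; apply: leq_trans sp.
have : (size (p - k *: J)%R <= size p)%N.
  rewrite (leq_trans (size_polyD _ _))// geq_max leqnn size_polyN.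
  by rewrite (leq_trans (size_scale_leq _ _))// sJ.
rewrite leq_eqVlt => /orP[/eqP s|//].
suff : lead_coef (p - k *: J) = 0.
  by move/eqP; rewrite lead_coef_eq0 -size_poly_eq0 s; case: (size p) p0.
rewrite lead_coefE s coefB coefZ -sJ -lead_coefE sJ -lead_coefE /k divfK ?subrr//.
Qed.

Lemma mode_poly_linear b a a' c c' k J K x y z :
  mode b a a' c c' (k *: J + K) x y z = k * mode b a a' c c' J x y z + mode b a a' c c' K x y z.
Proof. by rewrite /mode hornerD hornerZ; ring. Qed.

Lemma mode_conj b a a' c c' J x y z :
  mode b a a' c c' J x y z = (if b then 1 else -1) * mode b a' a c' c J x y z.
Proof.
rewrite /mode [(a' + a)%N]addnC [(c' + c)%N]addnC.
have -> : weight a' a c' c x z = - weight a a' c c' x z by rewrite /weight; ring.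
by case: b; rewrite /phase ?cosN ?sinN; ring.
Qed.

(** Conjugation maps the index (p, q, k) to (q, p, p + q - k). Of each conjugate pair one index
    receives the real part and the other the imaginary part; a self-conjugate index, p = q = k,
    receives the real part, the imaginary one being zero. *)
Definition real_part (p q k : nat) : bool := (q < p)%N || (p == q) && (q <= k)%N.

(* For fixed (p, q), k = 0, ..., p + q ranges over the weights
   (k - q, p - k) of the harmonic polynomials of bidegree (p, q). *)
Definition basis_mode (p q k : nat) : R -> R -> R -> R :=
  mode (real_part p q k) (k - q) (q - k) (p - k) (k - p)
    (jacobi R (k - q + (q - k)) (p - k + (k - p))
       (minn (minn k (p + q - k)) (minn p q))).

(** Common factors z_1 conj z_1 and z_2 conj z_2 are absorbed into the polynomial as 'X and 1 - 'X;
    the polynomial is then expanded in Jacobi polynomials, and a real or imaginary part that is not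
    listed is recovered from the conjugate index. *)
Lemma ip_mode_all w : tame w ->
  (forall p q k, (k <= p + q)%N -> ip w (basis_mode p q k) = 0) ->
  forall b a a' c c' J, ip w (mode b a a' c c' J) = 0.
Proof.
move=> tw wb.
(* The index is read off the exponents: p = a + c + j, q = a' + c' + j, k = a + c' + j. *)
have direct b a a' c c' j : (a * a' = 0)%N -> (c * c' = 0)%N ->
    b = real_part (a + c + j) (a' + c' + j) (a + c' + j) ->
    ip w (mode b a a' c c' (jacobi R (a + a') (c + c') j)) = 0.
  move=> aa cc bE.
  have a0 : (a == 0%N) || (a' == 0%N) by rewrite -muln_eq0 aa.
  have c0 : (c == 0%N) || (c' == 0%N) by rewrite -muln_eq0 cc.
  rewrite -[RHS](wb (a + c + j)%N (a' + c' + j)%N (a + c' + j)%N); last by lia.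
  rewrite /basis_mode -bE.
  have -> : (a + c' + j - (a' + c' + j) = a)%N by lia.
  have -> : (a' + c' + j - (a + c' + j) = a')%N by lia.
  have -> : (a + c + j - (a + c' + j) = c)%N by lia.
  have -> : (a + c' + j - (a + c + j) = c')%N by lia.
  by congr (ip w (mode _ _ _ _ _ (jacobi R _ _ _))); lia.
have jac b a a' c c' j : (a * a' = 0)%N -> (c * c' = 0)%N ->
    ip w (mode b a a' c c' (jacobi R (a + a') (c + c') j)) = 0.
  move=> aa cc.
  have a0 : (a == 0%N) || (a' == 0%N) by rewrite -muln_eq0 aa.
  have c0 : (c == 0%N) || (c' == 0%N) by rewrite -muln_eq0 cc.
  have [bE|/eqP bN] := eqVneq b (real_part (a + c + j) (a' + c' + j) (a + c' + j)).
    exact: direct.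
  have swap : b = real_part (a' + c' + j) (a + c + j) (a' + c + j) ->
      ip w (mode b a a' c c' (jacobi R (a + a') (c + c') j)) = 0.
    move=> bE; have := direct b a' a c' c j; rewrite mulnC => /(_ aa).
    rewrite mulnC => /(_ cc bE); rewrite [(a' + a)%N]addnC [(c' + c)%N]addnC => h.
    rewrite (@eq_ip _ _ _ (fun x y z => (if b then 1 else -1) *
       mode b a' a c' c (jacobi R (a + a') (c + c') j) x y z + 0)).
      rewrite ip_linear ?h ?mulr0 ?ip0 ?addr0//; [exact: tame_mode|exact: tame_cst].
    by move=> x y z; rewrite addr0 mode_conj.
  case: b bN swap => bN swap.
    by apply: swap; rewrite /real_part in bN *; lia.
  (* With all exponents zero the conjugate index is the same one; the missing mode is the sine of
     0. *)
  have [z0|nz] := eqVneq (a + a' + c + c')%N 0%N; last first.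
    by apply: swap; rewrite /real_part in bN *; lia.
  rewrite -[RHS](ip0 w); apply: eq_ip => x y z.
  have [-> [-> [-> ->]]] : a = 0%N /\ a' = 0%N /\ c = 0%N /\ c' = 0%N by lia.
  by rewrite /mode /phase /weight !subrr !mul0r addr0 sin0 mulr0.
have poly b a a' c c' J : (a * a' = 0)%N -> (c * c' = 0)%N -> ip w (mode b a a' c c' J) = 0.
  move=> aa cc; move: J; apply: (@jacobi_span (a + a') (c + c')).
  - by rewrite -[RHS](ip0 w); apply: eq_ip => x y z; rewrite /mode horner0; ring.
  - move=> k p q hp hq; rewrite (eq_ip _ (mode_poly_linear b a a' c c' k p q)).
    by rewrite ip_linear ?hp ?hq ?mulr0 ?addr0//; exact: tame_mode.
  - by move=> j; exact: jac.
have redc b a a' c c' J : (a * a' = 0)%N -> ip w (mode b a a' c c' J) = 0.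
  move=> aa; elim: c c' J => [|c IH] [|c'] J; try by apply: poly => //; lia.
  rewrite -[RHS](IH c' ((1 - 'X) * J)); apply: eq_ip => x y z.
  rewrite /mode hornerM hornerD hornerN hornerC hornerX -sin2cos2.
  have -> : weight a a' c.+1 c'.+1 x z = weight a a' c c' x z by rewrite /weight -!natr1; ring.
  by rewrite addSn addnS !exprS; ring.
move=> b a a' c c' J; elim: a a' J => [|a IH] [|a'] J; try by apply: redc => //; lia.
rewrite -[RHS](IH a' ('X * J)); apply: eq_ip => x y z.
rewrite /mode hornerM hornerX.
have -> : weight a.+1 a'.+1 c c' x z = weight a a' c c' x z by rewrite /weight -!natr1; ring.
by rewrite addSn addnS !exprS; ring.
Qed.

Definition peak (v : 'rV[R]_4) (x y z : R) : R :=
  (1 + \sum_(i < 4) v 0 i * hopf3 x y z 0 i) / 2.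

Lemma tame_peak v : tame (peak v).
Proof.
apply: (@eq_tame _ _ (fun x y z => (1 + \sum_(i < 4) v 0 i * (fun u : 'rV[R]_4 => u 0 i) (hopf3 x y z)) * 2^-1)) => //.
apply: tameM; last exact: tame_cst.
apply: tameD; first exact: tame_cst.
apply: tame_sum => i; apply: tameM; first exact: tame_cst.
exact: (@tame_hopf R (fun u => u 0 i) (@smooth_coord R 4 i)).
Qed.

(** Since Re z_1 is the mean of z_1 and its conjugate, the product raises one of the two exponents.
    For the imaginary coordinates, below, the real and imaginary parts are exchanged as well. *)
Lemma mul_coord0 b a a' c c' J x y z :
  cos (y / 2) * cos (x + z / 2) * mode b a a' c c' J x y z
  = 2^-1 * mode b a.+1 a' c c' J x y z + 2^-1 * mode b a a'.+1 c c' J x y z.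
Proof.
rewrite /mode.
have -> : weight a.+1 a' c c' x z = weight a a' c c' x z + (x + z / 2) by rewrite /weight -natr1; ring.
have -> : weight a a'.+1 c c' x z = weight a a' c c' x z - (x + z / 2) by rewrite /weight -natr1; ring.
rewrite addSn addnS !exprS; set u := weight _ _ _ _ _ _; set s := x + z / 2.
by case: b; rewrite /phase ?(cosD u s) ?(cosB u s) ?(sinD u s) ?(sinB u s); field.
Qed.

Lemma mul_coord1 b a a' c c' J x y z :
  cos (y / 2) * sin (x + z / 2) * mode b a a' c c' J x y z
  = (if b then 2^-1 else - 2^-1) * mode (~~ b) a.+1 a' c c' J x y z
    + (if b then - 2^-1 else 2^-1) * mode (~~ b) a a'.+1 c c' J x y z.
Proof.
rewrite /mode.
have -> : weight a.+1 a' c c' x z = weight a a' c c' x z + (x + z / 2) by rewrite /weight -natr1; ring.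
have -> : weight a a'.+1 c c' x z = weight a a' c c' x z - (x + z / 2) by rewrite /weight -natr1; ring.
rewrite addSn addnS !exprS; set u := weight _ _ _ _ _ _; set s := x + z / 2.
by case: b; rewrite /phase /= ?(cosD u s) ?(cosB u s) ?(sinD u s) ?(sinB u s); field.
Qed.

Lemma mul_coord2 b a a' c c' J x y z :
  sin (y / 2) * cos (x - z / 2) * mode b a a' c c' J x y z
  = 2^-1 * mode b a a' c.+1 c' J x y z + 2^-1 * mode b a a' c c'.+1 J x y z.
Proof.
rewrite /mode.
have -> : weight a a' c.+1 c' x z = weight a a' c c' x z + (x - z / 2) by rewrite /weight -natr1; ring.
have -> : weight a a' c c'.+1 x z = weight a a' c c' x z - (x - z / 2) by rewrite /weight -natr1; ring.
rewrite addSn addnS !exprS; set u := weight _ _ _ _ _ _; set s := x - z / 2.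
by case: b; rewrite /phase ?(cosD u s) ?(cosB u s) ?(sinD u s) ?(sinB u s); field.
Qed.

Lemma mul_coord3 b a a' c c' J x y z :
  sin (y / 2) * sin (x - z / 2) * mode b a a' c c' J x y z
  = (if b then 2^-1 else - 2^-1) * mode (~~ b) a a' c.+1 c' J x y z
    + (if b then - 2^-1 else 2^-1) * mode (~~ b) a a' c c'.+1 J x y z.
Proof.
rewrite /mode.
have -> : weight a a' c.+1 c' x z = weight a a' c c' x z + (x - z / 2) by rewrite /weight -natr1; ring.
have -> : weight a a' c c'.+1 x z = weight a a' c c' x z - (x - z / 2) by rewrite /weight -natr1; ring.
rewrite addSn addnS !exprS; set u := weight _ _ _ _ _ _; set s := x - z / 2.
by case: b; rewrite /phase /= ?(cosD u s) ?(cosB u s) ?(sinD u s) ?(sinB u s); field.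
Qed.

Lemma ip_peak_mode w v n : tame w ->
  (forall b a a' c c' J, ip w (mode b a a' c c' J) = 0) ->
  forall b a a' c c' J, ip w (fun x y z => peak v x y z ^+ n * mode b a a' c c' J x y z) = 0.
Proof.
move=> tw wm; elim: n => [|n IH] b a a' c c' J.
  by rewrite -[RHS](wm b a a' c c' J); apply: eq_ip => x y z; rewrite mul1r.
pose T f := tame f /\ ip w (fun x y z => peak v x y z ^+ n * f x y z) = 0.
have tp : tame (fun x y z => peak v x y z ^+ n) by apply: tameX; exact: tame_peak.
have TL k f g : T f -> T g -> T (fun x y z => k * f x y z + g x y z).
  move=> [tf f0] [tg g0]; split; first by auto with tame.
  rewrite (@eq_ip _ _ _ (fun x y z => k * (peak v x y z ^+ n * f x y z) + peak v x y z ^+ n * g x y z)).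
    by rewrite ip_linear ?f0 ?g0 ?mulr0 ?addr0//; exact: tameM.
  by move=> x y z; ring.
have Tm b' d d' e e' : T (mode b' d d' e e' J) by split; [exact: tame_mode|exact: IH].
have T2 k l f g h : T f -> T g -> T h -> T (fun x y z => k * f x y z + (l * g x y z + h x y z)).
  by move=> hf hg hh; exact: (TL k _ _ hf (TL l _ _ hg hh)).
pose v0 := v 0 ord0; pose v1 := v 0 (lift ord0 ord0).
pose v2 := v 0 (lift ord0 (lift ord0 ord0)); pose v3 := v 0 (lift ord0 (lift ord0 (lift ord0 ord0))).
pose s1 : R := if b then 2^-1 else - 2^-1; pose s2 : R := if b then - 2^-1 else 2^-1.
(* The final [TL] yields [- 2^-1 * m + m], the contribution of the constant 1/2 in [peak]; the other
   coefficients combine the half in [peak] with those of the products by coordinates. *)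
have [_ H] := T2 (v0 / 4) (v0 / 4) _ _ _ (Tm b a.+1 a' c c') (Tm b a a'.+1 c c')
  (T2 (v1 / 2 * s1) (v1 / 2 * s2) _ _ _ (Tm (~~ b) a.+1 a' c c') (Tm (~~ b) a a'.+1 c c')
  (T2 (v2 / 4) (v2 / 4) _ _ _ (Tm b a a' c.+1 c') (Tm b a a' c c'.+1)
  (T2 (v3 / 2 * s1) (v3 / 2 * s2) _ _ _ (Tm (~~ b) a a' c.+1 c') (Tm (~~ b) a a' c c'.+1)
  (TL (- 2^-1) _ _ (Tm b a a' c c') (Tm b a a' c c'))))).
rewrite -[RHS]H; apply: eq_ip => x y z.
rewrite exprSr -mulrA; congr (_ * _).
have := (mul_coord0 b a a' c c' J x y z, mul_coord1 b a a' c c' J x y z,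
  mul_coord2 b a a' c c' J x y z, mul_coord3 b a a' c c' J x y z) => -[[[E0 E1] E2] E3].
rewrite -/s1 -/s2 in E1 E3.
transitivity (v0 / 2 * (2^-1 * mode b a.+1 a' c c' J x y z + 2^-1 * mode b a a'.+1 c c' J x y z)
  + v1 / 2 * (s1 * mode (~~ b) a.+1 a' c c' J x y z + s2 * mode (~~ b) a a'.+1 c c' J x y z)
  + v2 / 2 * (2^-1 * mode b a a' c.+1 c' J x y z + 2^-1 * mode b a a' c c'.+1 J x y z)
  + v3 / 2 * (s1 * mode (~~ b) a a' c.+1 c' J x y z + s2 * mode (~~ b) a a' c c'.+1 J x y z)
  + 2^-1 * mode b a a' c c' J x y z); last by field.
by rewrite -E0 -E1 -E2 -E3 /peak !big_ord_recl big_ord0 /= !mxE /= -/v0 -/v1 -/v2 -/v3; field.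
Qed.

End AllModes.

(** * Concentration of the peaks *)

Section Completeness.
Variable R : realType.

Lemma hopf3_sphere (x y z : R) : \sum_(i < 4) hopf3 x y z 0 i ^+ 2 = 1.
Proof.
rewrite !big_ord_recl big_ord0 !mxE /= addr0 !exprMn addrA -!mulrDr.
by rewrite !cos2Dsin2 !mulr1 cos2Dsin2.
Qed.

Lemma peak_dist (v : 'rV[R]_4) x y z : \sum_(i < 4) v 0 i ^+ 2 = 1 ->
  \sum_(i < 4) (hopf3 x y z 0 i - v 0 i) ^+ 2 = 4 * (1 - peak v x y z).
Proof.
move=> v1; rewrite /peak; under eq_bigr => i _ do rewrite sqrrB.
rewrite big_split sumrB /= v1 hopf3_sphere.
have -> : \sum_(i < 4) (hopf3 x y z 0 i * v 0 i) *+ 2 = 2 * \sum_(i < 4) v 0 i * hopf3 x y z 0 i.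
  by rewrite mulr_sumr; apply: eq_bigr => i _; rewrite -(mulr_natl (_ * _)) [_ * v 0 i]mulrC.
by field.
Qed.

Lemma peak_le1 (v : 'rV[R]_4) x y z : \sum_(i < 4) v 0 i ^+ 2 = 1 -> peak v x y z <= 1.
Proof.
move=> /peak_dist h; have : 0 <= 4 * (1 - peak v x y z).
  by rewrite -h sumr_ge0// => i _; exact: sqr_ge0.
by rewrite pmulr_rge0// subr_ge0.
Qed.

Lemma peak_ge0 (v : 'rV[R]_4) x y z : \sum_(i < 4) v 0 i ^+ 2 = 1 -> 0 <= peak v x y z.
Proof.
move=> v1; have : peak (- v) x y z <= 1.
  by apply: peak_le1; under eq_bigr => i _ do rewrite mxE sqrrN.
rewrite /peak; under eq_bigr => i _ do rewrite mxE mulNr.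
rewrite sumrN; lra.
Qed.

Lemma expr_eventually_lt (r e : R) : 0 <= r < 1 -> 0 < e -> exists n, r ^+ n < e.
Proof.
move=> /andP[r0 r1] e0; have : `|r| < 1 by rewrite ger0_norm.
move=> /cvg_expr /cvgr0Pnorm_lt /(_ e e0)[N _ /(_ N)].
by move=> /(_ (leqnn N)) /=; rewrite ger0_norm ?exprn_ge0// => h; exists N.
Qed.

Lemma rint_bump (f : R -> R -> R -> R) c d x0 y0 z0 : 0 < c -> 0 < d ->
  - pi < x0 < pi -> 0 < y0 < pi -> - (2 * pi) < z0 < 2 * pi ->
  f = (fun x y z => c * [&& `|x - x0| < d, `|y - y0| < d & `|z - z0| < d]%:R) ->
  bounded3 f /\ 0 < rint f.
Proof.
move=> c0 d0 x0p y0p z0p ->.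
set f' := fun x y z => _.
have bf : bounded3 f'.
  exists c => x y z; rewrite /f' normrM (gtr0_norm c0); apply: ler_piMr; first exact: ltW.
  by case: [&& _, _ & _]; rewrite ?normr1 ?normr0.
split=> //; apply: (@rint_gt0 R f' c d x0 y0 z0) => //.
- by move=> x y z _; apply: mulr_ge0; first exact: ltW.
- by move=> x y z h1 h2 h3; rewrite /f' h1 h2 h3 mulr1.
Qed.

Lemma bounded3Z k (f : R -> R -> R -> R) : bounded3 f ->
  bounded3 (fun x y z => k * f x y z).
Proof.
by move=> [D fD]; exists (`|k| * D) => x y z; rewrite normrM; exact: ler_wpM2l.
Qed.

Lemma bounded3D (f g : R -> R -> R -> R) : bounded3 f -> bounded3 g ->
  bounded3 (fun x y z => f x y z + g x y z).
Proof.
move=> [D fD] [D' gD]; exists (D + D') => x y z.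
by apply: le_trans (ler_normD _ _) _; exact: lerD.
Qed.

(* The powers of [peak] concentrate at the point where [F] is positive. *)
Lemma peak_positive F x0 y0 z0 : smooth F ->
  - pi < x0 < pi -> 0 < y0 < pi -> - (2 * pi) < z0 < 2 * pi ->
  let w (x y z : R) := F (hopf3 x y z) in
  (forall n, ip w (fun x y z => peak (hopf3 x0 y0 z0) x y z ^+ n) = 0) ->
  w x0 y0 z0 <= 0.
Proof.
move=> Fs x0p y0p z0p w wn; rewrite leNgt; apply/negP => w0.
set v := hopf3 x0 y0 z0 in wn *; have v1 : \sum_(i < 4) v 0 i ^+ 2 = 1 by exact: hopf3_sphere.
have tw : tame w by exact: tame_hopf.
have [M Mw] := tame_bounded tw.
have M0 : 0 < M by apply: lt_le_trans w0 _; apply: le_trans (ler_norm _) (Mw _ _ _).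
pose eta := w x0 y0 z0 / 2; have eta0 : 0 < eta by rewrite divr_gt0.
have [d d0 dP] : exists2 d, 0 < d & forall u : 'rV[R]_4, `|u - v| < d -> eta < F u.
  have := smooth_continuous Fs; move=> /(_ v) /cvgrPdist_lt /(_ eta eta0) /nbhs_ballP[d /= d0 dP].
  exists d => // u uv; have : ball v d u by rewrite -ball_normE /= distrC.
  move=> /dP /=; rewrite -[F v]/(w x0 y0 z0) ltr_norml => /andP[_].
  by rewrite /eta; lra.
(* As the squared distance to [v] is [4 * (1 - peak)], a peak value above [1 - rho] forces distance
   less than [d]. *)
pose rho := Num.min (d ^+ 2 / 4) (1 / 2).
have rho0 : 0 < rho by rewrite lt_min !divr_gt0// exprn_gt0.
have rho1 : rho <= 1 / 2 by rewrite ge_min lexx orbT.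
have near_v x y z : 1 - rho < peak v x y z -> eta < w x y z.
  move=> pv; apply: dP; have := peak_dist x y z v1 => dist.
  have lt_d : \sum_(i < 4) (hopf3 x y z 0 i - v 0 i) ^+ 2 < d ^+ 2.
    rewrite dist; have : rho <= d ^+ 2 / 4 by rewrite ge_min lexx.
    by lra.
  have [e e0 ed] : exists2 e : R, 0 <= e & e < d /\ \sum_(i < 4) (hopf3 x y z 0 i - v 0 i) ^+ 2 = e ^+ 2.
    have s0 : 0 <= \sum_(i < 4) (hopf3 x y z 0 i - v 0 i) ^+ 2 by rewrite sumr_ge0// => i _; exact: sqr_ge0.
    exists (Num.sqrt (\sum_(i < 4) (hopf3 x y z 0 i - v 0 i) ^+ 2)); first exact: sqrtr_ge0.
    by rewrite sqr_sqrtr//; split=> //; rewrite -(@ltr_pXn2r _ 2)// ?nnegrE ?sqrtr_ge0 ?ltW// sqr_sqrtr.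
  case: ed => ed es; apply: le_lt_trans ed; apply: mx_norm_le => // i.
  rewrite !mxE -(@ler_pXn2r _ 2)// ?nnegrE// real_normK ?num_real// -es.
  by rewrite (bigD1 i)//= !mxE lerDl sumr_ge0// => j _; exact: sqr_ge0.
have pv0 : peak v x0 y0 z0 = 1.
  have := peak_dist x0 y0 z0 v1; rewrite big1 => [|i _]; last by rewrite subrr expr0n.
  by move=> /esym/eqP; rewrite mulf_eq0 pnatr_eq0 /= subr_eq0 => /eqP.
have [C C0 pC] := tame_lipschitz (tame_peak v).
have [C' C'0 sC] := tame_lipschitz (tame_siny R).
have sy0 : 0 < sin y0 by exact: sin_gt0_pi.
pose sig := sin y0 / 2; have sig0 : 0 < sig by rewrite divr_gt0.
(* On the box of half-width [dl] the peak exceeds [1 - rho / 2] and [sin] is at least half of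
   [sin y0]. *)
pose dl := Num.min (rho / (8 * (C + 1))) (sig / (C' + 1)).
have C1 : 0 < C + 1 by rewrite ltr_wpDl.
have C'1 : 0 < C' + 1 by rewrite ltr_wpDl.
have dl0 : 0 < dl by rewrite lt_min !divr_gt0// mulr_gt0.
have dl1 : dl * (8 * (C + 1)) <= rho by rewrite -ler_pdivlMr ?mulr_gt0// ge_min lexx.
have dl2 : dl * (C' + 1) <= sig by rewrite -ler_pdivlMr// ge_min lexx orbT.
have [bB IB] := @rint_bump _ (sig * eta) dl x0 y0 z0 (mulr_gt0 sig0 eta0) dl0 x0p y0p z0p erefl.
set B := (fun x y z => _) in bB IB.
pose q := (1 - rho) / (1 - rho / 2).
have q1 : 0 <= q < 1.
  by rewrite /q divr_ge0 ?subr_ge0//=; [rewrite ltr_pdivrMr ?subr_gt0; lra|lra|lra].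
have bs : bounded3 (fun _ y _ : R => sin y) by apply: tame_bounded; exact: tame_siny.
have I1 : 0 <= rint (fun _ y _ : R => sin y).
  by apply: rint_ge0 => // x y z; exact: sin_ge0_pi.
(* [q] compares the rate [1 - rho] far from [v] with the rate [1 - rho / 2] on the box. The [+ 1]
   keeps the denominator positive, the integral of [sin] being known here only to be nonnegative. *)
have [n qn] := @expr_eventually_lt q (rint B / (M * rint (fun _ y _ : R => sin y) + 1)) q1
  (divr_gt0 IB (ltr_wpDl (mulr_ge0 (ltW M0) I1) ltr01)).
(* Three regions: on the box the integrand dominates the bump; where the peak exceeds [1 - rho], [w]
   is positive; elsewhere [w] times the power is at most [M * (1 - rho) ^+ n] in absolute value.
   Integration contradicts the choice of [n]. *)
have key x y z : 0 <= y <= pi -> 0 <= (sin y * (w x y z * peak v x y z ^+ n)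
    + (M * (1 - rho) ^+ n) * sin y) + - (1 - rho / 2) ^+ n * B x y z.
  move=> yp; have sy : 0 <= sin y by exact: sin_ge0_pi.
  have p0 := peak_ge0 x y z v1; have pn0 : 0 <= peak v x y z ^+ n by exact: exprn_ge0.
  have r0 : 0 <= (1 - rho) ^+ n by apply: exprn_ge0; lra.
  have h0 : 0 <= M * (1 - rho) ^+ n * sin y by rewrite !mulr_ge0// ltW.
  have r20 : 0 <= (1 - rho / 2) ^+ n by apply: exprn_ge0; lra.
  rewrite /B; case: and3P => [[hx hy hz]|_].
    have pn : 1 - rho / 2 < peak v x y z.
      have := pC x0 y0 z0 x y z; rewrite pv0 ler_norml => /andP[h _].
      have : C * (`|x - x0| + `|y - y0| + `|z - z0|) <= C * (3 * dl) by apply: ler_wpM2l => //; lra.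
      nra.
    have wy : eta < w x y z by apply: near_v; lra.
    have sg : sig <= sin y.
      have := sC x0 y0 z0 x0 y z0; rewrite !subrr normr0 add0r addr0 ler_norml => /andP[h _].
      have : C' * `|y - y0| <= C' * dl by apply: ler_wpM2l => //; exact: ltW.
      rewrite /sig in dl2 *; nra.
    have pnn : (1 - rho / 2) ^+ n <= peak v x y z ^+ n.
      by apply: lerXn2r; rewrite ?nnegrE; lra.
    have : sig * (eta * (1 - rho / 2) ^+ n) <= sin y * (w x y z * peak v x y z ^+ n).
      apply: ler_pM => //; [exact: ltW|by apply: mulr_ge0 => //; exact: ltW|].
      by apply: ler_pM => //; exact: ltW.
    rewrite mulr1; lra.
  rewrite !mulr0 addr0.
  have [pr|pr] := ltP (1 - rho) (peak v x y z).
    apply: addr_ge0 => //; apply: mulr_ge0 => //; apply: mulr_ge0 => //.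
    by apply: ltW; apply: lt_trans (near_v _ _ _ pr).
  have : `|w x y z * peak v x y z ^+ n| <= M * (1 - rho) ^+ n.
    rewrite normrM (ger0_norm pn0); apply: ler_pM => //.
    by apply: lerXn2r; rewrite ?nnegrE; lra.
  rewrite ler_norml => /andP[h _].
  rewrite [M * _ * sin y]mulrC -mulrDr; apply: mulr_ge0 => //; lra.
have tpn : tame (fun x y z => peak v x y z ^+ n) by apply: tameX; exact: tame_peak.
have b1 := ip_tame tw tpn.
have b2 := bounded3Z (M * (1 - rho) ^+ n) bs.
have b3 := bounded3Z (- (1 - rho / 2) ^+ n) bB.
have := rint_ge0 (bounded3D (bounded3D b1 b2) b3) key.
rewrite (rintD (bounded3D b1 b2) b3) (rintD b1 b2) (rintZ _ bs) (rintZ _ bB).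
rewrite -[rint (fun x y z => sin y * _)]/(ip w (fun x y z => peak v x y z ^+ n)) wn add0r.
move: qn IB I1; set IS := rint (fun _ y _ => sin y); set IBv := rint B => qn IB I1 h.
have r1 : 0 < (1 - rho / 2) ^+ n by apply: exprn_gt0; lra.
have qE : (1 - rho) ^+ n = q ^+ n * (1 - rho / 2) ^+ n.
  by rewrite /q expr_div_n divfK// gt_eqF.
have MI : 0 <= M * IS by rewrite mulr_ge0// ltW.
move: h; rewrite qE.
have -> : M * (q ^+ n * (1 - rho / 2) ^+ n) * IS + - (1 - rho / 2) ^+ n * IBv
  = (1 - rho / 2) ^+ n * (q ^+ n * (M * IS) - IBv) by ring.
rewrite pmulr_rge0// subr_ge0 => h.
have : q ^+ n * (M * IS + 1) < IBv by rewrite -ltr_pdivlMr// ltr_wpDl.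
have : 0 <= q ^+ n by apply: exprn_ge0; case/andP: q1.
rewrite mulrDr mulr1; lra.
Qed.

Lemma polar (x y r : R) : 0 <= r -> x ^+ 2 + y ^+ 2 = r ^+ 2 ->
  exists2 s, - pi <= s <= pi & x = r * cos s /\ y = r * sin s.
Proof.
move=> r0 xy; have pi0 := pi_ge0 R.
have [r00|r10] := eqVneq r 0.
  exists 0; first by rewrite oppr_le0 pi0.
  move: xy; rewrite r00 expr0n !mul0r => /eqP.
  by rewrite paddr_eq0 ?sqr_ge0// !sqrf_eq0 => /andP[/eqP -> /eqP ->].
have rp : 0 < r by rewrite lt_neqAle eq_sym r10.
have xr : -1 <= x / r <= 1.
  rewrite -ler_norml -(@ler_pXn2r _ 2)// ?nnegrE// real_normK ?num_real// expr1n.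
  by rewrite expr_div_n ler_pdivrMr ?exprn_gt0// mul1r -xy lerDl sqr_ge0.
have sy : r * sin (acos (x / r)) = `|y|.
  rewrite sin_acos//; transitivity (Num.sqrt (r ^+ 2) * Num.sqrt (1 - (x / r) ^+ 2)).
    by rewrite sqrtr_sqr ger0_norm.
  rewrite -sqrtrM ?sqr_ge0//.
  rewrite -[in RHS]sqrtr_sqr; congr Num.sqrt.
  have -> : y ^+ 2 = r ^+ 2 - x ^+ 2 by rewrite -xy; ring.
  by field.
have cx : x = r * cos (acos (x / r)) by rewrite acosK ?in_itv//= mulrC divfK.
have := acos_ge0 xr; have := acos_lepi xr => a1 a2.
have [y0|y0] := leP 0 y.
  exists (acos (x / r)); first by apply/andP; split; lra.
  by rewrite sy ger0_norm.
exists (- acos (x / r)); first by apply/andP; split; lra.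
by rewrite cosN sinN mulrN sy ltr0_norm// opprK.
Qed.

Lemma hopf3_surj (v : 'rV[R]_4) : \sum_(i < 4) v 0 i ^+ 2 = 1 ->
  exists x y z, [/\ - pi <= x <= pi, 0 <= y <= pi, - (2 * pi) <= z <= 2 * pi
    & v = hopf3 x y z].
Proof.
set i1 : 'I_4 := lift ord0 ord0; set i2 : 'I_4 := lift ord0 (lift ord0 ord0).
set i3 : 'I_4 := lift ord0 (lift ord0 (lift ord0 ord0)).
rewrite !big_ord_recl big_ord0 -/i1 -/i2 -/i3 addr0 addrA => v1.
set r1 := Num.sqrt (v 0 ord0 ^+ 2 + v 0 i1 ^+ 2).
set r2 := Num.sqrt (v 0 i2 ^+ 2 + v 0 i3 ^+ 2).
have r1E : v 0 ord0 ^+ 2 + v 0 i1 ^+ 2 = r1 ^+ 2 by rewrite sqr_sqrtr// addr_ge0 ?sqr_ge0.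
have r2E : v 0 i2 ^+ 2 + v 0 i3 ^+ 2 = r2 ^+ 2 by rewrite sqr_sqrtr// addr_ge0 ?sqr_ge0.
have r10 : 0 <= r1 by exact: sqrtr_ge0.
have r20 : 0 <= r2 by exact: sqrtr_ge0.
have [s /andP[s1 s2] [xs ys]] := polar r10 r1E.
have [t /andP[t1 t2] [xt yt]] := polar r20 r2E.
have r1le : -1 <= r1 <= 1.
  rewrite -ler_norml -(@ler_pXn2r _ 2)// ?nnegrE// real_normK ?num_real// expr1n.
  by rewrite -v1 r1E r2E lerDl sqr_ge0.
have c1 : cos (acos r1) = r1 by rewrite acosK ?in_itv.
have c2 : sin (acos r1) = r2.
  by rewrite sin_acos// -v1 r1E r2E addrAC subrr add0r sqrtr_sqr ger0_norm.
have ah : acos r1 <= pi / 2.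
  rewrite leNgt; apply/negP => h; have := acos_lepi r1le => hpi.
  have : cos (acos r1) < cos (pi / 2).
    by rewrite ltr_cos ?in_itv//=; apply/andP; split; have := pi_gt0 R; lra.
  by rewrite c1 cos_pihalf ltNge r10.
(* [s] and [t] are arguments of z_1 and z_2, that is x + z / 2 and x - z / 2, and |z_1| = cos (y /
   2). *)
exists ((s + t) / 2), (2 * acos r1), (s - t); split.
- by apply/andP; split; lra.
- by have := acos_ge0 r1le => ?; apply/andP; split; lra.
- by apply/andP; split; lra.
have -> : hopf3 ((s + t) / 2) (2 * acos r1) (s - t) = \row_(i < 4) nth 0 [:: r1 * cos s; r1 * sin s; r2 * cos t; r2 * sin t] i.
  apply/rowP => i; rewrite !mxE.
  have -> : 2 * acos r1 / 2 = acos r1 by field.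
  have -> : (s + t) / 2 + (s - t) / 2 = s by field.
  have -> : (s + t) / 2 - (s - t) / 2 = t by field.
  by rewrite c1 c2.
apply/rowP => i; rewrite mxE; case: i => -[|[|[|[|]]]]//= hi.
- by rewrite -xs; congr (v 0 _); apply: val_inj.
- by rewrite -ys; congr (v 0 _); apply: val_inj.
- by rewrite -xt; congr (v 0 _); apply: val_inj.
- by rewrite -yt; congr (v 0 _); apply: val_inj.
Qed.

(** Contracting the box towards its centre (0, pi / 2, 0) moves boundary points inside, where the
    positivity argument applies; the Lipschitz bound controls the change. *)
Lemma tame_dense (f : R -> R -> R -> R) : tame f ->
  (forall x y z, - pi < x < pi -> 0 < y < pi -> - (2 * pi) < z < 2 * pi -> f x y z = 0) ->
  forall x y z, - pi <= x <= pi -> 0 <= y <= pi -> - (2 * pi) <= z <= 2 * pi -> f x y z = 0.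
Proof.
move=> /tame_lipschitz[C C0 fC] f0 x y z /andP[x1 x2] /andP[y1 y2] /andP[z1 z2].
have pi0 := pi_gt0 R.
apply/eqP; rewrite -normr_le0; apply/ler_addgt0Pr => e e0; rewrite add0r.
pose K := C * (`|x| + `|y - pi / 2| + `|z|) + 1.
have K0 : 0 < K by rewrite ltr_wpDl// mulr_ge0// !addr_ge0.
pose t := Num.min (e / K) (1 / 2).
have t0 : 0 < t by rewrite lt_min !divr_gt0.
have t1 : t <= 1 / 2 by rewrite ge_min lexx orbT.
have tK : t * K <= e by rewrite -ler_pdivlMr// ge_min lexx.
pose x' := (1 - t) * x; pose y' := y - t * (y - pi / 2); pose z' := (1 - t) * z.
have fz : f x' y' z' = 0.
  by apply: f0; apply/andP; split; rewrite /x' /y' /z'; nra.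
have := fC x' y' z' x y z; rewrite fz subr0.
have -> : x - x' = t * x by rewrite /x'; ring.
have -> : y - y' = t * (y - pi / 2) by rewrite /y'; ring.
have -> : z - z' = t * z by rewrite /z'; ring.
rewrite !normrM (gtr0_norm t0) -!mulrDr mulrCA => h; apply: le_trans h _.
by apply: le_trans tK; apply: ler_wpM2l; [exact: ltW|rewrite /K lerDl].
Qed.

(** The powers of a peak are combinations of modes, so [F] is orthogonal to all of them; the
    positivity argument for [F] and for [-1 * F] leaves only the value 0. *)
Lemma hopf_complete F : smooth F ->
  (forall p q k, (k <= p + q)%N -> ip (fun x y z => F (hopf3 x y z)) (@basis_mode R p q k) = 0) ->
  forall v : 'rV[R]_4, \sum_(i < 4) v 0 i ^+ 2 = 1 -> F v = 0.
Proof.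
move=> Fs Fb v /hopf3_surj[x [y [z [xp yp zp ->]]]].
pose w (x y z : R) := F (hopf3 x y z).
have tw : tame w by exact: tame_hopf.
have wp u n : ip w (fun x y z => peak u x y z ^+ n) = 0.
  rewrite -[RHS](ip_peak_mode u n tw (ip_mode_all tw Fb) true 0 0 0 0 1).
  apply: eq_ip => x1 y1 z1; rewrite /mode /phase /weight !subrr !mul0r addr0 cos0 hornerC.
  by rewrite !mulr1.
apply: (@tame_dense w tw _ x y z) => // x0 y0 z0 x0p y0p z0p.
apply/eqP; rewrite eq_le (peak_positive Fs)//=.
rewrite -oppr_le0 -mulN1r.
apply: (@peak_positive (fun v => -1 * F v)) => //.
  by apply: smoothM => //; exact: smooth_cst.
move=> n; rewrite ipC; have tp : tame (fun x y z => peak (hopf3 x0 y0 z0) x y z ^+ n).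
  by apply: tameX; exact: tame_peak.
rewrite (@eq_ip _ _ _ (fun x y z => -1 * w x y z + 0)); last by move=> *; rewrite addr0.
by rewrite ip_linear// ?ip0 ?addr0; [rewrite ipC wp mulr0|exact: tame_cst].
Qed.

End Completeness.

(** * The spectrum of a Berger sphere *)

Section Spectrum.
Variables (R : realType) (a c : R).
Hypotheses (a_gt0 : 0 < a) (c_gt0 : 0 < c).

Lemma ip_gt0 (w : R -> R -> R -> R) x0 y0 z0 : tame w -> w x0 y0 z0 != 0 ->
  - pi < x0 < pi -> 0 < y0 < pi -> - (2 * pi) < z0 < 2 * pi -> 0 < ip w w.
Proof.
move=> tw w0 x0p y0p z0p.
have [C C0 wC] := tame_lipschitz tw.
have [C' C'0 sC] := tame_lipschitz (tame_siny R).
have sy0 : 0 < sin y0 by exact: sin_gt0_pi.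
have w1 : 0 < `|w x0 y0 z0| by rewrite normr_gt0.
pose d := Num.min (`|w x0 y0 z0| / (6 * (C + 1))) (sin y0 / (2 * (C' + 1))).
have C1 : 0 < C + 1 by rewrite ltr_wpDl.
have C'1 : 0 < C' + 1 by rewrite ltr_wpDl.
have d0 : 0 < d by rewrite lt_min !divr_gt0// mulr_gt0.
have d1 : d * (6 * (C + 1)) <= `|w x0 y0 z0| by rewrite -ler_pdivlMr ?mulr_gt0// ge_min lexx.
have d2 : d * (2 * (C' + 1)) <= sin y0 by rewrite -ler_pdivlMr ?mulr_gt0// ge_min lexx orbT.
apply: (@rint_gt0 R _ (sin y0 / 2 * (`|w x0 y0 z0| / 2) ^+ 2) d x0 y0 z0) => //.
- exact: ip_tame.
- by rewrite mulr_gt0 ?exprn_gt0 ?divr_gt0.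
- by move=> x y z yp; rewrite mulr_ge0 ?sin_ge0_pi// -expr2 sqr_ge0.
- move=> x y z hx hy hz.
  have s1 : sin y0 / 2 <= sin y.
    have := sC x0 y0 z0 x0 y z0; rewrite !subrr normr0 add0r addr0 ler_norml => /andP[h _].
    have : C' * `|y - y0| <= C' * d by apply: ler_wpM2l => //; exact: ltW.
    nra.
  have s2 : `|w x0 y0 z0| / 2 <= `|w x y z|.
    have h := wC x0 y0 z0 x y z.
    have h2 : C * (`|x - x0| + `|y - y0| + `|z - z0|) <= C * (3 * d) by apply: ler_wpM2l => //; lra.
    have h3 : `|w x0 y0 z0| <= `|w x y z| + `|w x y z - w x0 y0 z0|.
      by rewrite -{1}(subKr (w x y z) (w x0 y0 z0)) ler_normB.
    nra.
  rewrite -expr2 -[w x y z ^+ 2]real_normK ?num_real//.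
  apply: ler_pM; [by rewrite divr_ge0// ltW|exact: sqr_ge0|exact: s1|].
  by apply: lerXn2r; rewrite ?nnegrE// divr_ge0.
Qed.

Lemma basis_mode_gt0 p q k : 0 < ip (@basis_mode R p q k) (@basis_mode R p q k).
Proof.
have pi0 := pi_gt0 R.
rewrite /basis_mode; set J := jacobi _ _ _ _; set b := real_part p q k.
have [x0 [z0 [x0p z0p ph]]] : exists x0 z0 : R, [/\ - pi < x0 < pi, - (2 * pi) < z0 < 2 * pi
    & phase b (weight (k - q) (q - k) (p - k) (k - p) x0 z0) = 1].
  have wE x z : weight (k - q) (q - k) (p - k) (k - p) x z
      = (p%:Z - q%:Z)%:~R * x + (k%:Z - q%:Z - (p%:Z - k%:Z))%:~R * (z / 2) :> R.
    have -> : (p%:Z - q%:Z) = (k - q)%N%:Z - (q - k)%N%:Z + ((p - k)%N%:Z - (k - p)%N%:Z) by lia.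
    have -> : (k%:Z - q%:Z - (p%:Z - k%:Z)) = (k - q)%N%:Z - (q - k)%N%:Z - ((p - k)%N%:Z - (k - p)%N%:Z) by lia.
    by rewrite /weight !(rmorphD, rmorphN) /= -!pmulrn; ring.
  case bE: b.
    exists 0, 0; split; [by apply/andP; split; lra|by apply/andP; split; lra|].
    by rewrite wE !mul0r !mulr0 addr0 /phase cos0.
  have small (m : int) : m != 0 -> - (pi / 2) <= (pi / 2 / m%:~R : R) <= pi / 2.
    move=> m0; have m1 : 1 <= `|m%:~R : R|.
      by rewrite -intr_norm -[1]/(1%:~R) ler_int; lia.
    have ph0 : 0 <= pi / 2 :> R by lra.
    rewrite -ler_norml normrM normfV (ger0_norm ph0).
    by apply: ler_piMr => //; rewrite invf_le1// (lt_le_trans ltr01).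
  (* By the choice of [real_part], a sine mode has a nonzero frequency in [x] or in [z]; a quarter
     period in that variable makes the phase 1. *)
  have [pq|pq] := eqVneq (p%:Z - q%:Z) 0; last first.
    exists (pi / 2 / (p%:Z - q%:Z)%:~R), 0; have /andP[h1 h2] := small _ pq.
    split; [by apply/andP; split; lra|by apply/andP; split; lra|].
    by rewrite wE mul0r mulr0 addr0 mulrC divfK ?intr_eq0// /phase sin_pihalf.
  set m := (k%:Z - q%:Z - (p%:Z - k%:Z)) in wE *.
  have m0 : m != 0 by rewrite /m; move: bE; rewrite /b /real_part; lia.
  exists 0, (2 * (pi / 2 / m%:~R)); have /andP[h1 h2] := small _ m0.
  split; [by apply/andP; split; lra|by apply/andP; split; lra|].
  rewrite wE mulr0 add0r -/m (_ : m%:~R * _ = pi / 2) ?/phase ?sin_pihalf//.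
  by field; rewrite intr_eq0.
have tJ : tame (fun _ y _ : R => J.[cos (y / 2) ^+ 2]) by apply: tame_horner; auto with tame.
have [C C0 JC] := tame_lipschitz tJ.
pose d := Num.min (1 / (2 * (C + 1))) (pi / 2).
have C1 : 0 < C + 1 by rewrite ltr_wpDl.
have d0 : 0 < d by rewrite lt_min !divr_gt0// mulr_gt0.
have d1 : d * (2 * (C + 1)) <= 1 by rewrite -ler_pdivlMr ?mulr_gt0// ge_min lexx.
have d2 : d <= pi / 2 by rewrite ge_min lexx orbT.
(* At [y = pi] the Jacobi polynomial has its normalized value 1, but a power of [cos (y / 2)] may
   vanish; slightly before, all factors are nonzero. *)
pose y0 := pi - d.
have y0p : 0 < y0 < pi by rewrite /y0; apply/andP; split; lra.
have [c0 s0] := half_gt0 y0p.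
have J0 : J.[cos (y0 / 2) ^+ 2] != 0.
  have yd : y0 - pi = - d by rewrite /y0; ring.
  have := JC 0 pi 0 0 y0 0; rewrite subrr normr0 add0r addr0 yd normrN (gtr0_norm d0).
  rewrite cos_pihalf expr0n horner_coef0 coef_jacobi /= ler_norml => /andP[h _].
  by apply/lt0r_neq0; nra.
apply: (@ip_gt0 _ x0 y0 z0) => //; first exact: tame_mode.
by rewrite /mode ph mulr1 !mulf_neq0// expf_neq0// gt_eqF.
Qed.

Definition bidegree_eigenvalue (p q : nat) : R :=
  (2 * p%:R * q%:R + p%:R + q%:R) / (2 * a) + (p%:R - q%:R) ^+ 2 / c.

Lemma row3_exists (x y z : R) : exists v : 'rV[R]_3, [/\ psi_ v = x, theta_ v = y & phi_ v = z].
Proof.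
exists (\row_(i < 3) nth 0 [:: x; y; z] i).
by rewrite /psi_ /theta_ /phi_ !mxE !inordK.
Qed.

Lemma laplace_beltrami_smooth (h : 'rV[R]_3 -> 'M[R]_3) f l y :
  (forall y, chart y -> h y = berger_metric a c y) ->
  weighted_laplacian a c f l -> chart y ->
  laplace_beltrami h (on3 f) y = on3 l y / sin (theta_ y).
Proof.
move=> hE [fx [fy [fz [Z [D1 [D2 [D3 [[? ? ? ? ? fd1 fd2 fd3 fZ] [[_ D1P] [_ D2P] [_ D3P] E]]]]]]]]] cy.
have -> : on3 l y = on3 D1 y + on3 D2 y + on3 D3 y by rewrite /on3 E.
refine (@laplace_beltrami_berger R a c h f fx fy fz _ _ _ D1 D2 D3 y a_gt0 c_gt0 hE
  _ _ cy (D1P _ _ _) (D2P _ _ _) (D3P _ _ _)).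
  by move=> x t z _; split.
move=> x t z tp; have st : sin t != 0 by rewrite gt_eqF// sin_gt0_pi.
have a0 : a != 0 by rewrite gt_eqF.
by split=> //; rewrite fZ; field; rewrite ?a0 ?st ?gt_eqF.
Qed.

(** The smooth extension provides a Laplacian in divergence form that is tame up to the poles;
    inside the chart it is identified by the explicit computation for modes. *)
Lemma basis_mode_eigenfunction p q k : (k <= p + q)%N ->
  eigenfunction a c (bidegree_eigenvalue p q) (@basis_mode R p q k).
Proof.
move=> kpq.
have [F Fs FE] : hopf_smooth (@basis_mode R p q k) by exact: hopf_smooth_mode.
have [l] := weighted_laplacian_smooth a c Fs.
have -> : (fun x y z => F (hopf3 x y z)) = @basis_mode R p q k.
  by apply/funext => x; apply/funext => y; apply/funext => z; rewrite FE.
move=> wl; exists l => // x y z yp.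
have [v [vx vy vz]] := row3_exists x y z.
have cv : chart v by rewrite /chart /= vy.
have h1 := laplace_beltrami_smooth (fun y _ => erefl (berger_metric a c y)) wl cv.
pose j := minn (minn k (p + q - k)) (minn p q).
have h2 := @laplace_beltrami_mode R a c _ (real_part p q k) (k - q) (q - k) (p - k) (k - p) j v
  a_gt0 c_gt0 (fun y _ => erefl (berger_metric a c y)) _ _ cv.
have mm : ((k - q) * (q - k) = 0)%N.
  by apply/eqP; rewrite muln_eq0; apply/orP; lia.
have nn : ((p - k) * (k - p) = 0)%N.
  by apply/eqP; rewrite muln_eq0; apply/orP; lia.
move: h2 => /(_ mm nn); rewrite [X in X = _]h1.
have -> : (k - q + (p - k) + j = p)%N by rewrite /j; lia.
have -> : (q - k + (k - p) + j = q)%N by rewrite /j; lia.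
rewrite /on3 vx vy vz -/(basis_mode p q k) -/(bidegree_eigenvalue p q) => E.
have sy : sin y != 0 by rewrite gt_eqF// sin_gt0_pi.
by rewrite -[LHS](divfK sy) E; ring.
Qed.

Lemma bidegree_eigenvalue_lt p q d : (0 < d)%N ->
  bidegree_eigenvalue p q < bidegree_eigenvalue (p + d) (q + d).
Proof.
rewrite -(ltr_nat R) /bidegree_eigenvalue !natrD => d0.
have -> : p%:R + d%:R - (q%:R + d%:R) = p%:R - q%:R :> R by ring.
rewrite ltrD2r ltr_pM2r ?invr_gt0 ?mulr_gt0//.
have := (ler0n R p, ler0n R q) => -[? ?]; nra.
Qed.

Lemma basis_mode_orth p q k p' q' k' : (k <= p + q)%N -> (k' <= p' + q')%N ->
  (p, q, k) != (p', q', k') -> ip (@basis_mode R p q k) (@basis_mode R p' q' k') = 0.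
Proof.
move=> kpq kpq' ne.
have [b12|b12] := eqVneq (real_part p q k) (real_part p' q' k'); last first.
  by apply: ip_mode_eq0; left.
have [E|mn] := eqVneq ((k - q)%N%:Z - (q - k)%N%:Z, (p - k)%N%:Z - (k - p)%N%:Z)
  ((k' - q')%N%:Z - (q' - k')%N%:Z, (p' - k')%N%:Z - (k' - p')%N%:Z); last first.
  apply: ip_mode_eq0; right; split=> //.
  (* Conjugate indices have different [real_part] unless both weights are zero, so opposite weights
     with the same part are also equal. *)
  apply: contra mn => /eqP[m0 n0].
  apply/eqP; congr pair; move: b12; rewrite /real_part; lia.
have [m0 n0] := E.
have pp : p != p'.
  apply: contraNneq ne => pp; apply/eqP; congr (_, _, _); lia.
apply: (eigenfunction_orth (basis_mode_eigenfunction kpq) (basis_mode_eigenfunction kpq')).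
have [lt|gt|pE] := ltngtP p p'; last by rewrite pE eqxx in pp.
  have [d [d0 [-> ->]]] : exists d, (0 < d)%N /\ p' = (p + d)%N /\ q' = (q + d)%N.
    by exists (p' - p)%N; lia.
  by rewrite lt_eqF// bidegree_eigenvalue_lt.
have [d [d0 [-> ->]]] : exists d, (0 < d)%N /\ p = (p' + d)%N /\ q = (q' + d)%N.
  by exists (p - p')%N; lia.
by rewrite gt_eqF// bidegree_eigenvalue_lt.
Qed.

End Spectrum.

(** * Dimensions of the eigenspaces *)

Section Eigenspaces.
Variables (R : realType) (a c : R).
Hypotheses (a_gt0 : 0 < a) (c_gt0 : 0 < c).

(** Stating the equation in divergence form for a smooth extension makes linear combinations and
    Green's formula directly available; [page_eigenspaceE] links it to the Laplacian of the
    chart. *)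
Definition sphere_eigenspace (mu : R) : set (S3 R -> R) :=
  [set u | exists2 F : 'rV[R]_4 -> R, smooth F & (forall z : S3 R, u z = F (val z)) /\
     eigenfunction a c mu (fun x y z => F (hopf3 x y z))].

Lemma eigenfunction_linear mu k f g : eigenfunction a c mu f -> eigenfunction a c mu g ->
  eigenfunction a c mu (fun x y z => k * f x y z + g x y z).
Proof.
move=> [l fl fE] [m gm gE]; exists (fun x y z => k * l x y z + m x y z).
  exact: weighted_laplacian_linear.
by move=> x y z yp; rewrite fE// gE//; ring.
Qed.

Lemma sphere_eigenspace_linear mu k u v : sphere_eigenspace mu u ->
  sphere_eigenspace mu v -> sphere_eigenspace mu (k *: u + v).
Proof.
move=> [F Fs [FE Fe]] [G Gs [GE Ge]]; exists (fun z => k * F z + G z).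
  by apply: smoothD => //; apply: smoothM => //; exact: smooth_cst.
by split; [move=> z; rewrite -FE -GE|exact: eigenfunction_linear].
Qed.

Lemma hopf_gradient0 : hopf_gradient (R := R) (fun _ _ _ => 0) (fun _ _ _ => 0) (fun _ _ _ => 0)
  (fun _ _ _ => 0) (fun _ _ _ => 0).
Proof.
by split; try exact: tame_cst; move=> x y z; try exact: der_cst; rewrite !mulr0 addr0.
Qed.

Lemma sphere_eigenspace0 mu : sphere_eigenspace mu 0.
Proof.
exists (fun=> 0); first exact: smooth_cst.
split=> //; exists (fun _ _ _ => 0) => [|x y z _]; last by rewrite !mulr0.
exists (fun _ _ _ => 0), (fun _ _ _ => 0), (fun _ _ _ => 0), (fun _ _ _ => 0),
  (fun _ _ _ => 0), (fun _ _ _ => 0), (fun _ _ _ => 0).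
split; first exact: hopf_gradient0.
split; try (split; [exact: tame_cst|]); move=> x y z.
- under eq_fun do rewrite !mulr0 !mul0r subr0; exact: der_cst.
- under eq_fun do rewrite !mulr0 !mul0r; exact: der_cst.
- under eq_fun do rewrite mul0r; exact: der_cst.
- by rewrite !addr0.
Qed.

Definition basis_extension (i : nat * nat * nat) : 'rV[R]_4 -> R :=
  let: (p, q, k) := i in
  s2val (cid2 (hopf_smooth_mode (real_part p q k) (k - q) (q - k) (p - k) (k - p)
    (jacobi R (k - q + (q - k)) (p - k + (k - p)) (minn (minn k (p + q - k)) (minn p q))))).

Definition mode_of (i : nat * nat * nat) : R -> R -> R -> R :=
  let: (p, q, k) := i in @basis_mode R p q k.

Definition valid (i : nat * nat * nat) : bool := (i.2 <= i.1.1 + i.1.2)%N.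

Lemma smooth_basis_extension i : smooth (basis_extension i).
Proof. by case: i => -[p q] k; rewrite /basis_extension; case: (cid2 _). Qed.

Lemma basis_extensionE i :
  (fun x y z => basis_extension i (hopf3 x y z)) = mode_of i.
Proof.
case: i => -[p q] k; apply/funext => x; apply/funext => y; apply/funext => z.
by rewrite /basis_extension; case: (cid2 _) => F Fs /= FE; exact: esym (FE x y z).
Qed.

Lemma tame_mode_of i : tame (mode_of i).
Proof. by case: i => -[p q] k; exact: tame_mode. Qed.

Lemma mode_of_orth i j : valid i -> valid j -> i != j -> ip (mode_of i) (mode_of j) = 0.
Proof.
case: i j => -[p q] k [[p' q'] k'] vi vj ij.
exact: (basis_mode_orth a_gt0 c_gt0).
Qed.

Lemma mode_of_gt0 i : 0 < ip (mode_of i) (mode_of i).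
Proof. by case: i => -[p q] k; exact: basis_mode_gt0. Qed.

Lemma mode_of_eigenfunction i : valid i ->
  eigenfunction a c (bidegree_eigenvalue a c i.1.1 i.1.2) (mode_of i).
Proof. by case: i => -[p q] k vi; exact: basis_mode_eigenfunction. Qed.

Definition basis_fun i (z : S3 R) : R := basis_extension i (val z).

Lemma ip_sum (w : R -> R -> R -> R) d (k : 'I_d -> R) (f : 'I_d -> R -> R -> R -> R) :
  tame w -> (forall i, tame (f i)) ->
  ip w (fun x y z => \sum_(i < d) k i * f i x y z) = \sum_(i < d) k i * ip w (f i).
Proof.
move=> tw tf; elim: d k f tf => [|d IH] k f tf.
  by rewrite big_ord0 -[RHS](ip0 w); apply: eq_ip => x y z; rewrite big_ord0.
rewrite big_ord_recl -(IH (fun i => k (lift ord0 i)) (fun i => f (lift ord0 i))) => [|i]; last exact: tf.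
rewrite -ip_linear//; first by apply: eq_ip => x y z; rewrite big_ord_recl.
by apply: tame_sum => i; apply: tameM; [exact: tame_cst|exact: tf].
Qed.

Lemma sphere_hopf3 x y z : \sum_(i < 4) (hopf3 x y z : 'rV[R]_4) 0 i ^+ 2 == 1.
Proof. by rewrite hopf3_sphere. Qed.

Lemma sphere_eigenspace_has_dim mu (r : seq (nat * nat * nat)) : uniq r ->
  (forall i, (i \in r) = valid i && (bidegree_eigenvalue a c i.1.1 i.1.2 == mu)) ->
  has_dim (sphere_eigenspace mu) (size r).
Proof.
move=> ur rE; pose m (j : 'I_(size r)) := nth (0, 0, 0)%N r j.
have mr j : m j \in r by exact: mem_nth.
have mv j : valid (m j) by have := mr j; rewrite rE => /andP[].
have me j : bidegree_eigenvalue a c (m j).1.1 (m j).1.2 = mu by have := mr j; rewrite rE => /andP[_ /eqP].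
have orth i j : i != j -> ip (mode_of (m i)) (mode_of (m j)) = 0.
  by move=> ij; apply: mode_of_orth => //; rewrite /m nth_uniq.
pose S (k : 'I_(size r) -> R) (v : 'rV[R]_4) := \sum_(j < size r) k j * basis_extension (m j) v.
have Ss k : smooth (S k).
  rewrite /S; elim: (index_enum _) => [|j s IH].
    by under eq_fun do rewrite big_nil; exact: smooth_cst.
  under eq_fun do rewrite big_cons.
  by apply: smoothD => //; apply: smoothM; [exact: smooth_cst|exact: smooth_basis_extension].
have SE k x y z : S k (hopf3 x y z) = \sum_(j < size r) k j * mode_of (m j) x y z.
  by apply: eq_bigr => j _; rewrite -basis_extensionE.
have ipS i k : ip (mode_of i) (fun x y z => S k (hopf3 x y z)) =
    \sum_(j < size r) k j * ip (mode_of i) (mode_of (m j)).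
  rewrite (eq_ip _ (SE k)); apply: ip_sum; first exact: tame_mode_of.
  by move=> j; exact: tame_mode_of.
have bE k z : (\sum_(j < size r) k j *: basis_fun (m j)) z = S k (val z).
  by rewrite fct_sumE.
exists (fun j => basis_fun (m j)); split=> [u|k k0 j]; last first.
  have : ip (mode_of (m j)) (fun x y z => S k (hopf3 x y z)) = 0.
    rewrite -[RHS](ip0 (mode_of (m j))); apply: eq_ip => x y z.
    have /= := bE k (exist _ (hopf3 x y z) (sphere_hopf3 x y z)); rewrite k0 => <-.
    by [].
  rewrite ipS (bigD1 j)//= big1 => [|i ij]; last by rewrite orth ?mulr0// eq_sym.
  move=> /eqP; rewrite addr0 mulf_eq0 => /orP[/eqP //|].
  by rewrite gt_eqF// mode_of_gt0.
split=> [[F Fs [FE Fe]]|[k ->]]; last first.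
  elim: (index_enum _) => [|j s IH]; first by rewrite big_nil; exact: sphere_eigenspace0.
  rewrite big_cons; apply: sphere_eigenspace_linear => //.
  exists (basis_extension (m j)); first exact: smooth_basis_extension.
  by split=> //; rewrite basis_extensionE -(me j); exact: mode_of_eigenfunction.
pose w (x y z : R) := F (hopf3 x y z).
have tw : tame w by exact: tame_hopf.
pose k j := ip w (mode_of (m j)) / ip (mode_of (m j)) (mode_of (m j)).
exists k; apply/funext => z; rewrite bE FE; apply/eqP; rewrite -subr_eq0; apply/eqP.
have Gs : smooth (fun v => -1 * S k v + F v).
  by apply: smoothD => //; apply: smoothM => //; exact: smooth_cst.
have tS : tame (fun x y z => S k (hopf3 x y z)) by exact: tame_hopf.
rewrite -mulN1r addrC; apply: (hopf_complete Gs); last by apply/eqP; exact: (valP z).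
move=> p q l lpq; rewrite ipC; pose i := (p, q, l).
rewrite ip_linear//; last exact: tame_mode.
have vi : valid i by [].
rewrite -[basis_mode p q l]/(mode_of i) -/w ipS.
(* Modes of [r] are orthogonal to the remainder by the choice of [k]. Any other mode has a different
   eigenvalue, so it is orthogonal to [w] by Green's formula, and to the sum by orthogonality of the
   modes. *)
have [ir|ir] := boolP (i \in r).
  pose j0 : 'I_(size r) := Ordinal (etrans (index_mem i r) ir).
  have mj0 : m j0 = i by rewrite /m nth_index.
  rewrite -mj0 (bigD1 j0)//= big1 => [|j jj]; last by rewrite orth ?mulr0// eq_sym.
  rewrite addr0 /k divfK ?gt_eqF ?mode_of_gt0// [ip w _]ipC.
  by ring.
rewrite big1 => [|j _].
  rewrite mulr0 add0r ipC; apply: (eigenfunction_orth Fe (mode_of_eigenfunction vi)).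
  by move: ir; rewrite rE vi /= eq_sym.
rewrite mode_of_orth ?mulr0//; apply: contraNneq ir => ->; exact: mr.
Qed.

End Eigenspaces.

(** * The spectrum of the stability operator *)

Lemma has_dim_eigenvalue (R : realType) (V : lmodType R) (E : R -> set V) lam d :
  has_dim (E lam) d -> is_eigenvalue E lam <-> (0 < d)%N.
Proof.
move=> [b [bE bfree]]; split=> [[u /bE[k ->]]|].
  by case: d b k bE bfree => // b k _ _; rewrite big_ord0 eqxx.
case: d b bE bfree => // d b bE bfree _; pose k (i : 'I_d.+1) : R := (i == ord0)%:R.
have kE : \sum_(i < d.+1) k i *: b i = b ord0.
  rewrite (bigD1 ord0)//= big1 => [|i /negPf i0]; first by rewrite /k eqxx scale1r addr0.
  by rewrite /k i0 scale0r.
exists (b ord0); first by apply/bE; exists k.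
apply/eqP => b0; have := bfree k (etrans kE b0) ord0.
by rewrite /k eqxx => /eqP; rewrite oner_eq0.
Qed.

Section PageSpectrum.
Variables (R : realType) (nu : R).
Hypothesis nu01 : 0 < nu < 1.
Let a : R := page_S nu * page_B nu 0.
Let c : R := page_S nu * (4 * page_alpha nu ^+ 2 * page_A nu 0).
Let a_gt0 : 0 < a. Proof. by have [] := page_coef_gt0 nu01 (zero_itv R). Qed.
Let c_gt0 : 0 < c. Proof. by have [] := page_coef_gt0 nu01 (zero_itv R). Qed.

Lemma page_eigenspaceE lam :
  page_eigenspace nu 0 lam = sphere_eigenspace a c (lam + 3).
Proof.
have LE (u : S3 R -> R) F l y : (forall z, u z = F (val z)) ->
    weighted_laplacian a c (fun x y z => F (hopf3 x y z)) l -> chart y ->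
    stability_operator (page_metric nu) 0 (u \o @hopf R) y =
    - (on3 l y / sin (theta_ y)) - 3 * u (hopf y).
  move=> uF Fl cy; rewrite /stability_operator page_ricci_nn0// /tr_K2.
  rewrite page_totally_geodesic0// mulmx0 mul0mx mxtrace0 addr0.
  have -> : u \o @hopf R = on3 (fun x y z => F (hopf3 x y z)).
    by apply/funext => v /=; rewrite uF.
  rewrite (laplace_beltrami_smooth a_gt0 c_gt0 _ Fl cy)//; last by move=> v _; exact: page_induced.
  by rewrite [u _]uF.
apply/seteqP; split=> u /=.
  move=> [[F Fs uF] Lu]; exists F => //; split=> //.
  have [l Fl] := weighted_laplacian_smooth a c Fs; exists l => // x y z yp.
  have [v [vx vy vz]] := row3_exists x y z.
  have cv : chart v by rewrite /chart /= vy.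
  have sv := chart_sin_gt0 cv.
  have := Lu v cv; rewrite (LE _ _ _ _ uF Fl cv) uF /on3 vx vy vz.
  have -> : val (hopf v) = hopf3 x y z by rewrite -vx -vy -vz.
  rewrite vy in sv; move: (F _) (l _ _ _) => f L E.
  have -> : L = L / sin y * sin y by rewrite divfK// gt_eqF.
  by rewrite (_ : L / sin y = - ((lam + 3) * f)); [ring|lra].
move=> [F Fs [uF [l Fl lE]]]; split; first by exists F.
move=> y cy; have sy := chart_sin_gt0 cy.
rewrite (LE _ _ _ _ uF Fl cy) uF /on3 lE//.
have -> : val (hopf y) = hopf3 (psi_ y) (theta_ y) (phi_ y) by [].
by field; rewrite gt_eqF.
Qed.

Lemma page_eigenvalueE p q : page_eigenvalue nu (p, q) = bidegree_eigenvalue a c p q - 3.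
Proof.
have [_ _ _ e0] := page_factors_gt0 nu01 (zero_itv R).
have [n0 n1] : 0 < nu ^+ 2 /\ nu ^+ 2 < 1 by case/andP: nu01 => *; split; [exact: exprn_gt0|rewrite expr_lt1 ?ltW].
have h1 : 1 + nu ^+ 2 != 0 by rewrite gt_eqF; lra.
have h2 : 3 - nu ^+ 2 != 0 by rewrite gt_eqF; lra.
have h3 : 3 + nu ^+ 2 != 0 by rewrite gt_eqF; lra.
have h4 : 3 + 6 * nu ^+ 2 - nu ^+ 4 != 0 by rewrite gt_eqF.
rewrite /page_eigenvalue /bidegree_eigenvalue /a /c /page_S /page_B /page_A /page_alpha /page_Lambda /=.
rewrite expr0n /= !mulr0 !subr0 !mulr1 !divr1.
by field; rewrite h1 h2 h3 h4.
Qed.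

(** With n = nu^2, cross-multiplying the comparison of the two coefficients with 3 leaves n (3 - n)
    and 4 n^2, both nonnegative. *)
Lemma page_eigenvalue_lower (p q : nat) :
  3 * ((2 * p%:R * q%:R + p%:R + q%:R) / 2) + 3 * (p%:R - q%:R) ^+ 2 - 3
  <= page_eigenvalue nu (p, q).
Proof.
have [n0 n1] : 0 < nu ^+ 2 /\ nu ^+ 2 < 1.
  by case/andP: nu01 => *; split; [exact: exprn_gt0|rewrite expr_lt1 ?ltW].
have P0 := ler0n R p; have Q0 := ler0n R q.
rewrite /page_eigenvalue /= (_ : nu ^+ 4 = (nu ^+ 2) ^+ 2); last by rewrite -exprM.
move: (nu ^+ 2) (p%:R : R) (q%:R : R) n0 n1 P0 Q0 => n P Q n0 n1 P0 Q0.
rewrite lerD2r; apply: lerD; apply: ler_wpM2r.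
- nra.
- rewrite ler_pdivlMr; nra.
- exact: sqr_ge0.
- rewrite ler_pdivlMr; nra.
Qed.

(** Linear growth in p + q confines each level to a finite square of indices. *)
Lemma page_eigenvalue_ge p q : (p + q)%:R <= page_eigenvalue nu (p, q) + 3.
Proof.
have := page_eigenvalue_lower p q; have P0 := ler0n R p; have Q0 := ler0n R q.
have := mulr_ge0 P0 Q0; have := sqr_ge0 (p%:R - q%:R : R); rewrite natrD; lra.
Qed.

Lemma page_eigenvalue00 : page_eigenvalue nu (0, 0)%N = -3.
Proof. by rewrite page_eigenvalueE /bidegree_eigenvalue; ring. Qed.

Lemma page_eigenvalue_gt0 p q : (0 < p + q)%N -> 0 < page_eigenvalue nu (p, q).
Proof.
move=> pq; apply: lt_le_trans (page_eigenvalue_lower p q).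
have P0 := ler0n R p; have Q0 := ler0n R q; have PQ := mulr_ge0 P0 Q0.
have [E|ne] := eqVneq p q.
  have : 1 <= (p%:R : R) by rewrite ler1n; lia.
  by rewrite -E => P1; nra.
have : 1 <= (p%:R - q%:R : R) ^+ 2.
  have [pq'|] := ltnP p q; last rewrite leq_eqVlt eq_sym (negPf ne) => /= pq'.
    by have : ((p + 1)%:R : R) <= q%:R by [rewrite ler_nat; lia]; rewrite natrD; nra.
  by have : ((q + 1)%:R : R) <= p%:R by [rewrite ler_nat; lia]; rewrite natrD; nra.
have : 1 <= ((p + q)%:R : R) by rewrite ler1n.
rewrite natrD; nra.
Qed.

Lemma page_level_exists lam : exists2 s : seq (nat * nat), uniq s &
  forall i, (i \in s) = (page_eigenvalue nu i == lam).
Proof.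
pose N := (Num.truncn (lam + 3)).+1.
exists [seq i <- allpairs pair (iota 0 N) (iota 0 N) | page_eigenvalue nu i == lam].
  by rewrite filter_uniq// allpairs_uniq ?iota_uniq// => -[? ?] [].
move=> [p q]; rewrite mem_filter; case: eqP => // E; rewrite andTb.
have : ((p + q)%:R : R) < N%:R.
  apply: le_lt_trans (page_eigenvalue_ge p q) _; rewrite E.
  rewrite -truncn_lt_nat//; apply: le_trans (ler0n R (p + q)) _.
  by rewrite -E page_eigenvalue_ge.
rewrite ltr_nat => pqN; apply/allpairsP; exists (p, q); rewrite !mem_iota !leq0n !add0n !andTb.
by split=> //; apply: leq_ltn_trans pqN; [exact: leq_addr|exact: leq_addl].
Qed.

Lemma page_has_spectrum :
  has_spectrum (page_eigenspace nu 0) (page_eigenvalue nu) page_multiplicity.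
Proof.
move=> lam; have [s us sE] := page_level_exists lam; exists s; split=> //.
pose r := [seq (i, k) | i <- s, k <- iota 0 (i.1 + i.2).+1].
have -> : (\sum_(i <- s) page_multiplicity i)%N = size r.
  by rewrite size_allpairs_dep sumnE big_map; apply: eq_bigr => i _; rewrite size_iota.
rewrite page_eigenspaceE; apply: (sphere_eigenspace_has_dim a_gt0 c_gt0).
  apply: allpairs_uniq_dep => //; first by move=> i _; exact: iota_uniq.
  by move=> [? ?] [? ?] _ _ /= [<- <-].
move=> [[p q] k]; rewrite /valid /=.
have <- : (page_eigenvalue nu (p, q) == lam) = (bidegree_eigenvalue a c p q == lam + 3).
  by rewrite page_eigenvalueE subr_eq.
rewrite -sE; apply/allpairsPdep/andP => [[i [l [si li E]]]|[kpq spq]].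
  by case: E li si => <- <-; rewrite mem_iota ltnS /=.
by exists (p, q), k; rewrite mem_iota.
Qed.

(** Two duplicate-free enumerations of a level are permutations of each other, so the dimension can
    be computed from any of them. *)
Lemma page_eigenspace_dim lam s : uniq s ->
  (forall i, (i \in s) = (page_eigenvalue nu i == lam)) ->
  has_dim (page_eigenspace nu 0 lam) (\sum_(i <- s) page_multiplicity i)%N.
Proof.
move=> us sE; have [s' [us' sE' D]] := page_has_spectrum lam.
rewrite (perm_big s')//; apply: uniq_perm => // i; by rewrite sE sE'.
Qed.

Lemma page_eigenspace_dim1 : has_dim (page_eigenspace nu 0 (-3)) 1.
Proof.
have := @page_eigenspace_dim (-3) [:: (0, 0)%N] isT; rewrite big_seq1; apply.
move=> [p q]; rewrite inE; case: eqP => [->|/eqP ne]; first by rewrite page_eigenvalue00 eqxx.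
rewrite gt_eqF//; apply: (@lt_trans _ _ 0); first by rewrite oppr_lt0.
apply: page_eigenvalue_gt0.
by case: p q ne => [|p] [|q].
Qed.

Lemma page_has_nullity : has_nullity (page_eigenspace nu 0) 0.
Proof.
have := @page_eigenspace_dim 0 [::] isT; rewrite big_nil; apply=> -[p q].
have [|pq] := posnP (p + q); last by rewrite gt_eqF// page_eigenvalue_gt0.
case: p q => [|p] [|q]//= _; rewrite page_eigenvalue00 lt_eqF// oppr_lt0//.
Qed.

Lemma page_has_index : has_index (page_eigenspace nu 0) 1.
Proof.
exists [:: -3], (fun=> 1%N); split=> [//|lam|lam|].
- rewrite inE; split=> [/eqP->|[lam0]].
    by split; [rewrite oppr_lt0|apply/(has_dim_eigenvalue page_eigenspace_dim1)].
  have [s [us sE D]] := page_has_spectrum lam; move/(has_dim_eigenvalue D).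
  case: s us sE D => [|[p q] s] _ sE _; first by rewrite big_nil.
  move: (sE (p, q)); rewrite inE eqxx => /esym/eqP E _.
  have [|pq] := posnP (p + q).
    by move: E; case: p q {sE} => [|p] [|q]// <- _; rewrite page_eigenvalue00.
  by have := page_eigenvalue_gt0 pq; rewrite E ltNge (ltW lam0).
- by rewrite inE => /eqP->; exact: page_eigenspace_dim1.
- by rewrite big_seq1.
Qed.

End PageSpectrum.

(** Expanded around 1, the defining polynomial has only positive coefficients, so it has no root
    from 1 on. *)
Lemma page_nu_lt1 (R : realType) (nu : R) :
  nu ^+ 4 + 4 * nu ^+ 3 - 6 * nu ^+ 2 + 12 * nu - 3 = 0 -> nu < 1.
Proof.
move=> E; rewrite ltNge; apply/negP => nu1.
have : 0 < (nu - 1) ^+ 4 + 8 * (nu - 1) ^+ 3 + 12 * (nu - 1) ^+ 2 + 16 * (nu - 1) + 8.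
  have h : 0 <= nu - 1 by rewrite subr_ge0.
  by apply: ltr_wpDl => //; rewrite !addr_ge0// ?exprn_ge0// mulr_ge0// exprn_ge0.
rewrite (_ : _ + 8 = 0) ?ltxx// -E; ring.
Qed.

Theorem theorem1p1 (R : realType) (nu : R) (nu_gt0 : 0 < nu)
    (nu_root : nu ^+ 4 + 4 * nu ^+ 3 - 6 * nu ^+ 2 + 12 * nu - 3 = 0) :
  exists x0 : R,
    [/\ -1 < x0 < 1,
        page_minimal nu x0 &
        forall x : R, -1 < x < 1 -> page_minimal nu x -> x = x0] /\
    [/\ is_berger_sphere (induced_metric (page_metric nu) x0),
        page_totally_geodesic nu x0,
        has_spectrum (page_eigenspace nu x0) (page_eigenvalue nu)
          page_multiplicity,
        has_index (page_eigenspace nu x0) 1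
      & has_nullity (page_eigenspace nu x0) 0].
Proof.
have nu01 : 0 < nu < 1 by rewrite nu_gt0 (page_nu_lt1 nu_root).
exists 0; split; split.
- exact: zero_itv.
- exact: page_minimal0.
- by move=> x x1; exact: page_minimal_unique.
- have [a_gt0 c_gt0] := page_coef_gt0 nu01 (zero_itv R).
  by do 2 eexists; split; [exact: a_gt0|exact: c_gt0|move=> y _; exact: page_induced].
- exact: page_totally_geodesic0.
- exact: page_has_spectrum.
- exact: page_has_index.
- exact: page_has_nullity.
Qed.
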